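(* Let $p=N$ and let $\mathcal{X}$ be an admissible function space. Let $(\mathcal{P}_0')$ denote the problem of minimizing $J(u)$ in the set $\{u\in\mathcal{X}\setminus\{0\}\;|\;V(u)=0\}$. Assume that: (1) $T_0:=\inf\{J(u)\;|\;u\in\mathcal{X},\ u\neq0,\ V(u)=0\}>0$ and $(\mathcal{P}_0')$ admits a minimizer $u_0$; (2) any minimizer $u\in\mathcal{X}$ of $(\mathcal{P}_0')$ is $C^1$ and satisfies, for some $\alpha>0$, the system $-\mathrm{div}(|\nabla u_i|^{p-2}\nabla u_i)=\alpha g_i(u)$ in $\mathcal{D}'(\mathbf{R}^N)$ for $i=1,\dots,m$; (3) whenever $\alpha>0$ and $u\in\mathcal{X}$ satisfies $-\mathrm{div}(|\nabla u_i|^{p-2}\nabla u_i)=\alpha g_i(u)$ in $\mathcal{D}'(\mathbf{R}^N)$ for $i=1,\dots,m$, one has the Pohozaev identity $V(u)=0$. Then the system $-\mathrm{div}(|\nabla u_i|^{p-2}\nabla u_i)=g_i(u)$, $i=1,\dots,m$, admits a least energy solution, and any least energy solution solves $(\mathcal{P}_0')$. Moreover, if in addition, for some $\varepsilon>0$, $G$ is either negative everywhere or positive everywhere on the punctured ball $B_{\mathbf{R}^m}(0,\varepsilon)\setminus\{0\}$, and $u\in\mathcal{X}$ is a least energy solution such that $u(x)\to0$ as $|x|\to\infty$, then $u$ is radially symmetric (up to a translation in $\mathbf{R}^N$).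
   Context: Setting: $m\ge 1$, $1<p<\infty$, $g_1,\dots,g_m$ are real functions on $\mathbf{R}^m$ with $g_i(0)=0$, and there is $G\in C^1(\mathbf{R}^m\setminus\{0\},\mathbf{R})\cap C(\mathbf{R}^m,\mathbf{R})$ such that $g_i(u)=\frac{\partial G}{\partial u_i}(u)$ for $u\ne0$. For $u=(u_1,\dots,u_m):\mathbf{R}^N\to\mathbf{R}^m$ consider the system $$-\mathrm{div}(|\nabla u_i|^{p-2}\nabla u_i)=g_i(u),\qquad i=1,\dots,m. \qquad ( * )$$ Here $|y|^p=\big(\sum_{j=1}^N y_j^2\big)^{p/2}$, and gradients are weak gradients. Notation: for $\sigma>0$, $f_\sigma(x)=f(x/\sigma)$. For an affine hyperplane $\Pi$ in $\mathbf{R}^N$, $\Pi^+$ and $\Pi^-$ are the two closed half-spaces determined by $\Pi$ and $s_\Pi$ is the reflection in $\Pi$; for $f$ defined on $\mathbf{R}^N$, $f_{\Pi^+}(x)=f(x)$ if $x\in\Pi^+$ and $f(s_\Pi(x))$ if $x\in\Pi^-$; $f_{\Pi^-}(x)=f(x)$ if $x\in\Pi^-$ and $f(s_\Pi(x))$ if $x\in\Pi^+$. A space $\mathcal{X}$ of functions on $\mathbf{R}^N$ is admissible if it is nonempty and: (i) $\mathcal{X}\subset L^1_{loc}(\mathbf{R}^N,\mathbf{R}^m)$ and $\{x\;|\;|u(x)|>\alpha\}$ has finite measure for all $u\in\mathcal{X}$, $\alpha>0$; (ii) $g_i(u)\in L^1_{loc}(\mathbf{R}^N)$ for all $u\in\mathcal{X}$,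 $i=1,\dots,m$; (iii) $\sum_{i=1}^m|\nabla u_i|^p$ and $G(u)$ belong to $L^1(\mathbf{R}^N)$ for all $u\in\mathcal{X}$; (iv) $u_\sigma\in\mathcal{X}$ for all $u\in\mathcal{X}$, $\sigma>0$; (v) $u_{\Pi^+},u_{\Pi^-}\in\mathcal{X}$ for all $u\in\mathcal{X}$ and all affine hyperplanes $\Pi$ in $\mathbf{R}^N$. Functionals on $\mathcal{X}$: $J(u)=\frac1p\int_{\mathbf{R}^N}\sum_{i=1}^m|\nabla u_i|^p\,dx$, $V(u)=\int_{\mathbf{R}^N}G(u)\,dx$, $S(u)=J(u)-V(u)$. A function $u\in\mathcal{X}$ is a solution of $( * )$ if it satisfies $( * )$ in $\mathcal{D}'(\mathbf{R}^N)$. A least energy solution is a nontrivial (i.e. $\neq 0$) solution $\underline{u}\in\mathcal{X}$ of $( * )$ with $S(\underline{u})=\inf\{S(u)\;|\;u\in\mathcal{X}\setminus\{0\},\ u\text{ is a solution of }( * )\}$. To ''solve'' a minimization problem means to be a minimizer of it. *)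

(* Defs.v *)
From HB Require Import structures.
From mathcomp Require Import all_boot all_order all_algebra.
From mathcomp Require Import all_classical all_reals all_analysis.

Set Implicit Arguments.
Unset Strict Implicit.
Unset Printing Implicit Defensive.

Import Order.TTheory GRing.Theory Num.Theory.
Import numFieldNormedType.Exports.

Local Open Scope classical_set_scope.
Local Open Scope ring_scope.

Definition measure_rV_display : measure_display.
Proof. exact: default_measure_display. Qed.

Section measurable_rV.
Variables (R : realType) (n : nat).

Let coord (i : 'I_n) (x : 'rV[R]_n) : measurableTypeR R := x ord0 i.

Let rV_set0 : g_sigma_preimage coord set0.
Proof. exact: sigma_algebra0. Qed.

Let rV_setC A : g_sigma_preimage coord A -> g_sigma_preimage coord (~` A).
Proof. exact: sigma_algebraC. Qed.

Let rV_bigcup (F : (set 'rV[R]_n)^nat) :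
  (forall i, g_sigma_preimage coord (F i)) ->
  g_sigma_preimage coord (\bigcup_i (F i)).
Proof. exact: sigma_algebra_bigcup. Qed.

(** R^n is ['rV[R]_n], with the n-fold product of the Borel sigma-algebra of R,
    that is, the Borel sigma-algebra of R^n. *)
HB.instance Definition _ := @isMeasurable.Build measure_rV_display
  'rV[R]_n (g_sigma_preimage coord) rV_set0 rV_setC rV_bigcup.

End measurable_rV.

Section measurable_coord.
Context {R : realType}.

Lemma measurable_coord n (i : 'I_n) :
  measurable_fun [set: 'rV[R]_n] (fun x => x ord0 i : measurableTypeR R).
Proof.
move=> _ Y mY; rewrite setTI; apply: sub_sigma_algebra => /=.
rewrite -bigcup_seq/=; exists i => /=; first by rewrite mem_index_enum.
by exists Y => //; rewrite setTI.
Qed.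

Lemma measurable_fun_rVP d (T : measurableType d) n (f : T -> 'rV[R]_n) :
  (forall i, measurable_fun [set: T] (fun t => f t ord0 i : measurableTypeR R)) ->
  measurable_fun [set: T] f.
Proof.
move=> mf _ A mA; rewrite setTI.
have sub : g_sigma_preimage (fun i (x : 'rV[R]_n) =>
      x ord0 i : measurableTypeR R) `<=` [set B | measurable (f @^-1` B)].
  apply: smallest_sub.
    split.
    - by rewrite /= preimage_set0.
    - by move=> B /= mB; rewrite setTD preimage_setC; exact: measurableC.
    - move=> F mF /=; rewrite preimage_bigcup.
      by apply: bigcup_measurable => k _; exact: mF.
  rewrite -bigcup_seq; apply: bigcup_sub => i _ _ [B mB <-] /=.
  by rewrite setTI; have := mf i measurableT B mB; rewrite setTI.
exact: sub.
Qed.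

End measurable_coord.

Section lebesgue_measure_rV.
Variable R : realType.

Definition cons_rV n (xy : measurableTypeR R * 'rV[R]_n) : 'rV[R]_n.+1 :=
  row_mx (const_mx xy.1 : 'rV[R]_1) xy.2.

Lemma cons_rV0 n xy : @cons_rV n xy ord0 ord0 = xy.1.
Proof.
have := row_mxEl (const_mx xy.1 : 'rV[R]_1) xy.2 ord0 ord0.
rewrite [RHS]mxE => <-; rewrite /cons_rV; congr (row_mx _ _ _ _).
exact/val_inj.
Qed.

Lemma cons_rVS n xy (i : 'I_n) : cons_rV xy ord0 (lift ord0 i) = xy.2 ord0 i.
Proof.
have <- := row_mxEr (const_mx xy.1 : 'rV[R]_1) xy.2 ord0 i.
by rewrite /cons_rV; congr (row_mx _ _ _ _); exact/val_inj.
Qed.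

Lemma measurable_cons_rV n : measurable_fun setT (@cons_rV n).
Proof.
apply: measurable_fun_rVP => i; have [j ->|->] := unliftP ord0 i.
- under eq_fun do rewrite cons_rVS.
  exact: (measurableT_comp (measurable_coord j) measurable_snd).
- under eq_fun do rewrite cons_rV0.
  exact: measurable_fst.
Qed.

Section succ.
Local Open Scope ereal_scope.
Variables (n : nat) (mu : {sigma_finite_measure set 'rV[R]_n -> \bar R}).

Let leb1 : {sigma_finite_measure set (measurableTypeR R) -> \bar R} :=
  @lebesgue_measure R.

Definition lebesgue_rV_succ : set 'rV[R]_n.+1 -> \bar R :=
  pushforward (leb1 \x mu) (@cons_rV n).

Let succ_measure : {measure set 'rV[R]_n.+1 -> \bar R} :=
  measure_function_pushforward__canonical__measure_function_Measure
    (leb1 \x mu) (@measurable_cons_rV n).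

Let succ0 : lebesgue_rV_succ set0 = 0.
Proof. exact: (measure0 succ_measure). Qed.

Let succ_ge0 A : 0 <= lebesgue_rV_succ A.
Proof. exact: (measure_ge0 succ_measure). Qed.

Let succ_sigma_additive : semi_sigma_additive lebesgue_rV_succ.
Proof. exact: (@measure_semi_sigma_additive _ _ _ succ_measure). Qed.

HB.instance Definition _ := isMeasure.Build _ _ _ lebesgue_rV_succ
  succ0 succ_ge0 succ_sigma_additive.

Let uncons (x : 'rV[R]_n.+1) : measurableTypeR R * 'rV[R]_n :=
  (x ord0 ord0, \row_i x ord0 (lift ord0 i)).

Let measurable_uncons : measurable_fun setT uncons.
Proof.
apply/measurable_fun_pairP; split; first exact: measurable_coord.
apply: measurable_fun_rVP => i.
under eq_fun do rewrite /= mxE.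
exact: measurable_coord.
Qed.

Let consK : cancel (@cons_rV n) uncons.
Proof.
move=> [x y]; rewrite /uncons cons_rV0/=; congr pair.
by apply/rowP => i; rewrite mxE cons_rVS.
Qed.

Let succ_sigma_finite : sigma_finite setT lebesgue_rV_succ.
Proof.
have /sigma_finiteP[F [TF ndF Foo]] := sigma_finiteT leb1.
have /sigma_finiteP[G [TG ndG Goo]] := sigma_finiteT mu.
exists (fun k => uncons @^-1` (F k `*` G k)).
  rewrite -preimage_bigcup (_ : \bigcup_k _ = setT) ?preimage_setT//.
  rewrite -subTset => -[x y] _.
  have [a _ Fx] : (\bigcup_k F k) x by rewrite -TF.
  have [b _ Gy] : (\bigcup_k G k) y by rewrite -TG.
  exists (maxn a b) => //; split.
  - by move: x Fx; exact/subsetPset/ndF/leq_maxl.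
  - by move: y Gy; exact/subsetPset/ndG/leq_maxr.
move=> k; have [mF Fk] := Foo k; have [mG Gk] := Goo k.
have mFG : measurable (F k `*` G k) by exact: measurableX.
split; first by rewrite -[X in measurable X]setTI; exact: measurable_uncons.
rewrite /lebesgue_rV_succ /pushforward -comp_preimage.
rewrite (_ : uncons \o _ = idfun); last exact/funext/consK.
by rewrite preimage_id product_measure1E// lte_mul_pinfty// ge0_fin_numE.
Qed.

HB.instance Definition _ := Measure_isSigmaFinite.Build _ _ _
  lebesgue_rV_succ succ_sigma_finite.

End succ.

Fixpoint lebesgue_rV n : {sigma_finite_measure set 'rV[R]_n -> \bar R} :=
  if n is k.+1 then lebesgue_rV_succ (lebesgue_rV k) else \d_(0 : 'rV[R]_0).

Lemma lebesgue_rV_box n (a b : 'rV[R]_n) :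
  (forall i, a ord0 i <= b ord0 i) ->
  lebesgue_rV n [set x | forall i, x ord0 i \in `]a ord0 i, b ord0 i]] =
  (\prod_(i < n) (b ord0 i - a ord0 i))%:E.
Proof.
elim: n => [|n IHn] in a b *.
  by move=> _; rewrite big_ord0 /= diracE mem_set// => -[].
move=> ab; rewrite big_ord_recl EFinM.
pose t (c : 'rV[R]_n.+1) : 'rV[R]_n := \row_i c ord0 (lift ord0 i).
have tab i : t a ord0 i <= t b ord0 i by rewrite !mxE.
have box_measurable k (c d : 'rV[R]_k) :
    measurable [set x : 'rV[R]_k | forall i, x ord0 i \in `]c ord0 i, d ord0 i]].
  rewrite (_ : [set _ | _] = \bigcap_(i in [set: 'I_k])
      ((fun x : 'rV[R]_k => x ord0 i : measurableTypeR R) @^-1`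
       [set` `]c ord0 i, d ord0 i]])); last first.
    by apply/seteqP; split=> x /= h i; [move=> _; exact: h|exact: h].
  apply: fin_bigcap_measurable; first exact: finite_finset.
  by move=> i _; rewrite -[X in measurable X]setTI; exact: measurable_coord.
have -> : lebesgue_rV n.+1
      [set x | forall i, x ord0 i \in `]a ord0 i, b ord0 i]] =
    (@lebesgue_measure R \x lebesgue_rV n)%E
      ([set` `]a ord0 ord0, b ord0 ord0]] `*`
       [set x : 'rV[R]_n | forall i, x ord0 i \in `]t a ord0 i, t b ord0 i]]).
  congr (product_measure1 _ _ _); apply/seteqP; split=> -[x y] /=.
    move=> h; split; first by have := h ord0; rewrite cons_rV0.
    by move=> i; have := h (lift ord0 i); rewrite cons_rVS !mxE.
  move=> [hx hy] i; have [j ->|->] := unliftP ord0 i.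
    by rewrite cons_rVS; have := hy j; rewrite !mxE.
  by rewrite cons_rV0.
rewrite product_measure1E//; last exact: box_measurable.
rewrite IHn//; congr (_ * _)%E.
  rewrite [LHS](lebesgue_measure_itv `]a ord0 ord0, b ord0 ord0])/= lte_fin.
  have := ab ord0; rewrite le_eqVlt => /predU1P[->|->].
    by rewrite ltxx subrr.
  by rewrite EFinB.
by congr EFin; apply: eq_bigr => i _; rewrite !mxE.
Qed.

End lebesgue_measure_rV.

Section euclidean.
Context {R : realType} {n : nat}.
Implicit Types x y a : 'rV[R]_n.

Definition dot x y : R := \sum_(i < n) x ord0 i * y ord0 i.

(** The norm [`|x|] of the library is the sup norm on row vectors. *)
Definition enorm x : R := Num.sqrt (dot x x).

Definition partial (j : 'I_n) (f : 'rV[R]_n -> R) x : R :=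
  'D_(delta_mx ord0 j) f x.

Definition gradient (f : 'rV[R]_n -> R) x : 'rV[R]_n := \row_j partial j f x.

Fixpoint Ck (k : nat) (f : 'rV[R]_n -> R) : Prop :=
  continuous f /\
  if k is k'.+1 then
    forall j, (forall x, derivable f x (delta_mx ord0 j)) /\ Ck k' (partial j f)
  else True.

Definition test_function (phi : 'rV[R]_n -> R) :=
  (forall k, Ck k phi) /\ compact (closure [set x | phi x != 0]).

(** The hyperplane is [{x | dot a x = b}], with [a != 0] and with positive
    side [b <= dot a x]. *)
Definition reflection a (b : R) x := x - (2 * (dot a x - b) / dot a a) *: a.

Definition fold_pos T a (b : R) (f : 'rV[R]_n -> T) x :=
  if b <= dot a x then f x else f (reflection a b x).

Definition fold_neg T a (b : R) (f : 'rV[R]_n -> T) x :=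
  if dot a x <= b then f x else f (reflection a b x).

Definition dilation T (sigma : R) (f : 'rV[R]_n -> T) x := f (sigma^-1 *: x).

End euclidean.

Section weak_derivatives.
Context {R : realType} {N : nat}.
Local Notation leb := (lebesgue_rV R N).
Implicit Types f : 'rV[R]_N -> R.

Definition L1loc f := measurable_fun setT f /\
  forall K : set 'rV[R]_N, compact K -> leb.-integrable K (EFin \o f).

Definition is_weak_gradient f (F : 'rV[R]_N -> 'rV[R]_N) := forall j,
  L1loc (fun x => F x ord0 j) /\
  forall phi, test_function phi ->
    \int[leb]_x (f x * partial j phi x) =
    - \int[leb]_x (F x ord0 j * phi x).

(** A representative of the weak gradient, which is unique up to a.e.
    equality; it is the zero function if there is no weak gradient. *)
Definition weak_gradient f : 'rV[R]_N -> 'rV[R]_N :=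
  xget (fun=> 0) (is_weak_gradient f).

End weak_derivatives.

Section system.
Context {R : realType} {N m : nat}.
Local Notation leb := (lebesgue_rV R N).
Variables (p : R) (g : 'I_m -> 'rV[R]_m -> R) (G : 'rV[R]_m -> R).
Implicit Types u : 'rV[R]_N -> 'rV[R]_m.

Record potential : Prop := Potential {
  potential_g0 : forall i, g i 0 = 0;
  potential_continuous : continuous G;
  potential_derivable : forall i (v : 'rV[R]_m), v != 0 ->
    derivable G v (delta_mx ord0 i);
  potential_C1 : forall i (v : 'rV[R]_m), v != 0 ->
    {for v, continuous (partial i G)};
  potential_g : forall i (v : 'rV[R]_m), v != 0 -> g i v = partial i G v }.

Definition component i u : 'rV[R]_N -> R := fun x => u x ord0 i.

Definition grad u i : 'rV[R]_N -> 'rV[R]_N := weak_gradient (component i u).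

Definition energy_density u x : R := \sum_(i < m) enorm (grad u i x) `^ p.

Definition functionalJ u : R := p^-1 * \int[leb]_x energy_density u x.
Definition functionalV u : R := \int[leb]_x G (u x).
Definition functionalS u : R := functionalJ u - functionalV u.

(** -div(|grad u_i|^(p-2) grad u_i) = h_i(u) in the sense of distributions. *)
Definition weak_solution (h : 'I_m -> 'rV[R]_m -> R) u :=
  forall i phi, test_function phi ->
    \int[leb]_x (enorm (grad u i x) `^ (p - 2) *
                 dot (grad u i x) (gradient phi x)) =
    \int[leb]_x (h i (u x) * phi x).

(** A function [u] is a Borel representative of its class modulo a.e. equality:
    the four notions below only depend on this class. In particular, for the
    continuous representative of [u], the last two are the usual pointwise
    notions. *)
Definition nontrivial u := ~ {ae leb, forall x, u x = 0}.

Definition C1_class u := exists w : 'rV[R]_N -> 'rV[R]_m,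
  (forall i, Ck 1 (component i w)) /\ {ae leb, forall x, u x = w x}.

Definition vanishes_at_infinity u := forall eps : R, 0 < eps ->
  exists r : R, {ae leb, forall x, r < enorm x -> enorm (u x) < eps}.

Definition radially_symmetric u :=
  exists (x0 : 'rV[R]_N) (f : R -> 'rV[R]_m),
    {ae leb, forall x, u x = f (enorm (x - x0))}.

Record admissible (X : set ('rV[R]_N -> 'rV[R]_m)) : Prop := Admissible {
  admissible_nonempty : X !=set0;
  admissible_L1loc : forall u i, X u -> L1loc (component i u);
  admissible_level : forall u (alpha : R), X u -> 0 < alpha ->
    (leb [set x | (alpha < enorm (u x))%R] < +oo)%E;
  admissible_g : forall u i, X u -> L1loc (fun x => g i (u x));
  admissible_grad : forall u i, X u ->
    exists F, is_weak_gradient (component i u) F;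
  admissible_energy : forall u, X u ->
    leb.-integrable setT (EFin \o energy_density u);
  admissible_G : forall u, X u -> leb.-integrable setT (fun x => (G (u x))%:E);
  admissible_dilation : forall u (sigma : R), X u -> 0 < sigma ->
    X (dilation sigma u);
  admissible_fold_pos : forall u a b, X u -> a != 0 -> X (fold_pos a b u);
  admissible_fold_neg : forall u a b, X u -> a != 0 -> X (fold_neg a b u) }.

Definition P0_set (X : set ('rV[R]_N -> 'rV[R]_m)) :=
  [set u | [/\ X u, nontrivial u & functionalV u = 0]].

Definition P0_minimizer X u :=
  P0_set X u /\ forall v, P0_set X v -> functionalJ u <= functionalJ v.

Definition nontrivial_solutions (X : set ('rV[R]_N -> 'rV[R]_m)) :=
  [set u | [/\ X u, nontrivial u & weak_solution g u]].

Definition least_energy_solution X u := nontrivial_solutions X u /\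
  (functionalS u)%:E = ereal_inf
    [set (functionalS v)%:E | v in nontrivial_solutions X].

End system.

(* Main.v *)
From HB Require Import structures.
Require Import Defs.
From mathcomp Require Import all_boot all_order all_algebra.
From mathcomp Require Import all_classical all_reals all_analysis.
From mathcomp Require Import measurable_realfun ring lra.

Set Implicit Arguments.
Unset Strict Implicit.
Unset Printing Implicit Defensive.

Import Order.TTheory GRing.Theory Num.Theory.
Import numFieldNormedType.Exports.

Local Open Scope classical_set_scope.
Local Open Scope ring_scope.

(** In dimension [N = p], the dilation by [sigma] leaves [J] invariant,
    multiplies [V] by [sigma ^ N] and divides the p-Laplacian by [sigma ^ p].
    A minimizer [u0] of [J] under the constraint [V = 0] solves the system up
    to a factor [alpha], so its dilation by [alpha ^ (1/p)] solves the system,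
    with [V = 0] and the same value of [J]. By the Pohozaev identity every
    nontrivial solution satisfies the constraint, hence has [S = J], which is
    at least [J u0]. So the least energy is [J u0], and the least energy
    solutions are minimizers.

    The symmetry is a property of the minimizers, proved by reflection. For
    every hyperplane, the two foldings of [u] satisfy
    [J(u+) + J(u-) = 2 J(u)] and [V(u+) + V(u-) = 2 V(u)]
    ([functionalJ_folds], [functionalV_folds]). Hence a hyperplane that splits
    [V] evenly and leaves both foldings nontrivial gives two more minimizers
    ([fold_minimizer]). As these are [C^1], the normal derivative of [u]
    vanishes on the hyperplane ([vm_derive_eq0]).

    Such a hyperplane exists in every direction ([splitting_hyperplane]):
    [G(u)] has a sign where [u] is small, thus outside of a compact set, and
    the integral of [G(u)] over a half-space moving in this direction changes
    sign between the two supporting hyperplanes of the compact set. Now fold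
    along one such hyperplane for each coordinate direction. The resulting
    minimizer is centrally symmetric, so every hyperplane through the center
    splits [V] evenly, all derivatives tangent to the spheres vanish, and the
    minimizer is radial ([radial_of_central_symmetry]). The foldings are then
    removed one at a time ([radial_of_flip]). If both foldings of a minimizer
    along a hyperplane are radial, their centers lie on this hyperplane and
    coincide, so that the minimizer itself is radial: otherwise the function
    would be periodic in some direction, and a function that vanishes at
    infinity cannot be periodic unless it is zero ([radial_center_on_mirror],
    [radial_of_folds]).

    To identify the energy of a folding, one needs that weak gradients are
    local: functions that agree on a half-space have a.e. the same weak
    gradient there ([weak_gradient_local]). This is the fundamental lemma of
    the calculus of variations ([fundamental_lemma]), applied to test functions
    multiplied by a smooth function that is positive exactly on the open
    half-space. On the other half-space the folding is the composition with a
    reflection, which preserves the Lebesgue measure ([lebesgue_isometry]). *)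

(** * Borel sets of R^n *)

Section boxes.
Context {R : realType} {n : nat}.
Implicit Types a b : 'rV[R]_n.

Definition box a b : set 'rV[R]_n :=
  [set x | forall i, x ord0 i \in `]a ord0 i, b ord0 i]].

Lemma measurable_box a b : measurable (box a b).
Proof.
rewrite (_ : box a b = \bigcap_(i in [set: 'I_n])
    ((fun x : 'rV[R]_n => x ord0 i : measurableTypeR R) @^-1`
     [set` `]a ord0 i, b ord0 i]])); last first.
  by apply/seteqP; split=> x /= h i; [move=> _; exact: h|exact: h].
apply: fin_bigcap_measurable; first exact: finite_finset.
by move=> i _; rewrite -[X in measurable X]setTI; exact: measurable_coord.
Qed.

Lemma box_cover : \bigcup_k box (const_mx (- k%:R)) (const_mx k%:R) = setT.
Proof.
rewrite -subTset => x _.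
have [M hM] : exists M : nat, forall i, `|x ord0 i| < M%:R.
  exists (Num.truncn `|x|).+1 => i.
  apply: le_lt_trans (truncnS_gt _).
  rewrite [leRHS]/Num.norm/= mx_normrE.
  by apply/bigmax_geP; right => /=; exists (ord0, i).
exists M => // i; rewrite !mxE in_itv/=; have := hM i.
by rewrite ltr_norml => /andP[-> /ltW].
Qed.

Lemma boxI a b a' b' : exists c d, box a b `&` box a' b' = box c d.
Proof.
exists (\row_i Num.max (a ord0 i) (a' ord0 i)),
  (\row_i Num.min (b ord0 i) (b' ord0 i)).
apply/seteqP; split=> [x [h h'] i|x h].
  move: (h i) (h' i); rewrite !in_itv/= !mxE gt_max le_min.
  by move=> /andP[-> ->] /andP[-> ->].
by split=> i; have := h i; rewrite !in_itv/= !mxE gt_max le_min;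
  move=> /andP[/andP[? ?] /andP[? ?]]; apply/andP.
Qed.

Definition boxes : set (set 'rV[R]_n) := [set box ab.1 ab.2 | ab in setT].

Lemma measurable_boxes : @measurable _ 'rV[R]_n = <<s boxes >>.
Proof.
apply/seteqP; split; last first.
  apply: smallest_sub; first exact: sigma_algebra_measurable.
  by move=> _ [[a b] _ <-]; exact: measurable_box.
apply: smallest_sub; first exact: smallest_sigma_algebra.
rewrite -bigcup_seq; apply: bigcup_sub => i _ _ [B mB <-]; rewrite setTI.
have [sig0 sigC sigU] := smallest_sigma_algebra setT boxes.
suff: @measurable _ (measurableTypeR R) `<=`
    [set B | <<s boxes >> ((fun x : 'rV[R]_n => x ord0 i) @^-1` B)] by exact.
apply: smallest_sub.
  split=> [|C /= mC|F mF] /=.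
  - by rewrite preimage_set0.
  - by rewrite setTD preimage_setC -setTD; exact: sigC.
  - by rewrite preimage_bigcup; apply: sigU => k; exact: mF.
move=> _ [[s t] _ <-] /=.
pose F k := box (\row_j if j == i then s else - k%:R)
                (\row_j if j == i then t else k%:R).
rewrite (_ : _ @^-1` _ = \bigcup_k F k).
  by apply: sigU => k; apply: sub_sigma_algebra; eexists (_, _).
apply/seteqP; split=> [x /= xst|x [k _ /(_ i)]]; last by rewrite !mxE eqxx.
have : setT x by [].
rewrite -box_cover => -[k _ hk]; exists k => // j; have := hk j; rewrite !mxE.
by case: eqP => [->|].
Qed.

(** The half-open boxes are stable under intersection and generate the Borel
    sets. *)
Lemma box_measure_unique (m1 m2 : {measure set 'rV[R]_n -> \bar R}) :
  (forall a b, m1 (box a b) = m2 (box a b)) ->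
  (forall a b, (m1 (box a b) < +oo)%E) ->
  forall A, measurable A -> m1 A = m2 A.
Proof.
move=> m12 m1oo; apply: (measure_unique boxes
  (fun k => box (const_mx (- k%:R)) (const_mx k%:R))) => //.
- exact: measurable_boxes.
- move=> _ _ [[a b] _ <-] [[c d] _ <-] /=.
  by have [e [f ->]] := boxI a b c d; exists (e, f).
- by move=> k; eexists (_, _).
- exact: box_cover.
- by move=> _ [[a b] _ <-].
Qed.

End boxes.

Section open_sets.
Context {R : realType} {n : nat}.

Lemma rV_ball (x : 'rV[R]_n) (e : R) : 0 < e ->
  ball x e = [set y | forall i, `|x ord0 i - y ord0 i| < e].
Proof.
move=> e0; apply/seteqP; split=> [y [_ h] i|y h]; first exact: h.
by split=> // i j; rewrite ord1; exact: h.
Qed.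

Lemma measurable_rV_ball (x : 'rV[R]_n) (e : R) : 0 < e ->
  measurable (ball x e).
Proof.
move=> e0; have -> : ball x e = \bigcap_(i in [set: 'I_n])
    ((fun y : 'rV[R]_n => y ord0 i : measurableTypeR R) @^-1`
     (ball (x ord0 i) e)).
  rewrite (rV_ball _ e0).
  by apply/seteqP; split=> y /= h i; [move=> _; exact: h|exact: h].
apply: fin_bigcap_measurable; first exact: finite_finset.
move=> i _; rewrite -[X in measurable X]setTI; apply: measurable_coord => //.
exact: (open_measurable (ball_open _ _)).
Qed.

(** Every open set is the union of the balls that it contains and that have
    a rational center and a rational radius. *)
Lemma measurable_rV_open (U : set 'rV[R]_n) : open U -> measurable U.
Proof.
move=> oU.
pose F (qr : 'rV[rat]_n * nat) : set 'rV[R]_n :=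
  [set y | ball (map_mx ratr qr.1 : 'rV[R]_n) qr.2.+1%:R^-1 y /\
           ball (map_mx ratr qr.1 : 'rV[R]_n) qr.2.+1%:R^-1 `<=` U].
rewrite (_ : U = \bigcup_k (if unpickle k is Some qr then F qr else set0)).
  apply: bigcupT_measurable => k; case: unpickle => [qr|//].
  have [h|h] :=
      pselect (ball (map_mx ratr qr.1 : 'rV[R]_n) qr.2.+1%:R^-1 `<=` U).
    rewrite (_ : F qr = ball (map_mx ratr qr.1 : 'rV[R]_n) qr.2.+1%:R^-1).
      by apply: measurable_rV_ball; rewrite invr_gt0.
    by apply/seteqP; split=> y //= -[].
  by rewrite (_ : F qr = set0)//; apply/seteqP; split=> y //= -[].
apply/seteqP; split=> [x Ux|x [k _]]; last first.
  by case: unpickle => // qr [? ]; exact.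
have /nbhs_ballP[e /= e0 xeU] : nbhs x U by exact: open_nbhs_nbhs.
pose k := Num.truncn (e / 2)^-1.
have ke : k.+1%:R^-1 < e / 2.
  by rewrite invf_plt ?posrE ?divr_gt0// truncnS_gt.
have k0 : 0 < k.+1%:R^-1 :> R by rewrite invr_gt0.
have Q i : {q : rat | `|ratr q - x ord0 i| < k.+1%:R^-1}.
  apply: cid; have : x ord0 i - k.+1%:R^-1 < x ord0 i + k.+1%:R^-1.
    by rewrite ltrD2l gtrN.
  move=> /rat_in_itvoo[q]; rewrite in_itv/= => /andP[q1 q2]; exists q.
  by rewrite ltr_norml ltrBrDl q1 ltrBlDl.
exists (pickle (\row_i sval (Q i), k)) => //; rewrite pickleK; split => /=.
  by rewrite rV_ball// => i; rewrite !mxE; exact: (svalP (Q i)).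
move=> y; rewrite rV_ball// => hy; apply: xeU; rewrite rV_ball// => i.
have := hy i; have := svalP (Q i); rewrite !mxE /= => h1 h2.
rewrite (_ : _ - _ = (x ord0 i - ratr (sval (Q i))) +
   (ratr (sval (Q i)) - y ord0 i)); last by rewrite addrA subrK.
apply: (le_lt_trans (ler_normD _ _)); rewrite (splitr e) distrC.
by apply: ltrD; [exact: lt_trans ke|exact: lt_trans ke].
Qed.

Lemma measurable_rV_compact (K : set 'rV[R]_n) : compact K -> measurable K.
Proof.
move=> cK; rewrite -[K]setCK; apply: measurableC; apply: measurable_rV_open.
by apply: closed_openC; exact: (compact_closed (@norm_hausdorff _ _)).
Qed.

Lemma continuous_measurable_rV (f : 'rV[R]_n -> R) : continuous f ->
  measurable_fun setT f.
Proof.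
move=> /continuousP cf.
apply: (measurability _ (RGenOpens.measurableE R)).
move=> _ [_ [a [b ->] <-]]; rewrite setTI.
by apply: measurable_rV_open; apply: cf; exact: interval_open.
Qed.

End open_sets.

Lemma measurable_fun_dot {R : realType} {n : nat} (a : 'rV[R]_n) :
  measurable_fun setT (dot a : 'rV[R]_n -> R).
Proof.
apply: measurable_sum => i; apply: measurable_funM => //.
exact: measurable_coord.
Qed.

(** * Invariance of the Lebesgue measure *)

Section lebesgue_invariance.
Context {R : realType} {n : nat}.
Local Notation leb := (lebesgue_rV R n).
Local Open Scope ereal_scope.

(** The maximum accounts for the empty boxes. *)
Lemma lebesgue_box (a b : 'rV[R]_n) :
  leb (box a b) = (\prod_(i < n) Num.max 0 (b ord0 i - a ord0 i)%R)%:E.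
Proof.
have [ab|] := pselect (forall i, (a ord0 i <= b ord0 i)%R).
  rewrite lebesgue_rV_box//; congr (_%:E); apply: eq_bigr => i _.
  by rewrite max_r// subr_ge0.
move=> /existsNP[i /negP]; rewrite -ltNge => ba.
rewrite (_ : box a b = set0); last first.
  apply/seteqP; split=> x //= /(_ i); rewrite in_itv/= => /andP[ax xb].
  by move: (lt_le_trans ax xb); rewrite ltNge (ltW ba).
rewrite measure0 (bigD1 i)//= max_l ?mul0r//.
by rewrite subr_le0 ltW.
Qed.

Lemma lebesgue_box_fin (a b : 'rV[R]_n) : leb (box a b) < +oo.
Proof. by rewrite lebesgue_box ltry. Qed.

Definition shift_rV (v x : 'rV[R]_n) : 'rV[R]_n := (x + v)%R.

Lemma measurable_shift_rV v : measurable_fun setT (shift_rV v).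
Proof.
apply: measurable_fun_rVP => i; rewrite /shift_rV.
under eq_fun do rewrite !mxE.
by apply: measurable_funD => //; exact: measurable_coord.
Qed.

Lemma lebesgue_shift v (A : set 'rV[R]_n) : measurable A ->
  leb (shift_rV v @^-1` A) = leb A.
Proof.
move=> mA.
pose m : {measure set 'rV[R]_n -> \bar R} :=
  measure_function_pushforward__canonical__measure_function_Measure
    leb (measurable_shift_rV v).
suff E a b : m (box a b) = leb (box a b).
  apply: (@box_measure_unique _ _ m leb) => // a b.
  by rewrite E lebesgue_box_fin.
transitivity (leb (box (a - v)%R (b - v)%R)).
  congr (leb _); apply/seteqP; split=> x /= h i; have := h i;
  by rewrite !in_itv/= !mxE ?ltrBlDr ?lerBrDr.
rewrite !lebesgue_box; congr (_%:E); apply: eq_bigr => i _.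
by rewrite !mxE opprB addrA subrK.
Qed.

Lemma lebesgue_dilation (s : R) (A : set 'rV[R]_n) : (0 < s)%R ->
  measurable A ->
  leb ((fun x => s^-1 *: x)%R @^-1` A) = (s ^+ n)%:E * leb A.
Proof.
move=> s0 mA.
have mf : measurable_fun setT (fun x : 'rV[R]_n => s^-1 *: x)%R.
  apply: measurable_fun_rVP => i; under eq_fun do rewrite !mxE.
  by apply: measurable_funM => //; exact: measurable_coord.
pose m : {measure set 'rV[R]_n -> \bar R} :=
  measure_function_pushforward__canonical__measure_function_Measure leb mf.
have sn0 : (0 <= s ^+ n)%R by rewrite exprn_ge0 ?ltW.
pose m' := mscale (NngNum sn0) leb.
suff E a b : m (box a b) = m' (box a b).
  apply: (@box_measure_unique _ _ m m') => // a b.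
  rewrite E; apply: lte_mul_pinfty; rewrite ?lee_fin//.
  exact: lebesgue_box_fin.
transitivity (leb (box (s *: a)%R (s *: b)%R)).
  congr (leb _); apply/seteqP; split=> x /= h i; have := h i;
  by rewrite !in_itv/= !mxE ![(s * _)%R]mulrC ![(s^-1 * _)%R]mulrC
     ?ltr_pdivlMr ?ler_pdivrMr.
rewrite /m'/= /mscale/= !lebesgue_box -EFinM; congr (_%:E).
have -> : (s ^+ n = \prod_(i < n) s)%R by rewrite prodr_const card_ord.
rewrite -big_split/=; apply: eq_bigr => i _.
by rewrite !mxE -mulrBr maxr_pMr ?mulr0// ltW.
Qed.

(** Both sides are the integral of 1_A(x) 1_B(x + y) over the product of two
    translation invariant measures, computed in the two possible orders. *)
Lemma translation_invariant_swap
    (mu nu : {sigma_finite_measure set 'rV[R]_n -> \bar R}) :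
  (forall v A, measurable A -> mu (shift_rV v @^-1` A) = mu A) ->
  (forall v A, measurable A -> nu (shift_rV v @^-1` A) = nu A) ->
  forall A B, measurable A -> measurable B ->
    mu A * nu B = mu B * nu (-%R @^-1` A).
Proof.
move=> muT nuT A B mA mB.
have mD : measurable_fun setT (fun z : 'rV[R]_n * 'rV[R]_n => z.1 + z.2)%R.
  apply: measurable_fun_rVP => i; under eq_fun do rewrite !mxE.
  apply: measurable_funD.
    exact: (measurableT_comp (measurable_coord i) measurable_fst).
  exact: (measurableT_comp (measurable_coord i) measurable_snd).
pose E : set ('rV[R]_n * 'rV[R]_n) :=
  (fst @^-1` A) `&` ((fun z => z.1 + z.2)%R @^-1` B).
have mE : measurable E.
  apply: measurableI; rewrite -[X in measurable X]setTI.
    exact: measurable_fst.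
  exact: mD.
have mN : measurable_fun setT (-%R : 'rV[R]_n -> 'rV[R]_n).
  apply: measurable_fun_rVP => i; under eq_fun do rewrite !mxE.
  by apply: measurable_funN => //; exact: measurable_coord.
have mS v C : measurable C -> measurable (shift_rV v @^-1` C).
  move=> mC; rewrite -[X in measurable X]setTI.
  exact: measurable_shift_rV.
have mNC C : measurable C -> measurable ((-%R : 'rV[R]_n -> 'rV[R]_n) @^-1` C).
  by move=> mC; rewrite -[X in measurable X]setTI; exact: mN.
have Ex x : \int[nu]_y (\1_E (x, y))%:E = (\1_A x)%:E * nu B.
  transitivity (\int[nu]_y (\1_[set y | E (x, y)] y)%:E); first by [].
  have [Ax|Ax] := pselect (A x).
    have -> : [set y | E (x, y)] = shift_rV x @^-1` B.
      by apply/seteqP; split=> y; rewrite /E /shift_rV/= addrC; [case|split].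
    rewrite integral_indic//; last exact: mS.
    rewrite setIT indicE mem_set// mul1e; exact: nuT.
  rewrite indicE memNset// mul0e (_ : [set y | _] = set0).
    by rewrite integral_indic// set0I measure0.
  by apply/seteqP; split=> y // -[].
(* The translation by [- y] moves the second factor from [B - y] to [B]. *)
have Ey y : \int[mu]_x (\1_E (x, y))%:E = mu (shift_rV (- y)%R @^-1` A `&` B).
  transitivity (\int[mu]_x (\1_[set x | E (x, y)] x)%:E); first by [].
  have -> : [set x | E (x, y)] = A `&` (shift_rV y @^-1` B) by [].
  rewrite integral_indic ?setIT//; last by apply: measurableI => //; exact: mS.
  rewrite -[LHS](muT (- y)%R); last by apply: measurableI => //; exact: mS.
  by congr (mu _); apply/seteqP; split=> x /=; rewrite /shift_rV/= subrK.
pose E' : set ('rV[R]_n * 'rV[R]_n) :=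
  ((fun z => z.1 + - z.2)%R @^-1` A) `&` (fst @^-1` B).
have mE' : measurable E'.
  apply: measurableI; rewrite -[X in measurable X]setTI.
    have -> : (fun z : 'rV[R]_n * 'rV[R]_n => z.1 + - z.2)%R =
        (fun z => z.1 + z.2)%R \o (fun z => (z.1, - z.2)%R) by [].
    apply: (measurableT_comp mD) => //; apply/measurable_fun_pairP; split.
      exact: measurable_fst.
    exact: (measurableT_comp mN measurable_snd).
  exact: measurable_fst.
have E'y y : \int[mu]_x (\1_E' (x, y))%:E = mu (shift_rV (- y)%R @^-1` A `&` B).
  transitivity (\int[mu]_x (\1_[set x | E' (x, y)] x)%:E); first by [].
  rewrite integral_indic//; first by rewrite setIT.
  have -> : [set x | E' (x, y)] = (shift_rV (- y)%R @^-1` A) `&` B by [].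
  by apply: measurableI => //; exact: mS.
have E'x x : \int[nu]_y (\1_E' (x, y))%:E = (\1_B x)%:E * nu (-%R @^-1` A).
  transitivity (\int[nu]_y (\1_[set y | E' (x, y)] y)%:E); first by [].
  have [Bx|Bx] := pselect (B x).
    have -> : [set y | E' (x, y)] = shift_rV (- x)%R @^-1` (-%R @^-1` A).
      apply/seteqP; split=> y; rewrite /E' /shift_rV/= opprB; first by case.
      by split.
    rewrite integral_indic//; last by apply: mS; exact: mNC.
    by rewrite setIT indicE mem_set// mul1e; apply: nuT; exact: mNC.
  rewrite indicE memNset// mul0e (_ : [set y | _] = set0).
    by rewrite integral_indic// set0I measure0.
  by apply/seteqP; split=> y // -[].
have swap (F : set ('rV[R]_n * 'rV[R]_n)) : measurable F ->
    \int[mu]_x \int[nu]_y (\1_F (x, y))%:E =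
    \int[nu]_y \int[mu]_x (\1_F (x, y))%:E.
  move=> mF; apply: (@fubini_tonelli _ _ _ _ _ mu nu (EFin \o \1_F)).
    by apply/measurable_EFinP; exact: measurable_indic.
  by move=> z; rewrite lee_fin.
have intR C k : measurable C -> 0 <= k ->
    \int[mu]_x ((\1_C x)%:E * k) = mu C * k.
  move=> mC k0; rewrite ge0_integralZr//.
  - by rewrite integral_indic// setIT.
  - by apply/measurable_EFinP; exact: measurable_indic.
rewrite -intR// -[RHS]intR//.
under eq_integral do rewrite -Ex.
under [RHS]eq_integral do rewrite -E'x.
rewrite (swap _ mE) (swap _ mE'); apply: eq_integral => y _.
by rewrite Ey E'y.
Qed.

Lemma enorm_ge0 (x : 'rV[R]_n) : (0 <= enorm x)%R.
Proof. exact: sqrtr_ge0. Qed.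

Definition unit_ball := [set x : 'rV[R]_n | dot x x <= 1]%R.

Lemma measurable_unit_ball : measurable unit_ball.
Proof.
rewrite (_ : unit_ball = setT `&` (fun x => dot x x) @^-1` `]-oo, 1%R]).
  have : measurable_fun setT (fun x : 'rV[R]_n => dot x x).
    by apply: measurable_sum => i; apply: measurable_funM;
      exact: measurable_coord.
  by apply=> //; exact: measurable_itv.
by rewrite setTI; apply/seteqP; split=> x; rewrite /unit_ball/= in_itv.
Qed.

Lemma lebesgue_unit_ball_gt0 : 0 < leb unit_ball.
Proof.
pose c : R := n.+1%:R^-1%R.
have c0 : (0 < c)%R by rewrite invr_gt0.
have : leb (box 0%R (const_mx c)) <= leb unit_ball.
  apply: le_measure; rewrite ?inE//.
  - exact: measurable_box.
  - exact: measurable_unit_ball.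
  move=> x xc; rewrite /unit_ball/=.
  apply: (@le_trans _ _ (\sum_(i < n) c)%R).
    apply: ler_sum => i _; have := xc i; rewrite in_itv/= !mxE => /andP[x0 x1].
    rewrite -[leRHS]mulr1; apply: ler_pM => //; rewrite ?(ltW x0)//.
    by apply: (le_trans x1); rewrite invf_le1// ler1n.
  by rewrite sumr_const card_ord -mulr_natl ler_pdivrMr// mul1r ler_nat.
apply: lt_le_trans; rewrite lebesgue_box lte_fin; apply: prodr_gt0 => i _.
by rewrite lt_max !mxE subr0 c0 orbT.
Qed.

Lemma lebesgue_unit_ball_fin : leb unit_ball < +oo.
Proof.
apply: (@le_lt_trans _ _ (leb (box (const_mx (-2)%R) (const_mx 2%R)))).
  apply: le_measure; rewrite ?inE//.
  - exact: measurable_unit_ball.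
  - exact: measurable_box.
  move=> x xB i; rewrite in_itv/= !mxE.
  have : (x ord0 i ^+ 2 <= 1)%R.
    apply: le_trans xB; rewrite /dot (bigD1 i)//= -expr2 lerDl.
    by apply: sumr_ge0 => j _; rewrite -expr2 sqr_ge0.
  by move=> h; apply/andP; split; nra.
exact: lebesgue_box_fin.
Qed.

(** A linear isometry multiplies the Lebesgue measure by a constant, which is
    read off on a ball. *)
Lemma lebesgue_isometry (L : 'rV[R]_n -> 'rV[R]_n) :
  (forall x y, L (x + y) = L x + L y)%R -> involutive L ->
  measurable_fun setT L -> (forall x, enorm (L x) = enorm x) ->
  forall A, measurable A -> leb (L @^-1` A) = leb A.
Proof.
move=> LD LK mL Le A mA.
have mLC C : measurable C -> measurable (L @^-1` C).
  by move=> mC; rewrite -[X in measurable X]setTI; exact: mL.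
pose m : {measure set 'rV[R]_n -> \bar R} :=
  measure_function_pushforward__canonical__measure_function_Measure leb mL.
have sm : sigma_finite setT m.
  have /sigma_finiteP[F [TF ndF Foo]] := sigma_finiteT leb.
  exists (fun k => L @^-1` (F k)); first by rewrite -preimage_bigcup -TF.
  move=> k; have [mF Fk] := Foo k; split; first exact: mLC.
  by rewrite /m/= /pushforward -comp_preimage (_ : L \o L = id)//; exact/funext.
pose sm_mixin := Measure_isSigmaFinite.Build _ _ _ m sm.
pose m' : {sigma_finite_measure set 'rV[R]_n -> \bar R} :=
  HB.pack (m : set _ -> \bar R) (Measure.class m) sm_mixin.
pose B : set 'rV[R]_n := unit_ball.
have mB : measurable B by exact: measurable_unit_ball.
have LN x : L (- x)%R = (- L x)%R.
  apply/eqP; rewrite -addr_eq0 -LD addNr.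
  by rewrite -[X in X == _](addrK (L 0)%R) -LD addr0 subrr.
have shm v C : measurable C -> m' (shift_rV v @^-1` C) = m' C.
  move=> mC; rewrite -[RHS](lebesgue_shift (L v)) //; last exact: mLC.
  congr (leb _); apply/seteqP; split=> x /=; rewrite /shift_rV/= LD LK//.
have LB : L @^-1` B = B.
  have E (x : 'rV[R]_n) : (dot x x <= 1)%R = (enorm x <= 1)%R.
    by rewrite -[in RHS]sqrtr1 ler_sqrt.
  by apply/seteqP; split=> x; rewrite /B/unit_ball/= !E Le.
have NB : (-%R : 'rV[R]_n -> 'rV[R]_n) @^-1` B = B.
  have E x : dot (- x)%R (- x)%R = dot x x.
    by apply: eq_bigr => i _; rewrite !mxE mulrNN.
  by apply/seteqP; split=> x; rewrite /B/unit_ball/= E.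
have := @translation_invariant_swap m' leb shm lebesgue_shift B A mB mA.
have -> : m' B = leb B by rewrite -[in RHS]LB.
rewrite NB => E.
have B0 : 0 < leb B by exact: lebesgue_unit_ball_gt0.
have Boo : leb B < +oo by exact: lebesgue_unit_ball_fin.
have Bf : leb B \is a fin_num by rewrite ge0_fin_numE// measure_ge0.
move: E; rewrite [RHS]muleC => E.
apply/eqP; rewrite eq_le -(lee_pmul2l Bf B0).
by rewrite -[X in _ && X](lee_pmul2l Bf B0) E lexx.
Qed.

End lebesgue_invariance.

(** * Change of variables *)

Section change_of_variables.
Context {R : realType} {n : nat}.
Local Notation leb := (lebesgue_rV R n).
Local Open Scope ereal_scope.

(** [T] is a change of variables with constant Jacobian determinant
    [c^-1]. *)
Definition scales_lebesgue (c : R) (T : 'rV[R]_n -> 'rV[R]_n) :=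
  measurable_fun setT T /\
  forall A, measurable A -> leb (T @^-1` A) = c%:E * leb A.

Variables (c : R) (T : 'rV[R]_n -> 'rV[R]_n).
Hypotheses (c0 : (0 < c)%R) (sT : scales_lebesgue c T).

Let mT : measurable_fun setT T := sT.1.

Lemma measurable_preimage_scaling A : measurable A -> measurable (T @^-1` A).
Proof. by move=> mA; rewrite -[X in measurable X]setTI; exact: mT. Qed.

Lemma ge0_integral_scaling D (f : 'rV[R]_n -> \bar R) : measurable D ->
  measurable_fun setT f -> (forall x, 0 <= f x) ->
  \int[leb]_(x in T @^-1` D) f (T x) = c%:E * \int[leb]_(x in D) f x.
Proof.
move=> mD mf f0.
have c0' : (0 <= c)%R by exact: ltW.
rewrite -(@ge0_integral_mscale _ _ _ _ _ mD (NngNum c0'))//; last first.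
  exact: measurable_funTS.
transitivity (\int[pushforward leb T]_(y in D) f y).
  by rewrite ge0_integral_pushforward//; exact: measurable_funTS.
by apply: eq_measure_integral => A mA AD; have := sT.2 _ mA.
Qed.

(** If [f] is not integrable, the two sides degenerate to the same infinite
    value, because [c] is positive. *)
Lemma integral_scaling D (f : 'rV[R]_n -> \bar R) : measurable D ->
  measurable_fun setT f ->
  \int[leb]_(x in T @^-1` D) f (T x) = c%:E * \int[leb]_(x in D) f x.
Proof.
move=> mD mf; rewrite integralE [in RHS]integralE.
rewrite -/(f \o T) funepos_comp funeneg_comp.
rewrite !ge0_integral_scaling//; [|exact: measurable_funeneg|
  exact: measurable_funepos].
set a := \int[_]_(x in D) _; set b := \int[_]_(x in D) _.
have a0 : 0 <= a by exact: integral_ge0.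
have b0 : 0 <= b by exact: integral_ge0.
case: a a0 => [a| |//] a0; case: b b0 => [b| |//] b0.
- by rewrite -!EFinM -!EFinB mulrBr.
- by rewrite /= !gt0_muley ?gt0_muleNy ?lte_fin.
- by rewrite /= !gt0_muley ?lte_fin.
- by rewrite /= !gt0_muley ?gt0_muleNy ?lte_fin.
Qed.

(** An infinite integral has the real value 0 on both sides. *)
Lemma Rintegral_scaling D (f : 'rV[R]_n -> R) : measurable D ->
  measurable_fun setT f ->
  (\int[leb]_(x in T @^-1` D) f (T x) = c * \int[leb]_(x in D) f x)%R.
Proof.
move=> mD mf; rewrite /Rintegral (@integral_scaling D (EFin \o f))//; last first.
  exact/measurable_EFinP.
case: (\int[leb]_(x in D) _) => [r| |]//=.
  by rewrite gt0_muley ?lte_fin//= mulr0.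
by rewrite gt0_muleNy ?lte_fin//= mulr0.
Qed.

Lemma integrable_scaling D (f : 'rV[R]_n -> R) : measurable D ->
  measurable_fun setT f -> leb.-integrable D (EFin \o f) ->
  leb.-integrable (T @^-1` D) (EFin \o (f \o T)).
Proof.
move=> mD mf /integrableP[_ fD]; apply/integrableP; split.
  apply/measurable_EFinP; apply: measurable_funTS.
  exact: measurableT_comp.
rewrite (@integral_scaling D (fun x => `|(f x)%:E|))//.
  by apply: lte_mul_pinfty => //; rewrite lee_fin ltW.
by apply: measurableT_comp => //; exact/measurable_EFinP.
Qed.

Lemma ae_scaling (P : 'rV[R]_n -> Prop) :
  {ae leb, forall x, P x} -> {ae leb, forall x, P (T x)}.
Proof.
move=> [Z [mZ Z0 PZ]]; exists (T @^-1` Z); split.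
- exact: measurable_preimage_scaling.
- by rewrite sT.2// [X in _ * X]Z0 mule0.
- by move=> x /= nP; exact: PZ.
Qed.

End change_of_variables.

Section scalings.
Context {R : realType} {n : nat}.
Local Notation leb := (lebesgue_rV R n).
Implicit Types (a x : 'rV[R]_n) (b : R).

Lemma continuous_measurable_rV_rV (T : 'rV[R]_n -> 'rV[R]_n) :
  continuous T -> measurable_fun setT T.
Proof.
move=> cT; apply: measurable_fun_rVP => i; apply: continuous_measurable_rV => x.
exact: (continuous_comp (cT x) (@coord_continuous R 1 n ord0 i (T x))).
Qed.

Lemma dilation_scales (s : R) : 0 < s ->
  scales_lebesgue (s ^+ n) (fun x : 'rV[R]_n => s^-1 *: x).
Proof.
move=> s0; split; last by move=> A; exact: lebesgue_dilation.
by apply: continuous_measurable_rV_rV; exact: scaler_continuous.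
Qed.

Lemma isometry_scales (L : 'rV[R]_n -> 'rV[R]_n) v :
  (forall x y, L (x + y) = L x + L y) -> involutive L -> continuous L ->
  (forall x, enorm (L x) = enorm x) ->
  scales_lebesgue 1 (fun x => L x + v).
Proof.
move=> LD LK cL Le.
have mL : measurable_fun setT L by exact: continuous_measurable_rV_rV.
split; first exact: (measurableT_comp (measurable_shift_rV v)).
move=> A mA; rewrite mul1e -[RHS](lebesgue_shift v)//.
apply: (@lebesgue_isometry _ _ L) => //.
by rewrite -[X in measurable X]setTI; exact: measurable_shift_rV.
Qed.

Lemma dotC x y : dot x y = dot y x.
Proof. by apply: eq_bigr => i _; rewrite mulrC. Qed.

Lemma dotDl x y z : dot (x + y) z = dot x z + dot y z.
Proof. by rewrite -big_split; apply: eq_bigr => i _; rewrite mxE mulrDl. Qed.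

Lemma dotZl k x z : dot (k *: x) z = k * dot x z.
Proof. by rewrite mulr_sumr; apply: eq_bigr => i _; rewrite mxE mulrA. Qed.

Lemma dotDr x y z : dot z (x + y) = dot z x + dot z y.
Proof. by rewrite dotC dotDl !(dotC z). Qed.

Lemma dotZr k x z : dot z (k *: x) = k * dot z x.
Proof. by rewrite dotC dotZl !(dotC z). Qed.

Lemma dotNl x z : dot (- x) z = - dot x z.
Proof. by rewrite -scaleN1r dotZl mulN1r. Qed.

Lemma dotNr x z : dot z (- x) = - dot z x.
Proof. by rewrite dotC dotNl dotC. Qed.

Lemma dot_ge0 x : 0 <= dot x x.
Proof. by apply: sumr_ge0 => i _; rewrite -expr2 sqr_ge0. Qed.

Lemma dot_eq0 x : (dot x x == 0) = (x == 0).
Proof.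
apply/idP/eqP => [|->]; last by rewrite /dot big1// => i _; rewrite mxE mul0r.
rewrite psumr_eq0; last by move=> i _; rewrite -expr2 sqr_ge0.
move=> /allP h; apply/rowP => i; have := h i (mem_index_enum i).
by rewrite /= mulf_eq0 orbb mxE => /eqP.
Qed.

Lemma dot_gt0 x : x != 0 -> 0 < dot x x.
Proof. by move=> x0; rewrite lt_def dot_eq0 x0 dot_ge0. Qed.

Lemma continuous_dot a : continuous (dot a : 'rV[R]_n -> R).
Proof.
move=> x; apply: (@continuous_big _ _ _ _ xpredT add_continuous) => i _ y.
exact: (cvgM (cvg_cst _) (@coord_continuous _ _ _ _ _ y)).
Qed.

Lemma reflectionE a b x :
  reflection a b x = reflection a 0 x + (2 * b / dot a a) *: a.
Proof.
by apply/rowP => i; rewrite /reflection subr0 !mxE; ring.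
Qed.

Lemma reflectionD a x y :
  reflection a 0 (x + y) = reflection a 0 x + reflection a 0 y.
Proof.
rewrite /reflection !subr0 dotDr mulrDr mulrDl scalerDl opprD.
by rewrite addrACA.
Qed.

Lemma reflectionK a b : a != 0 -> involutive (reflection a b).
Proof.
move=> /dot_gt0 a0 x; rewrite /reflection -addrA -opprD -scalerDl.
rewrite dotDr dotNr dotZr -[RHS]subr0 -(scale0r a); congr (_ - _ *: _).
by field; rewrite gt_eqF.
Qed.

Lemma dot_reflection a b x : a != 0 ->
  dot a (reflection a b x) = 2 * b - dot a x.
Proof.
move=> /dot_gt0 a0; rewrite /reflection dotDr dotNr dotZr.
by field; rewrite gt_eqF.
Qed.

Lemma enorm_reflection a x : a != 0 -> enorm (reflection a 0 x) = enorm x.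
Proof.
move=> /dot_gt0 a0; rewrite /enorm /reflection subr0; congr Num.sqrt.
rewrite !(dotDr, dotDl, dotNr, dotNl, dotZr, dotZl) (dotC x a).
by field; rewrite gt_eqF.
Qed.

Lemma continuous_reflection a b : continuous (reflection a b).
Proof.
move=> x; apply: (cvgB (@cvg_id _ _)); apply: (cvgZ _ (cvg_cst _)).
apply: (cvgM _ (cvg_cst _)); apply: (cvgM (cvg_cst _)).
exact: (cvgB (@continuous_dot _ x) (cvg_cst _)).
Qed.

Lemma reflection_scales a b : a != 0 -> scales_lebesgue 1 (reflection a b).
Proof.
move=> a0; rewrite (_ : reflection a b =
  fun x => reflection a 0 x + (2 * b / dot a a) *: a).
  apply: isometry_scales.
  - exact: reflectionD.
  - exact: reflectionK.
  - exact: continuous_reflection.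
  - by move=> x; exact: enorm_reflection.
by apply/funext => x; rewrite reflectionE.
Qed.

Lemma point_reflection_scales (v : 'rV[R]_n) :
  scales_lebesgue 1 (fun x => - x + v).
Proof.
apply: isometry_scales.
- by move=> x y; rewrite opprD.
- exact: opprK.
- exact: opp_continuous.
- by move=> x; rewrite /enorm dotNr dotNl opprK.
Qed.

End scalings.

(** * Functions with continuous partial derivatives *)

Section derivative_along_a_line.
Context {R : realType} {n : nat}.
Implicit Types (f : 'rV[R]_n -> R) (x v : 'rV[R]_n).

Lemma is_derive_line f x v (t : R) : derivable f (x + t *: v) v ->
  is_derive t 1 (fun s : R => f (x + s *: v)) ('D_v f (x + t *: v)).
Proof.
move=> df; have E : (fun h : R => h^-1 *:
    (((fun s : R => f (x + s *: v)) \o shift t) (h *: 1) - f (x + t *: v))) =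
    (fun h => h^-1 *: ((f \o shift (x + t *: v)) (h *: v) - f (x + t *: v))).
  apply/funext => h /=; congr (_ *: (f _ - _)).
  by rewrite [h%:A]mulr1 scalerDl addrCA addrC.
by apply: DeriveDef; rewrite /derivable /derive E.
Qed.

End derivative_along_a_line.

Section frechet.
Context {R : realType} {n : nat}.
Implicit Types (f : 'rV[R]_n -> R) (x v h : 'rV[R]_n).

Lemma dot_is_linear (a : 'rV[R]_n) : linear (dot a : 'rV[R]_n -> R^o).
Proof. by move=> k u v; rewrite dotDr dotZr. Qed.

HB.instance Definition _ (a : 'rV[R]_n) :=
  GRing.isLinear.Build R 'rV[R]_n R^o _ (dot a) (@dot_is_linear a).

Lemma coord_ler_norm x i : `|x ord0 i| <= `|x|.
Proof.
by rewrite [leRHS]/Num.norm/= mx_normrE; apply/bigmax_geP; right;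
  exists (ord0, i).
Qed.

Definition truncate_rV (k : nat) h : 'rV[R]_n :=
  \row_i if (i < k)%N then h ord0 i else 0.

Lemma truncate_rVS h (k : 'I_n) :
  truncate_rV k.+1 h = truncate_rV k h + h ord0 k *: delta_mx ord0 k.
Proof.
apply/rowP => i; rewrite !mxE ltnS leq_eqVlt eqxx/=.
have [->|ik] := eqVneq i k; first by rewrite eqxx ltnn/= mulr1 add0r.
by rewrite mulr0 addr0 (_ : (i == k :> nat) = false)//; apply/negbTE.
Qed.

Lemma ler_norm_rV x (e : R) : 0 <= e -> (forall i, `|x ord0 i| <= e) ->
  `|x| <= e.
Proof.
move=> e0 h; rewrite [leLHS]/Num.norm/= mx_normrE.
by apply: bigmax_le => // -[i j] _ /=; rewrite ord1.
Qed.

(** Each step of the polygonal path from [x] to [x + h] that changes one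
    coordinate is controlled by the mean value theorem. *)
Lemma Ck1_littleo f x : Ck 1 f -> forall e : R, 0 < e ->
  \forall h \near (0 : 'rV[R]_n),
    `|f (x + h) - f x - dot (gradient f x) h| <= e * `|h|.
Proof.
move=> [cf df] e e0.
pose e' := e / n.+1%:R.
have e'0 : 0 < e' by rewrite divr_gt0.
have : \forall y \near x, forall j, `|partial j f x - partial j f y| < e'.
  apply: (@filter_forall _ _ (fun j y => `|partial j f x - partial j f y| < e')
    (nbhs x)) => j.
  have [_ [cj _]] := df j.
  by have /cvgrPdist_lt := cj x; apply.
move=> /nbhs_ballP[d /= d0 hd].
near=> h.
have hh : `|h| < d.
  near: h; apply/nbhs_ballP; exists d => //= h.
  by rewrite -ball_normE/= sub0r normrN.
have step (k : 'I_n) : `|f (x + truncate_rV k.+1 h) - f (x + truncate_rV k h) -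
    h ord0 k * partial k f x| <= e' * `|h|.
  rewrite truncate_rVS addrA; set z := x + truncate_rV k h.
  set c := h ord0 k.
  have dg (t : R) : is_derive t 1 (fun s : R => f (z + s *: delta_mx ord0 k))
      (partial k f (z + t *: delta_mx ord0 k)).
    by apply: is_derive_line; have [+ _] := df k; exact.
  have cz t : `|t| <= `|c| -> `|c * (partial k f (z + t *: delta_mx ord0 k) -
      partial k f x)| <= e' * `|h|.
    move=> tc; rewrite normrM mulrC; apply: ler_pM => //; last first.
      exact: coord_ler_norm.
    rewrite distrC; apply/ltW/hd; rewrite -ball_normE/=.
    rewrite opprD addrA opprD addrA subrr sub0r -opprD normrN.
    apply: le_lt_trans hh; apply: ler_norm_rV => // i; rewrite !mxE eqxx/=.
    case: ltnP => ik.
      have -> : (i == k) = false.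
        by apply: contraTF ik => /eqP ->; rewrite ltnn.
      by rewrite mulr0 addr0; exact: coord_ler_norm.
    rewrite add0r; case: (i == k); last by rewrite mulr0 normr0.
    by rewrite mulr1; apply: (le_trans tc); exact: coord_ler_norm.
  have cg : continuous (fun s : R => f (z + s *: delta_mx ord0 k)).
    move=> t; apply/differentiable_continuous/derivable1_diffP.
    by have [] := dg t.
  have [c0|c0|c0] := ltgtP c 0.
  - have [t] := MVT c0 (fun s _ => dg s) (continuous_subspaceT cg).
    rewrite scale0r addr0 sub0r in_itv/= => /andP[t1 t2].
    move=> /(congr1 -%R); rewrite opprB => ->.
    rewrite mulrN opprK mulrC -mulrBr; apply: cz.
    by rewrite !ltr0_norm// lerN2 ltW.
  - have [t] := MVT c0 (fun s _ => dg s) (continuous_subspaceT cg).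
    rewrite scale0r addr0 subr0 in_itv/= => /andP[t1 t2] ->.
    by rewrite mulrC -mulrBr; apply: cz; rewrite !gtr0_norm// ltW.
  - by rewrite c0 scale0r addr0 subrr mul0r subr0 normr0 mulr_ge0// ltW.
have -> : f (x + h) - f x - dot (gradient f x) h =
    \sum_(k < n) (f (x + truncate_rV k.+1 h) - f (x + truncate_rV k h) -
    h ord0 k * partial k f x).
  rewrite big_split/= sumrN; congr (_ - _); last first.
    by apply: eq_bigr => k _; rewrite mxE mulrC.
  rewrite -(big_mkord xpredT
    (fun k => f (x + truncate_rV k.+1 h) - f (x + truncate_rV k h))).
  rewrite telescope_sumr//; congr (f (x + _) - f _).
    by apply/rowP => i; rewrite mxE ltn_ord.
  by rewrite -[LHS]addr0; congr (_ + _); apply/rowP => i; rewrite !mxE.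
apply: (le_trans (ler_norm_sum _ _ _)).
apply: (@le_trans _ _ (\sum_(k < n) e' * `|h|)); first exact: ler_sum.
rewrite sumr_const card_ord -mulr_natl mulrA; apply: ler_wpM2r => //.
rewrite /e' mulrCA; apply: ler_piMr; first exact: ltW.
by rewrite ler_pdivrMr// mul1r ler_nat.
Unshelve. all: by end_near. Qed.

(** Continuous partial derivatives give the Frechet derivative, hence all
    directional derivatives. *)
Lemma Ck1_diff f x : Ck 1 f ->
  differentiable f x /\ forall v, 'D_v f x = dot v (gradient f x).
Proof.
move=> f1.
have E : f \o shift x = cst (f x) + dot (gradient f x) +o_ (0 : 'rV[R]_n) id.
  apply/eqaddoP => e e0; have := Ck1_littleo x f1 e0.
  apply: filterS => h /=; rewrite (_ : (f \o shift x - _) h =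
    f (x + h) - f x - dot (gradient f x) h)//.
  by rewrite !fctE/= opprD addrA [h + x]addrC.
have cd : continuous (dot (gradient f x) : 'rV[R]_n -> R^o).
  exact: continuous_dot.
have dE := diff_unique cd E.
have df : differentiable f x by apply/diff_locallyP; rewrite dE; split.
by split=> // v; rewrite deriveE// dE dotC.
Qed.

End frechet.

Section Ck_closure.
Context {R : realType} {n : nat}.
Implicit Types (f g : 'rV[R]_n -> R) (k : nat).

Lemma Ck_continuous k f : Ck k f -> continuous f.
Proof. by case: k => [|k] []. Qed.

Lemma CkS k f : Ck k.+1 f <-> [/\ continuous f,
  forall j x, derivable f x (delta_mx ord0 j) & forall j, Ck k (partial j f)].
Proof.
split=> [[cf df]|[cf df pf]].
  by split=> // j; have [] := df j.
by split=> // j; split.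
Qed.

Lemma CkW k f : Ck k.+1 f -> Ck k f.
Proof.
elim: k f => [|k IHk] f /CkS[cf df pf]; first by [].
by apply/CkS; split=> // j; apply: IHk.
Qed.

Lemma CkS_Ck1 k f : Ck k.+1 f -> Ck 1 f.
Proof. by elim: k => // k IHk /CkW. Qed.

Lemma Ck_cst k (c : R) : Ck k (cst c : 'rV[R]_n -> R).
Proof.
elim: k c => [|k IHk] c.
  by split=> //; exact: cst_continuous.
apply/CkS; split=> [|j x|j]; [exact: cst_continuous|exact: derivable_cst|].
rewrite (_ : partial j (cst c) = cst 0)//.
by apply/funext => x; exact: derive_cst.
Qed.

Lemma CkD k f g : Ck k f -> Ck k g -> Ck k (f \+ g).
Proof.
elim: k f g => [|k IHk] f g.
  by move=> [cf _] [cg _]; split=> // x; exact: (cvgD (cf x) (cg x)).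
move=> /CkS[cf df pf] /CkS[cg dg pg]; apply/CkS; split=> [x|j x|j].
- by exact: (cvgD (cf x) (cg x)).
- exact: derivableD.
- rewrite (_ : partial j _ = partial j f \+ partial j g); first exact: IHk.
  by apply/funext => x; exact: deriveD.
Qed.

Lemma CkM k f g : Ck k f -> Ck k g -> Ck k (f \* g).
Proof.
elim: k f g => [|k IHk] f g.
  by move=> [cf _] [cg _]; split=> // x; exact: (cvgM (cf x) (cg x)).
move=> f1 g1; have [f0 g0] := (CkW f1, CkW g1).
move: f1 g1 => /CkS[cf df pf] /CkS[cg dg pg]; apply/CkS; split=> [x|j x|j].
- by exact: (cvgM (cf x) (cg x)).
- exact: derivableM.
- rewrite (_ : partial j _ = (f \* partial j g) \+ (g \* partial j f)).
    by apply: CkD; apply: IHk.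
  by apply/funext => x; exact: deriveM.
Qed.

Lemma CkZ k c f : Ck k f -> Ck k (fun x => c * f x).
Proof. by move=> f1; exact: (CkM (Ck_cst k c) f1). Qed.

Lemma Ck_sum k I (r : seq I) (F : I -> 'rV[R]_n -> R) :
  (forall i, Ck k (F i)) -> Ck k (fun x => \sum_(i <- r) F i x).
Proof.
move=> kF; elim: r => [|i r IHr].
  by under eq_fun do rewrite big_nil; exact: Ck_cst.
by under eq_fun do rewrite big_cons; exact: CkD.
Qed.

Lemma Ck_prod k I (r : seq I) (F : I -> 'rV[R]_n -> R) :
  (forall i, Ck k (F i)) -> Ck k (fun x => \prod_(i <- r) F i x).
Proof.
move=> kF; elim: r => [|i r IHr].
  by under eq_fun do rewrite big_nil; exact: Ck_cst.
by under eq_fun do rewrite big_cons; exact: CkM.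
Qed.

(** An affine map is described by the images [M j] of the basis vectors under
    its linear part, the form in which its partial derivatives appear in the
    chain rule. *)
Definition affine_rV (L : 'rV[R]_n -> 'rV[R]_n) (M : 'I_n -> 'rV[R]_n) :=
  continuous L /\
  forall x h j, L (x + h *: delta_mx ord0 j) = L x + h *: M j.

Lemma derive_comp_affine f L M j x : affine_rV L M ->
  derivable f (L x) (M j) ->
  derivable (f \o L) x (delta_mx ord0 j) /\
  partial j (f \o L) x = 'D_(M j) f (L x).
Proof.
move=> [_ LM] df; rewrite /partial /derive /derivable.
have -> : (fun h : R => h^-1 *: (((f \o L) \o shift x) (h *: delta_mx ord0 j) -
    (f \o L) x)) =
    (fun h => h^-1 *: ((f \o shift (L x)) (h *: M j) - f (L x))).
  by apply/funext => h; rewrite /= [X in L X]addrC LM [L x + _]addrC.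
by split.
Qed.

Lemma partial_comp_affine f L M j x : affine_rV L M -> Ck 1 f ->
  partial j (f \o L) x = \sum_i M j ord0 i * partial i f (L x).
Proof.
move=> LM f1; have [df Df] := Ck1_diff (L x) f1.
have [_ ->] := derive_comp_affine LM (diff_derivable (v := M j) df).
by rewrite Df; apply: eq_bigr => i _; rewrite mxE.
Qed.

Lemma Ck_comp_affine k f L M : affine_rV L M -> Ck k f -> Ck k (f \o L).
Proof.
move=> LM; have [cL _] := LM; elim: k f => [|k IHk] f.
  by move=> [cf _]; split=> // x; exact: (continuous_comp (cL x) (cf (L x))).
move=> f1; have f1' := CkS_Ck1 f1; move: f1 => /CkS[cf df pf].
apply/CkS; split=> [x|j x|j].
- exact: (continuous_comp (cL x) (cf (L x))).
- have [d Df] := Ck1_diff (L x) f1'.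
  by have [+ _] := derive_comp_affine LM (diff_derivable (v := M j) d); exact.
- have -> : partial j (f \o L) =
      (fun x => \sum_i M j ord0 i * (partial i f \o L) x).
    by apply/funext => x; exact: partial_comp_affine.
  by apply: Ck_sum => i; apply: CkZ; exact: IHk.
Qed.

Lemma test_function_affine f L L' M : affine_rV L M ->
  cancel L L' -> cancel L' L -> continuous L' ->
  test_function f -> test_function (f \o L).
Proof.
move=> LM LK L'K cL' [fk sf]; split.
  by move=> k; exact: Ck_comp_affine LM (fk k).
pose K := closure [set x | f x != 0].
have cK : compact (L' @` K).
  by apply: continuous_compact => //; exact: continuous_subspaceT.
apply: (subclosed_compact _ cK); first exact: closed_closure.
have clK : closed (L' @` K) by exact: (compact_closed (@norm_hausdorff _ _)).
move=> x; rewrite closureEbigcap; apply; split => // y /= fy.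
by exists (L y); [exact: subset_closure|exact: LK].
Qed.

Lemma dilation_affine (s : R) :
  affine_rV (fun x => s *: x) (fun j => s *: delta_mx ord0 j).
Proof.
split; first exact: scaler_continuous.
by move=> x h j; rewrite scalerDr !scalerA mulrC.
Qed.

Lemma reflection_affine a (b : R) : affine_rV (reflection a b)
  (fun j => reflection a 0 (delta_mx ord0 j)).
Proof.
split; first exact: continuous_reflection.
move=> x h j; rewrite reflectionE [in RHS]reflectionE reflectionD addrAC.
congr (_ + _); rewrite /reflection !subr0 scalerBr dotZr !scalerA.
by congr (_ - _ *: _); ring.
Qed.

End Ck_closure.

(** * Smooth bump functions *)

Section flat_functions.
Context {R : realType}.
Implicit Types (P : {poly R}) (x : R).

(** The functions [P(1/x) exp(-1/x)] extended by zero: a family of functions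
    flat at the origin and closed under differentiation. *)
Definition flat P x : R := if 0 < x then P.[x^-1] * expR (- x^-1) else 0.

(** With [t = 1/x], the derivative of [P(t) exp(-t)] in [t] is
    [(P'(t) - P(t)) exp(-t)], and [dt/dx = - t^2]. *)
Definition flat_deriv P : {poly R} := 'X^2 * (P - P^`()).

Lemma horner_growth P : exists (C : R) (k : nat), 0 <= C /\
  forall t, 1 <= t -> `|P.[t]| <= C * t ^+ k.
Proof.
exists (\sum_(i < size P) `|P`_i|), (size P).
split; first by apply: sumr_ge0.
move=> t t1; rewrite horner_coef mulr_suml.
apply: (le_trans (ler_norm_sum _ _ _)); apply: ler_sum => i _.
rewrite normrM; apply: ler_wpM2l => //.
rewrite ger0_norm ?exprn_ge0//; last exact: le_trans t1.
by apply: ler_weXn2l => //; exact: ltnW.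
Qed.

(** The exponential beats every power of [1/x]; the factor [x ^+ 2] makes the
    difference quotient at the origin tend to 0. *)
Lemma flat_small P : exists C : R, 0 <= C /\
  forall x, 0 < x <= 1 -> `|flat P x| <= C * x ^+ 2.
Proof.
have [C [k [C0 hC]]] := horner_growth P.
exists (C * (k.+2)`!%:R); split; first by rewrite mulr_ge0.
move=> x /andP[x0 x1]; rewrite /flat x0 normrM (ger0_norm (expR_ge0 _)).
have t1 : 1 <= x^-1 by rewrite invf_ge1.
have t0 : 0 < x^-1 by rewrite invr_gt0.
(* With [t = 1/x], the Taylor expansion gives [t^(k+2) <= (k+2)! exp t]. *)
apply: (le_trans (ler_wpM2r (expR_ge0 _) (hC _ t1))).
rewrite -!mulrA; apply: ler_wpM2l => //.
rewrite expRN ler_pdivrMr ?expR_gt0//.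
have := @expR_ge1Dxn _ x^-1 k.+1 (ltW t0) => h.
have {h} : x^-1 ^+ k.+2 / (k.+2)`!%:R <= expR x^-1.
  by apply: le_trans h; rewrite lerDr.
rewrite ler_pdivrMr ?ltr0n ?fact_gt0// => h.
have -> : x^-1 ^+ k = x ^+ 2 * x^-1 ^+ k.+2.
  by rewrite -[k.+2]add2n exprD mulrA -exprMn divff ?gt_eqF// expr1n mul1r.
rewrite (_ : _ * expR _ = x ^+ 2 * (expR x^-1 * (k.+2)`!%:R)); last by ring.
by apply: ler_wpM2l => //; rewrite exprn_ge0// ltW.
Qed.

Lemma is_derive_flat P x : is_derive x 1 (flat P) (flat (flat_deriv P) x).
Proof.
have [x0|x0|->] := ltgtP x 0.
- apply: (@near_eq_is_derive _ _ _ (cst 0)).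
    near=> y; rewrite /flat ifF//; apply/negbTE; rewrite -leNgt ltW//.
    by near: y; exact: lt_nbhsl.
  rewrite /flat ifF; last by apply/negbTE; rewrite -leNgt ltW.
  exact: is_derive_cst.
- apply: (@near_eq_is_derive _ _ _ (fun y : R => P.[y^-1] * expR (- y^-1) : R)).
    near=> y; rewrite /flat ifT//.
    by near: y; exact: lt_nbhsr.
  rewrite /flat x0.
  have dV : is_derive x (1:R) (fun y : R => y^-1) (- x ^- 2).
    by rewrite -[- _](mulr1); apply: is_deriveV; rewrite gt_eqF.
  have dP : is_derive x^-1 (1:R) (horner P) (P^`().[x^-1]).
    by apply: DeriveDef; [exact: derivable_horner|rewrite derivE derive1E].
  have dPV := is_derive1_comp dP dV.
  have dNV : is_derive x (1:R) (fun y : R => - y^-1) (x ^- 2).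
    by rewrite -[x ^- 2]opprK; exact: is_deriveN.
  have dE := @is_derive1_comp _ _ (fun y : R => - y^-1) x _ _
    (is_derive_expR (- x^-1)) dNV.
  have dM := is_deriveM dPV dE.
  apply: (is_derive_eq dM) => /=.
  rewrite /flat_deriv !hornerE /GRing.scale/= exprVn; ring.
- have [C [C0 hC]] := flat_small P.
  have F0 : flat P 0 = 0 by rewrite /flat ltxx.
  have -> : flat (flat_deriv P) 0 = 0 by rewrite /flat ltxx.
  have lim0 : (fun h : R => h^-1 *: ((flat P \o shift 0) (h *: 1) - flat P 0))
      @ 0^' --> (0 : R).
    apply/cvgrPdist_le => e e0.
    have d0 : 0 < Num.min 1 (e / (C + 1)).
      by rewrite lt_min ltr01 divr_gt0// ltr_wpDl.
    near=> h; rewrite sub0r normrN /= F0 subr0 addr0 [h%:A]mulr1.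
    rewrite normrM.
    have hd : `|h| < Num.min 1 (e / (C + 1)).
      near: h; apply: dnbhs0_lt; exact: d0.
    move: hd; rewrite lt_min => /andP[h1 h2].
    have [h0|h0] := leP h 0.
      by rewrite /flat ifF ?normr0 ?mulr0 ?ltW//; apply/negbTE; rewrite -leNgt.
    rewrite gtr0_norm ?invr_gt0//.
    have hh : 0 < h <= 1 by rewrite h0 -(gtr0_norm h0) ltW.
    apply: (le_trans (ler_wpM2l _ (hC _ hh))); first by rewrite invr_ge0 ltW.
    rewrite mulrCA expr2 mulKf ?gt_eqF//.
    move: h2; rewrite gtr0_norm// ltr_pdivlMr ?ltr_wpDl// => h2.
    by apply: le_trans (ltW h2); rewrite mulrC ler_wpM2l ?lerDl// ltW.
  apply: DeriveDef; first by apply/cvg_ex; exists 0.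
  exact: cvg_lim lim0.
Unshelve. all: by end_near. Qed.

Lemma flat_bounds x : 0 <= flat 1 x <= 1.
Proof.
rewrite /flat; case: ltP => x0; last by rewrite lexx ler01.
by rewrite hornerE mul1r expR_ge0 expR_le1 oppr_le0 invr_ge0 ltW.
Qed.

Lemma flat1_gt0 x : (0 < flat 1 x) = (0 < x).
Proof.
by rewrite /flat; case: (ltP 0 x) => x0; rewrite ?ltxx// hornerE mul1r expR_gt0.
Qed.

Lemma flat1_cvg x : flat 1 (k.+1%:R * x) @[k --> \oo] --> ((0 < x)%R%:R : R).
Proof.
have [x0|x0] := ltP 0 x; last first.
  rewrite (_ : (fun k => _) = cst 0); first exact: cvg_cst.
  apply/funext => k; rewrite /flat ifF//; apply/negbTE; rewrite -leNgt.
  by rewrite pmulr_rle0.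
have -> : (fun k => flat 1 (k.+1%:R * x)) =
    (fun k => expR (- (x^-1 * k.+1%:R^-1))).
  by apply/funext => k; rewrite /flat pmulr_rgt0// x0 hornerE mul1r invfM mulrC.
rewrite -[X in _ --> X]expR0 -oppr0 -[X in expR (- X)](mulr0 x^-1).
apply: (cvg_comp _ expR); last exact: continuous_expR.
by apply: cvgN; apply: cvgM; [exact: cvg_cst|exact: cvg_harmonic].
Qed.

End flat_functions.

Section test_functions.
Context {R : realType} {n : nat}.
Implicit Types (a x : 'rV[R]_n) (b : R).

Lemma dot_delta i x : dot (delta_mx ord0 i) x = x ord0 i.
Proof.
rewrite /dot (bigD1 i)//= big1 => [|j ij].
  by rewrite mxE !eqxx mul1r addr0.
by rewrite mxE (negbTE ij) andbF mul0r.
Qed.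

Lemma dot_affine_line a b (h : R) j x :
  dot a (h *: delta_mx ord0 j + x) - b = h * a ord0 j + (dot a x - b).
Proof.
by rewrite dotDr dotZr (dotC a) dot_delta addrA.
Qed.

Lemma continuous_flat (P : {poly R}) : continuous (flat P).
Proof.
move=> y; apply/differentiable_continuous/derivable1_diffP.
by have [] := is_derive_flat P y.
Qed.

Lemma is_derive_flat_affine P a b j x :
  is_derive x (delta_mx ord0 j : 'rV[R]_n) (fun x => flat P (dot a x - b))
    (a ord0 j * flat (flat_deriv P) (dot a x - b)).
Proof.
have E : (fun h : R => h^-1 *: (((fun x => flat P (dot a x - b)) \o shift x)
    (h *: delta_mx ord0 j) - flat P (dot a x - b))) =
  (fun h : R => h^-1 *: (((fun h => flat P (h * a ord0 j + (dot a x - b))) \o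
    shift 0) (h *: 1) - flat P (0 * a ord0 j + (dot a x - b)))).
  apply/funext => h /=; rewrite dot_affine_line.
  by rewrite addr0 mul0r add0r [h%:A]mulr1.
have : is_derive (0:R) 1 (fun h => flat P (h * a ord0 j + (dot a x - b)))
    (flat (flat_deriv P) (dot a x - b) * a ord0 j).
  have dg : is_derive (0:R) 1 (fun h => h * a ord0 j + (dot a x - b))
      (a ord0 j).
    apply: is_derive_eq; rewrite /GRing.scale/= !(mulr0, mulr1, add0r, addr0).
    by [].
  have dP : is_derive (0 * a ord0 j + (dot a x - b)) (1:R) (flat P)
    (flat (flat_deriv P) (dot a x - b)).
    by rewrite mul0r add0r; exact: is_derive_flat.
  exact: (@is_derive1_comp _ _
    (fun h => h * a ord0 j + (dot a x - b)) _ _ _ dP dg).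
by rewrite [a ord0 j * _]mulrC => -[d1 d2]; apply: DeriveDef;
  rewrite /derivable /derive E.
Qed.

Lemma Ck_flat k P a b : Ck k (fun x => flat P (dot a x - b)).
Proof.
have ca Q : continuous (fun x => flat Q (dot a x - b)).
  move=> x; have cx : {for x, continuous (fun x => dot a x - b)}.
    exact: (cvgB (@continuous_dot _ _ a x) (cvg_cst _)).
  exact: (continuous_comp cx (@continuous_flat Q _)).
elim: k P => [|k IHk] P; first by split.
apply/CkS; split=> [|j x|j]; first exact: ca.
  by have [] := is_derive_flat_affine P a b j x.
rewrite (_ : partial j _ =
    (fun x => a ord0 j * flat (flat_deriv P) (dot a x - b))); last first.
  by apply/funext => x; have [_] := is_derive_flat_affine P a b j x.
by apply: CkZ; exact: IHk.
Qed.

(** Since [flat 1] is [exp(-1/t)], the factor [k + 1] replaces it by its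
    [(k + 1)]-th root, so that these functions increase to the indicator
    function of the open box. *)
Definition bump (k : nat) (a b x : 'rV[R]_n) : R :=
  \prod_(i < n) (flat 1 (k.+1%:R * (x ord0 i - a ord0 i)) *
                 flat 1 (k.+1%:R * (b ord0 i - x ord0 i))).

Definition open_box (a b : 'rV[R]_n) : set 'rV[R]_n :=
  [set x | forall i, x ord0 i \in `]a ord0 i, b ord0 i[].

Definition closed_box (a b : 'rV[R]_n) : set 'rV[R]_n :=
  [set x | forall i, x ord0 i \in `[a ord0 i, b ord0 i]].

Lemma compact_closed_box a (b : 'rV[R]_n) : compact (closed_box a b).
Proof.
apply: (@rV_compact _ _ (fun i => `[a ord0 i, b ord0 i]%classic)) => i.
exact: segment_compact.
Qed.

Lemma sub_open_closed_box a (b : 'rV[R]_n) : open_box a b `<=` closed_box a b.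
Proof.
by move=> x h i; have := h i; rewrite !in_itv/= => /andP[/ltW -> /ltW ->].
Qed.

Lemma sub_box_closed_box a (b : 'rV[R]_n) : box a b `<=` closed_box a b.
Proof.
by move=> x h i; have := h i; rewrite !in_itv/= => /andP[/ltW -> ->].
Qed.

Lemma bump_bounds k a (b : 'rV[R]_n) x : 0 <= bump k a b x <= 1.
Proof.
apply: (big_ind (fun y => 0 <= y <= 1)) => [|y z /andP[y0 y1] /andP[z0 z1]|i _].
- by rewrite ler01 lexx.
- by rewrite mulr_ge0//= mulr_ile1.
have /andP[y0 y1] := flat_bounds (k.+1%:R * (x ord0 i - a ord0 i)).
have /andP[z0 z1] := flat_bounds (k.+1%:R * (b ord0 i - x ord0 i)).
by rewrite mulr_ge0//= mulr_ile1.
Qed.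

Lemma bump_support k a (b : 'rV[R]_n) x : bump k a b x != 0 -> open_box a b x.
Proof.
move=> /prodf_neq0 h i; have := h i isT; rewrite mulf_eq0 negb_or in_itv/=.
have pos y : flat 1 y != 0 -> 0 < y.
  by rewrite /flat; case: (ltP 0 y) => // _; rewrite eqxx.
move=> /andP[/pos + /pos].
by rewrite !pmulr_rgt0// !subr_gt0 => -> ->.
Qed.

Lemma bump_cvg a (b : 'rV[R]_n) x :
  bump k a b x @[k --> \oo] --> (\1_(open_box a b) x : R).
Proof.
rewrite (_ : \1_(open_box a b) x = \prod_(i < n)
    ((0 < x ord0 i - a ord0 i)%R%:R * (0 < b ord0 i - x ord0 i)%R%:R)).
  apply: (@cvg_big _ _ _ _ xpredT mul_continuous) => i _.
  by apply: cvgM; exact: flat1_cvg.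
rewrite indicE; have [xab|xab] := pselect (open_box a b x).
  rewrite mem_set// big1// => i _; have := xab i; rewrite in_itv/=.
  by rewrite !subr_gt0 => /andP[-> ->]; rewrite mulr1.
rewrite memNset//; move/existsNP : xab => [i /negP]; rewrite in_itv/= => xi.
rewrite (bigD1 i)//= !subr_gt0 -natrM mulnb (negbTE xi).
by rewrite mul0r.
Qed.

Lemma bump_test k a (b : 'rV[R]_n) : test_function (bump k a b).
Proof.
split=> [l|].
  apply: Ck_prod => i; apply: CkM.
    have := Ck_flat l 1 (k.+1%:R *: delta_mx ord0 i) (k.+1%:R * a ord0 i).
    by under eq_fun do rewrite dotZl dot_delta -mulrBr.
  have := Ck_flat l 1 (- k.+1%:R *: delta_mx ord0 i) (- k.+1%:R * b ord0 i).
  by under eq_fun do rewrite dotZl dot_delta -mulrBr mulNr -mulrN opprB.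
have cK := @compact_closed_box a b.
apply: (subclosed_compact _ cK); first exact: closed_closure.
have clK := compact_closed (@norm_hausdorff _ _) cK.
move=> x; rewrite closureEbigcap; apply; split => // y /= /bump_support.
exact: sub_open_closed_box.
Qed.

End test_functions.

(** * Null hyperplanes and positive open sets *)

Section null_sets.
Context {R : realType} {n : nat}.
Local Notation leb := (lebesgue_rV R n).
Implicit Types (a x : 'rV[R]_n) (b : R).

Lemma measurable_hyperplane a b : measurable [set x | dot a x = b].
Proof.
rewrite (_ : mkset _ = setT `&` (fun x => dot a x) @^-1` [set b]).
  exact: measurable_fun_dot.
by rewrite setTI.
Qed.

Lemma measurable_open_halfspace a b : measurable [set x | b < dot a x].
Proof.
rewrite (_ : mkset _ = setT `&` (fun x => dot a x) @^-1` `]b, +oo[%classic).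
  by apply: measurable_fun_dot => //; exact: measurable_itv.
by rewrite setTI; apply/seteqP; split=> x; rewrite /= in_itv/= andbT.
Qed.

Lemma norm_box x (M : R) : `|x| < M -> box (const_mx (- M)) (const_mx M) x.
Proof.
move=> xM i; rewrite in_itv/= !mxE.
have := le_lt_trans (coord_ler_norm x i) xM.
by rewrite ltr_norml => /andP[-> /ltW].
Qed.

Lemma box_norm x (M : R) : 0 <= M -> box (const_mx (- M)) (const_mx M) x ->
  `|x| <= M.
Proof.
move=> M0 xM; apply: ler_norm_rV => // i; have := xM i.
by rewrite in_itv/= !mxE ler_norml => /andP[/ltW -> ->].
Qed.

(** A bounded piece of a hyperplane has infinitely many disjoint translates in
    a fixed box, all with the same measure. *)
Lemma lebesgue_hyperplane a b : a != 0 -> leb [set x | dot a x = b] = 0%E.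
Proof.
move=> a0; have aa := dot_gt0 a0.
pose H (M : nat) := [set x | dot a x = b] `&`
  box (const_mx (- M%:R)) (const_mx M%:R).
have mH M : measurable (H M).
  by apply: measurableI; [exact: measurable_hyperplane|exact: measurable_box].
suff H0 M : leb (H M) = 0%E.
  apply/negligibleP; first exact: measurable_hyperplane.
  rewrite (_ : mkset _ = \bigcup_M H M); last first.
    by rewrite -setI_bigcupr box_cover setIT.
  by apply: negligible_bigcup => M; apply/(negligibleP leb (mH M))/H0.
pose A (k : nat) := shift_rV (- (k.+1%:R^-1 *: a)) @^-1` (H M).
have mA k : measurable (A k).
  by rewrite -[X in measurable X]setTI; exact: measurable_shift_rV.
have AH k : leb (A k) = leb (H M) by exact: lebesgue_shift.
have tA : trivIset setT A.
  move=> i j _ _ [x [[/= hi _] [/= hj _]]]; move: hi hj.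
  rewrite /shift_rV !dotDr !dotNr !dotZr => {1}<-.
  move=> /addrI/oppr_inj/(mulIf (lt0r_neq0 aa)).
  by move=> /invr_inj/eqP; rewrite eqr_nat eqSS => /eqP.
pose C : set 'rV[R]_n :=
  box (const_mx (- (M%:R + `|a| + 1))) (const_mx (M%:R + `|a| + 1)).
have AC : \bigcup_k A k `<=` C.
  move=> x [k _ [_ hx]]; apply: norm_box; rewrite ltr_pwDr//.
  have := box_norm (ler0n _ _) hx; rewrite /shift_rV => h.
  rewrite -[x](subrK (k.+1%:R^-1 *: a)); apply: (le_trans (ler_normD _ _)).
  apply: lerD => //; rewrite normrZ ger0_norm ?invr_ge0//.
  by rewrite ler_piMl// invf_le1// ler1n.
have hC : (leb (\bigcup_k A k) <= leb C)%E.
  apply: le_measure; rewrite ?inE//; first exact: bigcupT_measurable.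
  exact: measurable_box.
have [c HM] : exists c : R, leb (H M) = c%:E.
  exists (fine (leb (H M))); rewrite fineK// ge0_fin_numE ?measure_ge0//.
  apply: (@le_lt_trans _ _ (leb (box (const_mx (- M%:R)) (const_mx M%:R)))).
    apply: le_measure; rewrite ?inE//; first exact: measurable_box.
    exact: subIsetr.
  exact: lebesgue_box_fin.
have c0 : 0 <= c by rewrite -lee_fin -HM measure_ge0.
rewrite HM; congr EFin; apply/eqP; rewrite eq_le c0 andbT leNgt.
apply/negP => cp.
move: hC; rewrite measure_semi_bigcup//; last exact: bigcupT_measurable.
rewrite lebesgue_box leNgt => /negP; apply; set r := (X in (X%:E < _)%E).
pose k := (Num.truncn (r / c)).+1.
have rk : (r%:E < \sum_(0 <= i < k) leb (A i))%E.
  under eq_bigr do rewrite AH HM.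
  rewrite sumEFin lte_fin sumr_const_nat subn0 -mulr_natl -ltr_pdivrMr//.
  exact: truncnS_gt.
apply: (lt_le_trans rk); apply: nneseries_lim_ge => i _ _.
exact: measure_ge0.
Qed.

Lemma open_lebesgue_gt0 (U : set 'rV[R]_n) x : open U -> U x ->
  (0 < leb U)%E.
Proof.
move=> oU Ux; have /nbhs_ballP[e /= e0 xeU] : nbhs x U.
  by apply: open_nbhs_nbhs.
have e2 : 0 < e / 2 by rewrite divr_gt0.
apply: (@lt_le_trans _ _ (leb (box x (\row_i (x ord0 i + e / 2))))).
  rewrite lebesgue_box lte_fin; apply: prodr_gt0 => i _.
  by rewrite mxE addrAC subrr add0r lt_max e2 orbT.
apply: le_measure; rewrite ?inE//; first exact: measurable_box.
  exact: measurable_rV_open.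
move=> y hy; apply: xeU; rewrite rV_ball// => i; have := hy i.
rewrite in_itv/= mxE distrC => /andP[h1 h2].
by rewrite ger0_norm ?subr_ge0 ?(ltW h1)//; lra.
Qed.

(** This carries an a.e. property of [u] to points of an open set that is
    defined by a continuous representative of [u]. *)
Lemma ae_open_exists (U : set 'rV[R]_n) x (P : 'rV[R]_n -> Prop) :
  open U -> U x -> {ae leb, forall y, P y} -> exists2 y, U y & P y.
Proof.
move=> oU Ux [Z [mZ Z0 PZ]]; apply: contrapT => nP.
have UZ : U `<=` Z.
  by move=> y Uy; apply: PZ => /= Py; apply: nP; exists y.
have : (leb U <= leb Z)%E.
  by apply: le_measure; rewrite ?inE//; exact: measurable_rV_open.
by rewrite Z0 leNgt (open_lebesgue_gt0 oU Ux).
Qed.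

Lemma ae_continuous_eq m (f g : 'rV[R]_n -> 'rV[R]_m) :
  (forall i, continuous (fun x => f x ord0 i)) ->
  (forall i, continuous (fun x => g x ord0 i)) ->
  {ae leb, forall x, f x = g x} -> f = g.
Proof.
move=> cf cg fg; apply/funext => x; apply/rowP => i.
apply/eqP; rewrite -subr_eq0.
apply/negP => /negP fgx.
pose h y := f y ord0 i - g y ord0 i.
have ch : continuous h by move=> y; exact: (cvgB (cf i y) (cg i y)).
have oU : open (h @^-1` [set y | y != 0]).
  by move/continuousP : ch; apply; exact: open_neq.
have [y] := ae_open_exists oU fgx fg.
by rewrite /h/= => /eqP + E; rewrite E subrr.
Qed.

End null_sets.

(** * The fundamental lemma of the calculus of variations *)

Section density.
Context d (T : measurableType d) (R : realType) (mu : {measure set T -> \bar R}).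
Variable f : T -> \bar R.
Hypotheses (mf : measurable_fun setT f) (f0 : forall x, (0 <= f x)%E).
Local Open Scope ereal_scope.

(** The measure with density [f]. The uniqueness of measures will be applied to
    the positive and the negative part of a locally integrable function. *)
Definition density (A : set T) : \bar R := \int[mu]_(x in A) f x.

Let density0 : density set0 = 0.
Proof. exact: integral_set0. Qed.

Let density_ge0 A : 0 <= density A.
Proof. by apply: integral_ge0 => x _. Qed.

Let density_sigma_additive : semi_sigma_additive density.
Proof.
move=> F mF tF mUF; rewrite /density ge0_integral_bigcup//; last first.
  exact: measurable_funTS.
by apply: is_cvg_nneseries => k _ _; exact: density_ge0.
Qed.

HB.instance Definition _ := isMeasure.Build _ _ _ density
  density0 density_ge0 density_sigma_additive.

Definition density_measure : {measure set T -> \bar R} := density.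

End density.

Section fundamental_lemma.
Context {R : realType} {n : nat}.
Local Notation leb := (lebesgue_rV R n).
Implicit Types (f F : 'rV[R]_n -> R) (a b x : 'rV[R]_n).

(** Both boxes differ by the faces [x_i = b_i], which lie in null
    hyperplanes. *)
Lemma ae_box a b :
  {ae leb, forall x, \1_(open_box a b) x = \1_(box a b) x :> R}.
Proof.
have h : {ae leb, forall x, forall i, dot (delta_mx ord0 i) x <> b ord0 i}.
  apply: filter_forall => i.
  exists [set x | dot (delta_mx ord0 i) x = b ord0 i].
  split; first exact: measurable_hyperplane.
    apply: lebesgue_hyperplane; apply/eqP => /rowP/(_ i)/eqP.
    by rewrite !mxE !eqxx/= oner_eq0.
  by move=> x /contrapT.
apply: filterS h => x xb; rewrite !indicE; congr (_%:R).
congr nat_of_bool; apply/idP/idP; rewrite !inE => xab i; have := xab i;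
  rewrite !in_itv/= => /andP[-> xbi]/=; first exact: ltW.
rewrite lt_neqAle xbi andbT; apply/eqP => xbi'.
by apply: (xb i); rewrite dot_delta.
Qed.

(** The integral against an indicator function of a box is the limit of the
    integrals against bump functions. *)
Lemma integral_box_eq0 F : L1loc F ->
  (forall phi, test_function phi -> \int[leb]_x (F x * phi x) = 0) ->
  forall a b, \int[leb]_(x in box a b) F x = 0.
Proof.
move=> [mF iF] F0 a b.
have mc : measurable (closed_box a b).
  exact: measurable_rV_compact (@compact_closed_box _ _ a b).
have ic := iF _ (@compact_closed_box _ _ a b).
pose f_ k x := (F x * bump k a b x)%:E.
have mb k : measurable_fun setT (bump k a b : 'rV[R]_n -> R).
  by apply: continuous_measurable_rV; have [/(_ 0%N)[]] := bump_test k a b.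
have ig : leb.-integrable setT
    (fun x => `|((F \_ (closed_box a b)) x)%:E|%E).
  apply: integrable_abse; move/(integrable_mkcond _ mc) : ic.
  by rewrite restrict_EFin.
have mf k : measurable_fun setT (f_ k).
  by apply/measurable_EFinP; exact: measurable_funM.
have fg k x : (`|f_ k x| <= `|((F \_ (closed_box a b)) x)%:E|)%E.
  rewrite /f_ /= lee_fin patchE; case: ifPn => [xc|xc].
    rewrite normrM ler_piMr//; have /andP[b0 b1] := bump_bounds k a b x.
    by rewrite ger0_norm.
  rewrite normr0 normr_le0 mulf_eq0 orbC; apply/orP; left.
  apply: contraNT xc => /bump_support/sub_open_closed_box h.
  exact: mem_set.
have := @dominated_convergence _ _ R leb setT measurableT f_
  (fun x => (F x * \1_(box a b) x)%:E)
  (fun x => `|((F \_ (closed_box a b)) x)%:E|%E).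
case.
- exact: mf.
- apply/measurable_EFinP; apply: measurable_funM => //.
  by apply: measurable_indic; exact: measurable_box.
- apply: filterS (ae_box a b) => x Ex _.
  apply: cvg_EFin; first by near=> k.
  rewrite -Ex; apply: cvgM; [exact: cvg_cst|exact: bump_cvg].
- exact: ig.
- by apply: aeW => x k _; exact: fg.
move=> ib _ cvb.
have E k : (\int[leb]_x f_ k x = 0)%E.
  rewrite -[LHS]fineK; first by congr EFin; exact: (F0 _ (bump_test k a b)).
  apply: integrable_fin_num => //; apply: le_integrable ig => // x _.
  by rewrite abse_id; exact: fg.
move: cvb; under eq_fun do rewrite E.
move=> /(cvg_lim (@ereal_hausdorff R)); rewrite lim_cst// => I0.
rewrite Rintegral_mkcond /Rintegral -[RHS]/(fine 0%E) I0; congr fine.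
apply: eq_integral => x _; congr EFin; rewrite patchE indicE.
by case: ifP => _; rewrite ?mulr1 ?mulr0.
Unshelve. all: by end_near. Qed.

(** The integrals of the positive and of the negative part of [F] agree on
    boxes, hence on all Borel sets. On the set where [F] is positive the
    negative part is 0, and conversely, so both integrals vanish there. *)
Lemma fundamental_lemma F : L1loc F ->
  (forall phi, test_function phi -> \int[leb]_x (F x * phi x) = 0) ->
  {ae leb, forall x, F x = 0}.
Proof.
move=> [mF iF] /(integral_box_eq0 (conj mF iF)) F0.
pose f := EFin \o F.
have mf : measurable_fun setT f by exact/measurable_EFinP.
pose m1 := density_measure leb (measurable_funepos mf) (funepos_ge0 f).
pose m2 := density_measure leb (measurable_funeneg mf) (funeneg_ge0 f).
have ib a b : leb.-integrable (box a b) f.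
  apply: integrableS (iF _ (@compact_closed_box _ _ a b)).
  - exact: measurable_rV_compact (@compact_closed_box _ _ a b).
  - exact: measurable_box.
  - exact: sub_box_closed_box.
have E a b : m1 (box a b) = m2 (box a b).
  have := F0 a b; rewrite /Rintegral integralE.
  have i1 := integrable_fin_num (measurable_box a b)
    (integrable_funepos (measurable_box a b) (ib a b)).
  have i2 := integrable_fin_num (measurable_box a b)
    (integrable_funeneg (measurable_box a b) (ib a b)).
  rewrite fineB// => /eqP; rewrite subr_eq0 => /eqP fE.
  by rewrite /m1 /m2/= /density -[LHS]fineK// fE fineK.
have m1oo a b : (m1 (box a b) < +oo)%E.
  have h : (\int[leb]_(x in box a b) f^\+%E x < +oo)%E.
    apply: integrable_lty; first exact: measurable_box.
    exact: (integrable_funepos (measurable_box a b) (ib a b)).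
  exact: h.
have m12 := box_measure_unique E m1oo.
have null (h1 h2 : 'rV[R]_n -> \bar R) (A : set 'rV[R]_n) :
    measurable A -> measurable_fun setT h1 -> (forall x, (0 <= h1 x)%E) ->
    (forall x, A x -> h2 x = 0%E) ->
    (\int[leb]_(x in A) h1 x = \int[leb]_(x in A) h2 x)%E ->
    {ae leb, forall x, A x -> h1 x = 0%E}.
  move=> mA mh h10 h20 I12.
  apply/(ae_eq_integral_abs leb mA (measurable_funTS mh)).
  under eq_integral do rewrite gee0_abs//.
  by rewrite I12 integral0_eq.
have mP : measurable (F @^-1` `]0, +oo[%classic).
  by rewrite -[X in measurable X]setTI; apply: mF => //; exact: measurable_itv.
have mN : measurable (F @^-1` `]-oo, 0[%classic).
  by rewrite -[X in measurable X]setTI; apply: mF => //; exact: measurable_itv.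
have P0 := null f^\+%E f^\-%E _ mP (measurable_funepos mf) (funepos_ge0 f) _
  (m12 _ mP).
have N0 := null f^\-%E f^\+%E _ mN (measurable_funeneg mf) (funeneg_ge0 f) _
  (esym (m12 _ mN)).
apply: filterS2 (P0 _) (N0 _) => [x|x|x].
- rewrite /= !in_itv/= andbT funeposE funenegE /f/= => hP hN.
  have [Fx|Fx|//] := ltgtP (F x) 0.
    have := hN Fx; rewrite max_l ?lee_fin ?oppr_ge0 ?ltW// => /eqP.
    by rewrite eqe oppr_eq0 => /eqP.
  by have := hP Fx; rewrite max_l ?lee_fin ?ltW// => /eqP; rewrite eqe => /eqP.
- rewrite /= in_itv/= andbT funenegE /f/= => Fx.
  by rewrite max_r// lee_fin oppr_le0 ltW.
- rewrite /= in_itv/= funeposE /f/= => Fx.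
  by rewrite max_r// lee_fin ltW.
Qed.

End fundamental_lemma.

(** * Weak gradients *)

Section L1loc_theory.
Context {R : realType} {n : nat}.
Local Notation leb := (lebesgue_rV R n).
Implicit Types (f F psi : 'rV[R]_n -> R) (a x : 'rV[R]_n) (b : R).

Lemma continuous_compact_bound psi (K : set 'rV[R]_n) : continuous psi ->
  compact K -> exists M : R, forall x, K x -> `|psi x| <= M.
Proof.
move=> cpsi cK.
have /compact_bounded[M [_ hM]] : compact (psi @` K).
  by apply: continuous_compact => //; exact: continuous_subspaceT.
exists (M + 1) => x Kx; apply: hM; first by rewrite ltrDl.
by exists x.
Qed.

Lemma L1loc_mul_continuous F psi : L1loc F -> continuous psi ->
  L1loc (fun x => F x * psi x).
Proof.
move=> [mF iF] cpsi.
have mpsi := continuous_measurable_rV cpsi.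
split; first exact: measurable_funM.
move=> K cK; have mK := measurable_rV_compact cK.
have [M hM] := continuous_compact_bound cpsi cK.
have iMF := integrableZl mK M (iF _ cK).
apply: le_integrable iMF => //.
  by apply/measurable_EFinP/measurable_funTS; exact: measurable_funM.
move=> x Kx; rewrite /= lee_fin !normrM mulrC ler_wpM2r//.
by apply: (le_trans (hM _ Kx)); exact: ler_norm.
Qed.

Lemma L1loc_integrable_compact F (K : set 'rV[R]_n) : L1loc F ->
  compact K -> (forall x, ~ K x -> F x = 0) ->
  leb.-integrable setT (EFin \o F).
Proof.
move=> [mF iF] cK F0; have mK := measurable_rV_compact cK.
move/(integrable_mkcond _ mK) : (iF _ cK); apply: eq_integrable => // x _.
rewrite patchE; case: ifPn => // /negP; rewrite inE => nK /=.
by rewrite F0.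
Qed.

Lemma test_function_continuous phi : test_function phi ->
  continuous (phi : 'rV[R]_n -> R).
Proof. by move=> [/(_ 0%N)[]]. Qed.

Lemma test_function_partial_continuous phi j : test_function phi ->
  continuous (partial j phi : 'rV[R]_n -> R).
Proof. by move=> [/(_ 1%N)[_ /(_ j)[_ []]]]. Qed.

Lemma eq0_off_support phi (x : 'rV[R]_n) :
  ~ closure [set x | phi x != 0] x -> phi x = 0 :> R.
Proof.
by move=> h; apply/eqP/negPn/negP => /= px; apply: h; exact: subset_closure.
Qed.

Lemma partial_support phi j x :
  ~ closure [set x : 'rV[R]_n | phi x != 0] x -> partial j phi x = 0 :> R.
Proof.
move=> h.
have nx : \forall y \near x, cst 0 y = phi y.
  have : nbhs x (~` closure [set x | phi x != 0]).
    apply: open_nbhs_nbhs; split => //; apply: closed_openC.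
    exact: closed_closure.
  apply: filterS => y hy; apply/esym/eqP/negPn/negP => /= px; apply: hy.
  exact: subset_closure.
have d0 : derivable (cst 0 : 'rV[R]_n -> R) x (delta_mx ord0 j).
  exact: derivable_cst.
by rewrite /partial -(near_eq_derive _ nx) ?derive_cst.
Qed.

Lemma integrable_test F phi : L1loc F -> test_function phi ->
  leb.-integrable setT (EFin \o (fun x => F x * phi x)).
Proof.
move=> lF tphi; have [_ cK] := tphi.
apply: (L1loc_integrable_compact _ cK).
  by apply: L1loc_mul_continuous => //; exact: test_function_continuous.
by move=> x nK; rewrite (eq0_off_support nK) mulr0.
Qed.

Lemma integrable_partial_test F phi j : L1loc F -> test_function phi ->
  leb.-integrable setT (EFin \o (fun x => F x * partial j phi x)).
Proof.
move=> lF tphi; have [_ cK] := tphi.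
apply: (L1loc_integrable_compact _ cK).
  by apply: L1loc_mul_continuous => //; exact: test_function_partial_continuous.
by move=> x nK; rewrite (partial_support j nK) mulr0.
Qed.

Lemma L1locD f F : L1loc f -> L1loc F -> L1loc (fun x => f x + F x).
Proof.
move=> [mf jf] [mF iF]; split; first exact: measurable_funD.
move=> K cK; have mK := measurable_rV_compact cK.
exact: (integrableD mK (jf _ cK) (iF _ cK)).
Qed.

Lemma L1locZ c F : L1loc F -> L1loc (fun x => c * F x).
Proof.
move=> [mF iF]; split; first exact: measurable_funM.
move=> K cK; have mK := measurable_rV_compact cK.
exact: (integrableZl mK c (iF _ cK)).
Qed.

Lemma L1loc_sum I (r : seq I) (F : I -> 'rV[R]_n -> R) :
  (forall i, L1loc (F i)) -> L1loc (fun x => \sum_(i <- r) F i x).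
Proof.
move=> lF; elim: r => [|i r IHr].
  under eq_fun do rewrite big_nil; split=> // K cK.
  exact: integrable0.
by under eq_fun do rewrite big_cons; exact: L1locD.
Qed.

Lemma L1loc_scaling c T T' F : 0 < c -> scales_lebesgue c T ->
  cancel T T' -> continuous T -> L1loc F -> L1loc (fun x => F (T x)).
Proof.
move=> c0 sT TK cT [mF iF]; split.
  by apply: (measurableT_comp mF); case: sT.
move=> K cK.
have cTK : compact (T @` K).
  by apply: continuous_compact => //; exact: continuous_subspaceT.
have mTK := measurable_rV_compact cTK.
have := integrable_scaling c0 sT mTK mF (iF _ cTK).
rewrite (_ : T @^-1` _ = K)//.
apply/seteqP; split=> [x [y Ky /(congr1 T')]|x Kx]; last by exists x.
by rewrite !TK => <-.
Qed.

(** Multiplying a test function by the smooth function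
    [flat 1 (dot a x - b)], which is positive exactly on an open half-space,
    localizes the fundamental lemma to this half-space. *)
Lemma weak_gradient_local f h (F H : 'rV[R]_n -> 'rV[R]_n) a b :
  is_weak_gradient f F -> is_weak_gradient h H ->
  (forall x, b <= dot a x -> f x = h x) ->
  {ae leb, forall x, b < dot a x -> F x = H x}.
Proof.
move=> fF hH fh.
suff D j : {ae leb, forall x, (F x ord0 j + (-1) * H x ord0 j) *
    flat 1 (dot a x - b) = 0}.
  apply: filterS (filter_forall _ D) => x hx abx; apply/rowP => j.
  have /eqP := hx j; rewrite mulf_eq0 => /orP[|].
    by rewrite mulN1r subr_eq0 => /eqP.
  move/eqP => h0; move: (flat1_gt0 (dot a x - b)).
  by rewrite h0 ltxx subr_gt0 abx.
have [lF wF] := fF j; have [lH wH] := hH j.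
have lD : L1loc (fun x => F x ord0 j + (-1) * H x ord0 j).
  by apply: L1locD => //; exact: L1locZ.
have schi k := Ck_flat k 1 a b.
apply: fundamental_lemma.
  by apply: L1loc_mul_continuous => //; exact: (Ck_continuous (schi 0%N)).
move=> phi tphi.
pose psi := (fun x => flat 1 (dot a x - b)) \* phi.
have tpsi : test_function psi.
  have [sphi cphi] := tphi; split; first by move=> k; apply: CkM.
  apply: (subclosed_compact _ cphi); first exact: closed_closure.
  apply: closureS => x; rewrite /psi/= mulf_eq0 negb_or.
  by move=> /andP[].
(* Below the hyperplane the cutoff and its derivatives vanish, and above it the
   functions agree: thus they have the same integrals against [psi]. *)
have E : (fun x => f x * partial j psi x) = (fun x => h x * partial j psi x).
  apply/funext => x; have [bx|xb] := leP b (dot a x); first by rewrite fh.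
  rewrite (_ : partial j psi x = 0) ?mulr0//.
  have [d1 e1] := is_derive_flat_affine 1 a b j x.
  have d2 : derivable phi x (delta_mx ord0 j).
    by have [/(_ 1%N)[_ /(_ j)[]]] := tphi.
  rewrite /partial /psi (deriveM d1 d2).
  have z P : flat P (dot a x - b) = 0.
    by rewrite /flat ifF//; apply/negbTE; rewrite -leNgt subr_le0 ltW.
  by rewrite e1 !z mulr0 scale0r scaler0 addr0.
transitivity (\int[leb]_x (F x ord0 j * psi x - H x ord0 j * psi x)).
  by apply: eq_Rintegral => x _; rewrite /psi/=; ring.
rewrite RintegralB//; [|exact: integrable_test|exact: integrable_test].
apply/eqP; rewrite subr_eq0 -eqr_opp -wF// -wH//; apply/eqP.
by apply: eq_Rintegral => x _; exact: (congr1 (fun g => g x) E).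
Qed.

Lemma weak_gradient_ae_unique f (F H : 'rV[R]_n -> 'rV[R]_n) :
  is_weak_gradient f F -> is_weak_gradient f H -> {ae leb, forall x, F x = H x}.
Proof.
move=> fF fH; have := weak_gradient_local (a := 0) (b := -1) fF fH.
move=> /(_ (fun _ _ => erefl)); apply: filterS => x; apply.
by rewrite /dot big1 ?ltrN10// => i _; rewrite mxE mul0r.
Qed.

Lemma weak_gradientP f :
  (exists F : 'rV[R]_n -> 'rV[R]_n, is_weak_gradient f F) ->
  is_weak_gradient f (weak_gradient f).
Proof. by move=> ?; exact: xgetPex. Qed.

Lemma Rintegral_linear_comb I (r : seq I) (k : I -> R) (h : I -> 'rV[R]_n -> R) :
  (forall i, leb.-integrable setT (EFin \o h i)) ->
  \int[leb]_x (\sum_(i <- r) k i * h i x) =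
  \sum_(i <- r) k i * \int[leb]_x h i x.
Proof.
move=> ih.
suff [] : leb.-integrable setT (EFin \o (fun x => \sum_(i <- r) k i * h i x)) /\
    \int[leb]_x (\sum_(i <- r) k i * h i x) =
    \sum_(i <- r) k i * \int[leb]_x h i x by [].
elim: r => [|i r [IHi IHr]].
  under eq_fun do rewrite big_nil; rewrite big_nil; split.
    exact: integrable0.
  by rewrite /Rintegral integral0.
have iZ := integrableZl measurableT (k i) (ih i).
under eq_fun do rewrite big_cons; split.
  exact: (integrableD measurableT iZ IHi).
by rewrite big_cons RintegralD// RintegralZl// IHr.
Qed.

(** The chain rule, obtained by the change of variables [y = T x] in the
    integrals against [phi], since [phi \o T'] is again a test function. *)
Lemma is_weak_gradient_affine f (F : 'rV[R]_n -> 'rV[R]_n) c T T' M M' :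
  0 < c -> scales_lebesgue c T ->
  cancel T T' -> cancel T' T -> affine_rV T M -> affine_rV T' M' ->
  L1loc f -> is_weak_gradient f F ->
  is_weak_gradient (f \o T) (fun x => \row_j dot (M j) (F (T x))).
Proof.
move=> c0 sT TK T'K aT aT' lf fF j.
have [[cT _] [cT' _]] := (aT, aT').
have lFi i : L1loc (fun x => M j ord0 i * F (T x) ord0 i).
  apply: L1locZ; have [lF _] := fF i.
  exact: (L1loc_scaling c0 sT TK cT lF).
split.
  rewrite (_ : (fun x => _) = (fun x => \sum_i M j ord0 i * F (T x) ord0 i)).
    exact: L1loc_sum.
  by apply/funext => x; rewrite mxE.
move=> phi tphi.
pose psi := phi \o T'.
have tpsi : test_function psi := test_function_affine aT' T'K TK cT tphi.
have phiE : phi = psi \o T by apply/funext => x; rewrite /psi/= TK.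
have mf : measurable_fun setT f by case: lf.
have mpsi : measurable_fun setT psi.
  exact: continuous_measurable_rV (test_function_continuous tpsi).
have mFi i : measurable_fun setT (fun x => F x ord0 i) by case: (fF i) => -[].
have mpart i : measurable_fun setT (partial i psi).
  by apply: continuous_measurable_rV; exact: test_function_partial_continuous.
pose h1 y := \sum_i M j ord0 i * (f y * partial i psi y).
pose h2 y := \sum_i M j ord0 i * (F y ord0 i * psi y).
transitivity (\int[leb]_x h1 (T x)).
  apply: eq_Rintegral => x _; rewrite phiE /=.
  rewrite (partial_comp_affine _ _ aT); last by have [/(_ 1%N)] := tpsi.
  by rewrite mulr_sumr; apply: eq_bigr => i _; rewrite mulrCA.
transitivity (- \int[leb]_x h2 (T x)); last first.
  congr (- _); apply: eq_Rintegral => x _; rewrite phiE /= mxE mulr_suml.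
  by apply: eq_bigr => i _; rewrite mulrA.
have chg h : measurable_fun setT h ->
    \int[leb]_x h (T x) = c * \int[leb]_x h x.
  move=> mh; have := Rintegral_scaling c0 sT measurableT mh.
  by rewrite preimage_setT.
rewrite !chg; last 2 first.
- apply: measurable_sum => i; apply: measurable_funM => //.
  exact: measurable_funM.
- apply: measurable_sum => i; apply: measurable_funM => //.
  exact: measurable_funM.
rewrite /h1 /h2 !Rintegral_linear_comb; last 2 first.
- by move=> i; apply: integrable_test => //; case: (fF i).
- by move=> i; exact: integrable_partial_test.
rewrite -mulrN -sumrN; congr (_ * _); apply: eq_bigr => i _.
by have [_ ->] := fF i; rewrite // mulrN.
Qed.

End L1loc_theory.

(** * Dilations, foldings and the two functionals *)

Section Rintegral_complements.
Context d (T : measurableType d) (R : realType) (mu : {measure set T -> \bar R}).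
Implicit Types (f g : T -> R).

Lemma ae_eq_Rintegral f g : measurable_fun setT f -> measurable_fun setT g ->
  {ae mu, forall x, f x = g x} -> \int[mu]_x f x = \int[mu]_x g x.
Proof.
move=> mf mg fg; congr fine; apply: ae_eq_integral => //.
- exact/measurable_EFinP.
- exact/measurable_EFinP.
- by apply: filterS fg => x Ex _; rewrite Ex.
Qed.

Lemma ae_eq_integrable f g : measurable_fun setT f -> measurable_fun setT g ->
  {ae mu, forall x, f x = g x} -> mu.-integrable setT (EFin \o f) ->
  mu.-integrable setT (EFin \o g).
Proof.
move=> mf mg fg /integrableP[_ foo]; apply/integrableP.
split; first exact/measurable_EFinP.
suff <- : (\int[mu]_x `|(f x)%:E| = \int[mu]_x `|(g x)%:E|)%E by [].
apply: ae_eq_integral => //.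
- by apply: measurableT_comp => //; exact/measurable_EFinP.
- by apply: measurableT_comp => //; exact/measurable_EFinP.
- by apply: filterS fg => x -> _.
Qed.

(** The real integral of a measurable function that is not integrable is 0, so
    that the identity also holds in this case. *)
Lemma RintegralZl_measurable k f : k != 0 -> measurable_fun setT f ->
  \int[mu]_x (k * f x) = k * \int[mu]_x f x.
Proof.
move=> k0 mf.
have nonint h : measurable_fun setT h -> ~ mu.-integrable setT (EFin \o h) ->
    \int[mu]_x h x = 0.
  move=> mh nh; rewrite /Rintegral.
  have : (\int[mu]_x (h x)%:E)%E \isn't a fin_num.
    apply/negP; rewrite -integral_fin_num_abs// => hoo; apply: nh.
    by apply/integrableP; split => //; exact/measurable_EFinP.
  by case: (\int[mu]_x _)%E.
have [fi|fi] := pselect (mu.-integrable setT (EFin \o f)).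
  exact: RintegralZl.
rewrite (nonint f)// mulr0 nonint//; first exact: measurable_funM.
move=> kfi; apply: fi.
have := integrableZl measurableT k^-1 kfi.
by apply: eq_integrable => // x _; rewrite /= -EFinM mulKf.
Qed.

End Rintegral_complements.

Lemma eq_of_average (R : realFieldType) (x y z : R) :
  x + y = 2 * z -> z <= x -> z <= y -> x = z /\ y = z.
Proof. by move=> ? ? ?; split; lra. Qed.

Section euclidean_norm.
Context {R : realType} {n : nat}.
Implicit Types x y : 'rV[R]_n.

Lemma enormZ (k : R) x : 0 <= k -> enorm (k *: x) = k * enorm x.
Proof.
move=> k0; rewrite /enorm dotZl dotZr mulrA -expr2 sqrtrM ?sqr_ge0//.
by rewrite sqrtr_sqr ger0_norm.
Qed.

Lemma sqr_enorm x : enorm x ^+ 2 = dot x x.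
Proof. by rewrite sqr_sqrtr// dot_ge0. Qed.

Lemma enorm_eq0 x : (enorm x == 0) = (x == 0).
Proof. by rewrite -sqrf_eq0 sqr_enorm dot_eq0. Qed.

Lemma norm_le_enorm (x : 'rV[R]_n) : `|x| <= enorm x.
Proof.
apply: ler_norm_rV; first exact: enorm_ge0.
move=> i; rewrite -sqrtr_sqr /enorm ler_sqrt ?dot_ge0//.
rewrite /dot (bigD1 i)//= -expr2 lerDl.
by apply: sumr_ge0 => j _; rewrite -expr2 sqr_ge0.
Qed.

Lemma measurable_enorm d (T : measurableType d) (f : T -> 'rV[R]_n) :
  (forall i, measurable_fun setT (fun t => f t ord0 i)) ->
  measurable_fun setT (fun t => enorm (f t)).
Proof.
move=> mf; have ms : measurable_fun setT (@Num.sqrt R).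
  by apply: continuous_measurable_fun; exact: sqrt_continuous.
apply: (measurableT_comp ms).
by apply: measurable_sum => i; exact: measurable_funM.
Qed.

Lemma measurable_dot d (T : measurableType d) (f g : T -> 'rV[R]_n) :
  (forall i, measurable_fun setT (fun t => f t ord0 i)) ->
  (forall i, measurable_fun setT (fun t => g t ord0 i)) ->
  measurable_fun setT (fun t => dot (f t) (g t)).
Proof. by move=> mf mg; apply: measurable_sum => i; exact: measurable_funM. Qed.

Lemma reflection_dotC a x y :
  dot (reflection a 0 x) y = dot x (reflection a 0 y).
Proof.
rewrite /reflection !subr0 dotDl dotNl dotZl dotDr dotNr dotZr (dotC a x).
by rewrite (dotC a y); ring.
Qed.

Lemma row_dot_reflection a x :
  \row_j dot (reflection a 0 (delta_mx ord0 j)) x = reflection a 0 x.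
Proof. by apply/rowP => j; rewrite mxE reflection_dotC dot_delta. Qed.

End euclidean_norm.

Section folding.
Context {R : realType} {N : nat}.
Local Notation leb := (lebesgue_rV R N).
Implicit Types (a x : 'rV[R]_N) (b : R).

Lemma reflectionNN a b : reflection (- a) (- b) = reflection a b.
Proof.
apply/funext => x; apply/rowP => i.
by rewrite /reflection !(dotNl, dotNr) !mxE !opprK; ring.
Qed.

Lemma fold_negE T a b (f : 'rV[R]_N -> T) :
  fold_neg a b f = fold_pos (- a) (- b) f.
Proof.
by apply/funext => x; rewrite /fold_neg /fold_pos dotNl lerN2 reflectionNN.
Qed.

Lemma reflection_fix a b x : dot a x = b -> reflection a b x = x.
Proof.
by move=> abx; rewrite /reflection abx subrr mulr0 mul0r scale0r subr0.
Qed.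

Lemma fold_pos_refl T a b (f : 'rV[R]_N -> T) x : dot a x <= b ->
  fold_pos a b f x = f (reflection a b x).
Proof.
rewrite /fold_pos le_eqVlt => /predU1P[xb|xb].
  by rewrite xb lexx reflection_fix.
by rewrite leNgt xb.
Qed.

Lemma fold_posK T a b (f : 'rV[R]_N -> T) x : a != 0 ->
  fold_pos a b f (reflection a b x) = fold_pos a b f x.
Proof.
move=> a0; have [xb|xb] := leP b (dot a x).
  rewrite fold_pos_refl; last by rewrite dot_reflection//; lra.
  by rewrite reflectionK// /fold_pos xb.
rewrite [RHS]fold_pos_refl ?ltW// /fold_pos ifT// dot_reflection//; lra.
Qed.

Lemma measurable_fold_pos a b (f : 'rV[R]_N -> R) : a != 0 ->
  measurable_fun setT f -> measurable_fun setT (fold_pos a b f).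
Proof.
move=> a0 mf; have [ms _] := reflection_scales b a0.
have mfs : measurable_fun setT (f \o reflection a b) by exact: measurableT_comp.
apply: (measurable_fun_ifT (f := fun x => b <= dot a x)) => //.
by apply: measurable_fun_ler => //; exact: measurable_fun_dot.
Qed.

Lemma ae_off_hyperplane a b : a != 0 -> {ae leb, forall x, dot a x != b}.
Proof.
move=> a0; exists [set x | dot a x = b]; split.
- exact: measurable_hyperplane.
- exact: lebesgue_hyperplane.
- by move=> x /negP; rewrite negbK => /eqP.
Qed.

(** The hyperplane itself is a null set. *)
Lemma Rintegral_halfspaces a b (h : 'rV[R]_N -> R) : a != 0 ->
  leb.-integrable setT (EFin \o h) ->
  \int[leb]_x h x = \int[leb]_(x in [set x | b < dot a x]) h x +
                    \int[leb]_(x in [set x | dot a x < b]) h x.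
Proof.
move=> a0 ih.
have mlt : measurable [set x | dot a x < b].
  have := measurable_open_halfspace (- a) (- b).
  by under eq_set do rewrite dotNl ltrN2.
have mgt := measurable_open_halfspace a b.
rewrite -Rintegral_setU//; last 2 first.
- by apply: integrableS ih => //; exact: measurableU.
- apply/disj_setPS => x [/= h1 h2].
  by move: (lt_trans h1 h2); rewrite ltxx.
rewrite [in RHS]Rintegral_mkcond; apply: ae_eq_Rintegral.
- exact: (iffLR (measurable_EFinP _ _) (measurable_int leb ih)).
- apply/(measurable_restrictT _ _).1; first exact: measurableU.
  apply: measurable_funTS.
  exact: (iffLR (measurable_EFinP _ _) (measurable_int leb ih)).
apply: filterS (ae_off_hyperplane b a0) => x xb.
rewrite patchE ifT// inE /=; move: xb; rewrite neq_lt => /orP[|]; tauto.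
Qed.

Lemma Rintegral_fold_pos a b (h : 'rV[R]_N -> R) : a != 0 ->
  leb.-integrable setT (EFin \o h) ->
  leb.-integrable setT (EFin \o fold_pos a b h) ->
  \int[leb]_x fold_pos a b h x = 2 * \int[leb]_(x in [set x | b < dot a x]) h x.
Proof.
move=> a0 ih ifh.
have mh : measurable_fun setT h.
  exact: (iffLR (measurable_EFinP _ _) (measurable_int leb ih)).
rewrite (Rintegral_halfspaces b a0 ifh) mulr_natl mulr2n; congr (_ + _).
  by apply: eq_Rintegral => x; rewrite inE /fold_pos/= => /ltW ->.
have := Rintegral_scaling ltr01 (reflection_scales b a0)
  (measurable_open_halfspace a b) mh.
rewrite mul1r => <-.
rewrite (_ : _ @^-1` _ = [set x | dot a x < b]); last first.
  apply/seteqP; split=> x /=; rewrite dot_reflection//; lra.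
by apply: eq_Rintegral => x; rewrite inE /= => /ltW ?; rewrite fold_pos_refl.
Qed.

End folding.

Section admissible_spaces.
Context {R : realType} {N m : nat}.
Local Notation leb := (lebesgue_rV R N).
Variables (p : R) (g : 'I_m -> 'rV[R]_m -> R) (G : 'rV[R]_m -> R).
Variable X : set ('rV[R]_N -> 'rV[R]_m).
Hypothesis admX : admissible p g G X.
Implicit Types (u : 'rV[R]_N -> 'rV[R]_m) (a : 'rV[R]_N) (b : R).

Lemma gradP u i : X u -> is_weak_gradient (component i u) (grad u i).
Proof. by move=> Xu; apply: weak_gradientP; exact: (admissible_grad admX). Qed.

Lemma measurable_grad u i j : X u ->
  measurable_fun setT (fun x => grad u i x ord0 j).
Proof. by move=> Xu; have [[]] := gradP i Xu j. Qed.

Lemma measurable_energy_density u : X u ->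
  measurable_fun setT (energy_density p u).
Proof.
move=> Xu; apply: measurable_sum => i.
apply: (measurableT_comp (measurable_powR p)).
by apply: measurable_enorm => j; exact: measurable_grad.
Qed.

Lemma measurable_G u : X u -> measurable_fun setT (fun x => G (u x)).
Proof.
move=> Xu; apply: (iffLR (measurable_EFinP _ _)).
exact: (measurable_int leb (admissible_G admX Xu)).
Qed.

Lemma grad_affine u i c T T' M M' : 0 < c -> scales_lebesgue c T ->
  cancel T T' -> cancel T' T -> affine_rV T M -> affine_rV T' M' -> X u ->
  is_weak_gradient (component i (u \o T))
    (fun x => \row_j dot (M j) (grad u i (T x))).
Proof.
move=> c0 sT TK T'K aT aT' Xu.
have lf : L1loc (component i u) by exact: (admissible_L1loc admX).
exact: (is_weak_gradient_affine c0 sT TK T'K aT aT' lf (gradP i Xu)).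
Qed.

Lemma dilationK (s : R) : s != 0 ->
  cancel (fun x : 'rV[R]_N => s^-1 *: x) (fun x => s *: x).
Proof. by move=> s0 x; rewrite scalerA mulfV// scale1r. Qed.

Lemma dilationVK (s : R) : s != 0 ->
  cancel (fun x : 'rV[R]_N => s *: x) (fun x => s^-1 *: x).
Proof. by move=> s0 x; rewrite scalerA mulVf// scale1r. Qed.

Lemma grad_dilation u (s : R) : X u -> 0 < s ->
  {ae leb, forall x, forall i,
    grad (dilation s u) i x = s^-1 *: grad u i (s^-1 *: x)}.
Proof.
move=> Xu s0; apply: filter_forall => i.
have Xsu := admissible_dilation admX Xu s0.
have s0' := lt0r_neq0 s0.
have sN : 0 < s ^+ N by rewrite exprn_gt0.
have := grad_affine i sN (dilation_scales s0) (dilationK s0') (dilationVK s0')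
  (dilation_affine s^-1) (dilation_affine s) Xu.
move=> /(weak_gradient_ae_unique (gradP i Xsu)); apply: filterS => x ->.
by apply/rowP => j; rewrite !mxE dotZl dot_delta.
Qed.

Lemma energy_density_dilation u (s : R) : X u -> 0 < s ->
  {ae leb, forall x, energy_density p (dilation s u) x =
    s^-1 `^ p * energy_density p u (s^-1 *: x)}.
Proof.
move=> Xu s0; apply: filterS (grad_dilation Xu s0) => x Ex.
rewrite /energy_density mulr_sumr; apply: eq_bigr => i _.
have si : 0 <= s^-1 by rewrite invr_ge0 ltW.
by rewrite Ex enormZ// powRM// enorm_ge0.
Qed.

Lemma Rintegral_dilation (s : R) (h : 'rV[R]_N -> R) : 0 < s ->
  measurable_fun setT h ->
  \int[leb]_x h (s^-1 *: x) = s ^+ N * \int[leb]_x h x.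
Proof.
move=> s0 mh; have sN : 0 < s ^+ N by rewrite exprn_gt0.
by have := Rintegral_scaling sN (dilation_scales s0) measurableT mh;
  rewrite preimage_setT.
Qed.

Lemma functionalV_dilation u (s : R) : X u -> 0 < s ->
  functionalV G (dilation s u) = s ^+ N * functionalV G u.
Proof. by move=> Xu s0; exact: (Rintegral_dilation s0 (measurable_G Xu)). Qed.

(** This is where the exponent has to be the dimension. *)
Lemma functionalJ_dilation u (s : R) : p = N%:R -> X u -> 0 < s ->
  functionalJ p (dilation s u) = functionalJ p u.
Proof.
move=> pN Xu s0; rewrite /functionalJ; apply: (congr1 (fun z => p^-1 * z)).
have me := measurable_energy_density Xu.
have [ms _] := @dilation_scales R N s s0.
have mes : measurable_fun setT
    (fun x : 'rV[R]_N => energy_density p u (s^-1 *: x)).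
  exact: (measurableT_comp me ms).
transitivity (\int[leb]_x (s^-1 `^ p * energy_density p u (s^-1 *: x))).
  apply: ae_eq_Rintegral; last exact: energy_density_dilation.
    by apply: measurable_energy_density; exact: (admissible_dilation admX).
  exact: measurable_funM.
have si : 0 < s^-1 by rewrite invr_gt0.
rewrite RintegralZl_measurable//; last by rewrite gt_eqF// powR_gt0.
rewrite Rintegral_dilation// mulrA pN powR_mulrn ?ltW// -exprMn mulVf.
  by rewrite expr1n mul1r.
exact: lt0r_neq0.
Qed.

Lemma nontrivial_dilation u (s : R) : 0 < s -> nontrivial u ->
  nontrivial (dilation s u).
Proof.
move=> s0 nu su0; apply: nu.
have si : 0 < s^-1 by rewrite invr_gt0.
have := ae_scaling (dilation_scales si) su0.
by apply: filterS => x; rewrite /dilation invrK dilationVK// lt0r_neq0.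
Qed.

(** The dilation [x |-> u (x / s)] divides the p-Laplacian by [s ^ p]. *)
Lemma weak_solution_dilation u (s : R) : X u -> 0 < s ->
  weak_solution p (fun i v => s `^ p * g i v) u ->
  weak_solution p g (dilation s u).
Proof.
move=> Xu s0 su i phi tphi.
have s0' := lt0r_neq0 s0.
have si : 0 < s^-1 by rewrite invr_gt0.
pose psi := phi \o (fun x => s *: x).
have tpsi : test_function psi.
  apply: (test_function_affine (dilation_affine s) (dilationVK s0')
    (dilationK s0')) => //.
  exact: scaler_continuous.
have phiE : phi = psi \o (fun x => s^-1 *: x).
  by apply/funext => x; rewrite /psi/= dilationK.
have gphi x : gradient phi x = s^-1 *: gradient psi (s^-1 *: x).
  apply/rowP => j; rewrite !mxE phiE.
  rewrite (partial_comp_affine _ _ (dilation_affine s^-1)).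
    under eq_bigr do rewrite mxE -mulrA.
    rewrite -mulr_sumr; congr (_ * _).
    by rewrite (bigD1 j)//= big1 => [|k kj];
      rewrite mxE ?eqxx ?mul1r ?addr0// (negbTE kj) andbF mul0r.
  by have [/(_ 1%N)] := tpsi.
have mgpsi j : measurable_fun setT (fun x => gradient psi x ord0 j).
  under eq_fun do rewrite mxE.
  by apply: continuous_measurable_rV; exact: test_function_partial_continuous.
have mgphi j : measurable_fun setT (fun x => gradient phi x ord0 j).
  under eq_fun do rewrite mxE.
  by apply: continuous_measurable_rV; exact: test_function_partial_continuous.
have mflux v (f : 'rV[R]_N -> 'rV[R]_N) : X v ->
    (forall j, measurable_fun setT (fun x => f x ord0 j)) ->
    measurable_fun setT
      (fun x => enorm (grad v i x) `^ (p - 2) * dot (grad v i x) (f x)).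
  move=> Xv mf; apply: measurable_funM.
    apply: (measurableT_comp (measurable_powR (p - 2))).
    by apply: measurable_enorm => j; exact: measurable_grad.
  by apply: measurable_dot => // j; exact: measurable_grad.
pose k x := enorm (grad u i x) `^ (p - 2) * dot (grad u i x) (gradient psi x).
have mk : measurable_fun setT k by exact: mflux.
have mg : measurable_fun setT (fun x => g i (u x)).
  by have [] := admissible_g admX i Xu.
have mpsi : measurable_fun setT psi.
  by apply: continuous_measurable_rV; exact: test_function_continuous.
have [ms _] := @dilation_scales R N s s0.
have sp0 : s `^ p != 0 by rewrite gt_eqF// powR_gt0.
transitivity (\int[leb]_x ((s `^ p)^-1 * k (s^-1 *: x))).
  apply: ae_eq_Rintegral.
  - by apply: mflux => //; exact: (admissible_dilation admX).
  - by apply: measurable_funM => //; exact: (measurableT_comp mk ms).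
  apply: filterS (grad_dilation Xu s0) => x Ex.
  have si' : 0 <= s^-1 by exact: ltW.
  rewrite Ex gphi enormZ// powRM ?enorm_ge0// dotZl dotZr /k.
  have <- : s^-1 `^ (p - 2) * (s^-1 * s^-1) = (s `^ p)^-1.
    apply: (mulIf sp0); rewrite mulVf// -expr2 -powR_mulrn// -powRD; last first.
      by rewrite (lt0r_neq0 si) implybT.
    by rewrite subrK -powRM ?(ltW s0)// mulVf// powR1.
  by ring.
rewrite RintegralZl_measurable ?invr_neq0//; last exact: (measurableT_comp mk ms).
rewrite Rintegral_dilation// (su i psi tpsi).
under eq_Rintegral do rewrite -mulrA.
rewrite RintegralZl_measurable//; last exact: measurable_funM.
rewrite mulrCA mulKf// -Rintegral_dilation//; last exact: measurable_funM.
by apply: eq_Rintegral => x _; rewrite phiE.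
Qed.

(** The gradient of the folding is the gradient of [u] on the positive side of
    the hyperplane, and its mirror image, which has the same length, on the
    other side. *)
Lemma Rintegral_fold_energy u a b : a != 0 -> X u ->
  \int[leb]_x energy_density p (fold_pos a b u) x =
  2 * \int[leb]_(x in [set x | b < dot a x]) energy_density p u x.
Proof.
move=> a0 Xu; have Xfu := admissible_fold_pos admX b Xu a0.
pose s := reflection a b.
have sK : involutive s by exact: reflectionK.
have ss : scales_lebesgue 1 s by exact: reflection_scales.
have as_ : affine_rV s (fun j => reflection a 0 (delta_mx ord0 j)).
  exact: reflection_affine.
have above : {ae leb, forall x, forall i, b < dot a x ->
    grad (fold_pos a b u) i x = grad u i x}.
  apply: filter_forall => i.
  apply: (weak_gradient_local (gradP i Xfu) (gradP i Xu)) => x bx.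
  by rewrite /component /fold_pos bx.
have below : {ae leb, forall x, forall i, - b < dot (- a) x ->
    grad (fold_pos a b u) i x = reflection a 0 (grad u i (s x))}.
  apply: filter_forall => i.
  have wus := grad_affine i ltr01 ss sK sK as_ as_ Xu.
  have := weak_gradient_local (gradP i Xfu) wus (a := - a) (b := - b).
  have fus x : - b <= dot (- a) x ->
      component i (fold_pos a b u) x = component i (u \o s) x.
    by rewrite dotNl lerN2 => bx; rewrite /component fold_pos_refl.
  move=> /(_ fus); apply: filterS => x h hx.
  by rewrite h// row_dot_reflection.
have mfe := measurable_energy_density Xfu.
have me := measurable_energy_density Xu.
have E : {ae leb, forall x, energy_density p (fold_pos a b u) x =
    fold_pos a b (energy_density p u) x}.
  apply: filterS3 above below (ae_off_hyperplane b a0) => x xa xb.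
  rewrite neq_lt => /orP[xlt|xgt].
    rewrite [RHS]fold_pos_refl; last exact: ltW.
    apply: eq_bigr => i _; rewrite xb; last by rewrite dotNl ltrN2.
    by rewrite enorm_reflection.
  by rewrite [RHS]/fold_pos (ltW xgt); apply: eq_bigr => i _; rewrite xa.
have mf := measurable_fold_pos b a0 me.
rewrite (ae_eq_Rintegral mfe mf E); apply: Rintegral_fold_pos => //.
  exact: (admissible_energy admX).
exact: (ae_eq_integrable mfe mf E (admissible_energy admX Xfu)).
Qed.

Lemma functionalV_fold u a b : a != 0 -> X u ->
  functionalV G (fold_pos a b u) =
  2 * \int[leb]_(x in [set x | b < dot a x]) G (u x).
Proof.
move=> a0 Xu; have Xfu := admissible_fold_pos admX b Xu a0.
have E x : G (fold_pos a b u x) = fold_pos a b (fun y => G (u y)) x.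
  by rewrite /fold_pos; case: ifP.
rewrite /functionalV; under eq_Rintegral do rewrite E.
apply: Rintegral_fold_pos => //; first exact: (admissible_G admX).
have := admissible_G admX Xfu; apply: eq_integrable => // x _.
by rewrite /= -E.
Qed.

Lemma functionalJ_fold u a b : a != 0 -> X u ->
  functionalJ p (fold_pos a b u) =
  p^-1 * (2 * \int[leb]_(x in [set x | b < dot a x]) energy_density p u x).
Proof.
move=> a0 Xu.
exact: (congr1 (fun z => p^-1 * z) (Rintegral_fold_energy b a0 Xu)).
Qed.

Lemma functionalJ_folds u a b : a != 0 -> X u ->
  functionalJ p (fold_pos a b u) + functionalJ p (fold_neg a b u) =
  2 * functionalJ p u.
Proof.
move=> a0 Xu; have Na0 : - a != 0 by rewrite oppr_eq0.
rewrite fold_negE (functionalJ_fold b a0 Xu) (functionalJ_fold (- b) Na0 Xu).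
have -> : functionalJ p u = p^-1 * _ := congr1 (fun z => p^-1 * z)
  (Rintegral_halfspaces b a0 (admissible_energy admX Xu)).
have -> : [set x | - b < dot (- a) x] = [set x | dot a x < b].
  by apply/seteqP; split=> x /=; rewrite dotNl ltrN2.
set I := Rintegral _ _ _; set J := Rintegral _ _ _.
by rewrite !mulrDr !(mulrCA p^-1).
Qed.

Lemma functionalV_folds u a b : a != 0 -> X u ->
  functionalV G (fold_pos a b u) + functionalV G (fold_neg a b u) =
  2 * functionalV G u.
Proof.
move=> a0 Xu; have Na0 : - a != 0 by rewrite oppr_eq0.
rewrite fold_negE (functionalV_fold b a0 Xu) (functionalV_fold (- b) Na0 Xu).
have -> : functionalV G u = _ :=
  Rintegral_halfspaces b a0 (admissible_G admX Xu).
have -> : [set x | - b < dot (- a) x] = [set x | dot a x < b].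
  by apply/seteqP; split=> x /=; rewrite dotNl ltrN2.
by rewrite mulrDr.
Qed.

(** Both foldings satisfy the constraint and their energies have average
    [functionalJ p u], the minimum. *)
Lemma fold_minimizer u a b : P0_minimizer p G X u -> a != 0 ->
  functionalV G (fold_pos a b u) = 0 ->
  nontrivial (fold_pos a b u) -> nontrivial (fold_neg a b u) ->
  P0_minimizer p G X (fold_pos a b u) /\ P0_minimizer p G X (fold_neg a b u).
Proof.
move=> [[Xu nu Vu] umin] a0 V1 n1 n2.
have V2 : functionalV G (fold_neg a b u) = 0.
  by have := functionalV_folds b a0 Xu; rewrite V1 Vu add0r mulr0.
have S1 : P0_set G X (fold_pos a b u).
  by split=> //; exact: (admissible_fold_pos admX).
have S2 : P0_set G X (fold_neg a b u).
  by split=> //; exact: (admissible_fold_neg admX).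
have JJ := functionalJ_folds b a0 Xu.
have J1 := umin _ S1; have J2 := umin _ S2.
have [E1 E2] := eq_of_average JJ J1 J2.
by split; split=> [|v Sv]; rewrite ?E1 ?E2; [|exact: umin| |exact: umin].
Qed.

End admissible_spaces.

Section scaled_minimizers.
Context {R : realType} {N m : nat}.
Variables (p : R) (g : 'I_m -> 'rV[R]_m -> R) (G : 'rV[R]_m -> R).
Variable X : set ('rV[R]_N -> 'rV[R]_m).
Hypothesis admX : admissible p g G X.
Hypotheses (p_gt1 : 1 < p) (pN : p = N%:R).
Implicit Types u v : 'rV[R]_N -> 'rV[R]_m.

Lemma dilated_minimizer_solution u (alpha : R) :
  P0_minimizer p G X u -> 0 < alpha ->
  weak_solution p (fun i y => alpha * g i y) u ->
  exists v, [/\ nontrivial_solutions p g X v, functionalV G v = 0 &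
    functionalJ p v = functionalJ p u].
Proof.
move=> [[Xu nu Vu] umin] a0 su.
have p0 : p != 0 by rewrite gt_eqF// (lt_trans ltr01).
pose s := alpha `^ p^-1.
have s0 : 0 < s by exact: powR_gt0.
have sp : s `^ p = alpha by rewrite /s -powRrM mulVf// powRr1// ltW.
exists (dilation s u); split.
- split; first exact: (admissible_dilation admX).
    exact: nontrivial_dilation.
  by apply: (weak_solution_dilation admX) => //; rewrite sp.
- by rewrite (functionalV_dilation admX)// Vu mulr0.
- exact: (functionalJ_dilation admX).
Qed.

End scaled_minimizers.

(** * Continuous representatives of minimizers *)

Section continuity_complements.
Context {R : realType} {N m : nat}.
Local Notation leb := (lebesgue_rV R N).
Implicit Types (u w : 'rV[R]_N -> 'rV[R]_m) (a x : 'rV[R]_N) (b : R).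

(** Folding a function is composing it with the folding of the space onto the
    half-space. The minimum replaces the case distinction by a formula that is
    visibly continuous. *)
Lemma fold_pos_comp T a b (f : 'rV[R]_N -> T) : a != 0 ->
  fold_pos a b f =
  f \o (fun x => x - Num.min 0 (2 * (dot a x - b) / dot a a) *: a).
Proof.
move=> /dot_gt0 a0; apply/funext => x; rewrite /fold_pos/=.
case: leP => h.
  rewrite min_l ?scale0r ?subr0// divr_ge0 ?(ltW a0)// mulr_ge0//.
  by rewrite subr_ge0.
rewrite min_r// pmulr_lle0 ?invr_gt0// pmulr_rle0// subr_le0; exact: ltW.
Qed.

Lemma continuous_fold_pos a b (f : 'rV[R]_N -> R) : a != 0 ->
  continuous f -> continuous (fold_pos a b f).
Proof.
move=> a0 cf; rewrite fold_pos_comp// => x.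
have ct : {for x, continuous (fun x => 2 * (dot a x - b) / dot a a)}.
  exact: (cvgM (cvgM (cvg_cst _) (cvgB (@continuous_dot _ _ a x) (cvg_cst _)))
    (cvg_cst _)).
have cm : {for x, continuous
    (fun x => Num.min 0 (2 * (dot a x - b) / dot a a))}.
  by apply: (continuous_min _ ct); exact: cst_continuous.
have cp : {for x, continuous
    (fun x => x - Num.min 0 (2 * (dot a x - b) / dot a a) *: a)}.
  exact: (cvgB cvg_id (cvgZ cm (cvg_cst _))).
exact: (continuous_comp cp (cf _)).
Qed.

Lemma component_fold_pos i a b u :
  component i (fold_pos a b u) = fold_pos a b (component i u).
Proof. by apply/funext => x; rewrite /component /fold_pos; case: ifP. Qed.

Lemma continuous_enorm w : (forall i, continuous (component i w)) ->
  continuous (fun x => enorm (w x)).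
Proof.
move=> cw x; have cs : {for x, continuous (fun x => dot (w x) (w x))}.
  apply: (@continuous_big _ _ _ _ xpredT add_continuous _ _
    (fun i x => w x ord0 i * w x ord0 i)) => i _ y.
  exact: (cvgM (cw i y) (cw i y)).
exact: (continuous_comp cs (@sqrt_continuous R _)).
Qed.

Lemma neq0_component (v : 'rV[R]_m) : v != 0 -> exists i, v ord0 i != 0.
Proof.
move=> v0; apply: contrapT => h; move/eqP: v0; apply; apply/rowP => i.
by rewrite mxE; apply: contrapT => vi; apply: h; exists i; exact/eqP.
Qed.

Lemma open_neq0 w : (forall i, continuous (component i w)) ->
  open [set x | w x != 0].
Proof.
move=> cw; have -> : [set x | w x != 0] = \bigcup_(i in [set: 'I_m])
    (component i w @^-1` [set y | y != 0]).
  apply/seteqP; split=> x /=; first by move=> /neq0_component[i wi]; exists i.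
  by move=> [i _ /=]; apply: contraNneq => w0; rewrite /component w0 mxE.
apply: bigcup_open => i _.
by move/continuousP : (cw i); apply; exact: open_neq.
Qed.

(** The set where [w] does not vanish is open, so none of its points is
    extremal in the direction [a]. *)
Lemma neq0_beyond w a x : (forall i, continuous (component i w)) -> a != 0 ->
  w x != 0 -> exists2 y, w y != 0 & dot a x < dot a y.
Proof.
move=> cw a0 wx.
have /nbhs_ballP[d /= d0 dU] : nbhs x [set x | w x != 0].
  by apply: open_nbhs_nbhs; split => //; exact: open_neq0.
pose k := d / 2 / (`|a| + 1).
have a1 : 0 < `|a| + 1 by rewrite ltr_wpDl.
have k0 : 0 < k by rewrite !divr_gt0.
exists (x + k *: a); last by rewrite dotDr dotZr ltrDl mulr_gt0// dot_gt0.
apply: dU; rewrite -ball_normE/= opprD addrA subrr sub0r normrN normrZ.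
rewrite gtr0_norm// /k mulrAC ltr_pdivrMr//.
have na := normr_ge0 a; nra.
Qed.

Lemma nontrivial_fold u w a b y : (forall i, continuous (component i w)) ->
  {ae leb, forall x, u x = w x} -> w y != 0 -> b < dot a y ->
  nontrivial (fold_pos a b u).
Proof.
move=> cw uw wy bay fu0.
have oU : open ([set x | w x != 0] `&` [set x | b < dot a x]).
  apply: openI; first exact: open_neq0.
  have /continuousP := @continuous_dot R N a.
  by move=> /(_ [set t | b < t]); apply; exact: open_gt.
have : {ae leb, forall x, u x = w x /\ fold_pos a b u x = 0}.
  by apply: filterS2 uw fu0.
move=> /(ae_open_exists oU (conj wy bay))[z [/= wz bz] [uwz]].
by rewrite /fold_pos ltW// uwz => /eqP; rewrite (negbTE wz).
Qed.

End continuity_complements.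

Section vanishing_minimizers.
Context {R : realType} {N m : nat}.
Local Notation leb := (lebesgue_rV R N).
Variables (p : R) (G : 'rV[R]_m -> R).
Variable X : set ('rV[R]_N -> 'rV[R]_m).
Hypothesis minimizer_C1 : forall u, P0_minimizer p G X u -> C1_class u.
Implicit Types (u w : 'rV[R]_N -> 'rV[R]_m) (a x : 'rV[R]_N) (b : R).

(** The function [w] is the continuous representative of the minimizer [u].
    Both are kept because the space [X] need not be stable under modification
    on null sets, while the pointwise arguments concern [w]. Vanishing at
    infinity is expressed by the compactness of the superlevel sets, a form
    that is inherited by foldings. *)
Record vanishing_minimizer u w : Prop := VanishingMinimizer {
  vm_minimizer : P0_minimizer p G X u;
  vm_continuous : forall i, continuous (component i w);
  vm_ae : {ae leb, forall x, u x = w x};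
  vm_compact : forall e : R, 0 < e -> compact [set x | e <= enorm (w x)] }.

Lemma vm_C1 u w i : vanishing_minimizer u w -> Ck 1 (component i w).
Proof.
move=> uw; have [w' [w'1 uw']] := minimizer_C1 (vm_minimizer uw).
have -> : w = w'; last exact: w'1.
apply: ae_continuous_eq => [j|j|].
- exact: (vm_continuous uw).
- exact: (Ck_continuous (w'1 j)).
- by apply: filterS2 (vm_ae uw) uw' => x <-.
Qed.

Lemma vm_neq0 u w : vanishing_minimizer u w -> exists x, w x != 0.
Proof.
move=> uw; apply: contrapT => w0.
have [[_ nu _] _] := vm_minimizer uw; apply: nu.
apply: filterS (vm_ae uw) => x ->; apply: contrapT => wx; apply: w0.
by exists x; exact/eqP.
Qed.

Lemma vm_fold u w a b : a != 0 -> vanishing_minimizer u w ->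
  P0_minimizer p G X (fold_pos a b u) ->
  vanishing_minimizer (fold_pos a b u) (fold_pos a b w).
Proof.
move=> a0 uw mfu.
have cfw i : continuous (component i (fold_pos a b w)).
  rewrite component_fold_pos; apply: continuous_fold_pos => //.
  exact: (vm_continuous uw).
split=> //.
  apply: filterS2 (vm_ae uw) (ae_scaling (reflection_scales b a0) (vm_ae uw)).
  by move=> x h1 h2; rewrite /fold_pos h1 h2.
move=> e e0; pose K := [set x | e <= enorm (w x)].
have cK : compact K by exact: (vm_compact uw).
have cKK : compact (K `|` reflection a b @` K).
  apply: compactU => //; apply: continuous_compact => //.
  exact/continuous_subspaceT/continuous_reflection.
apply: (subclosed_compact _ cKK).
  apply: (preimage_closed (D := [set y | e <= y])); last exact: closed_ge.
  by move=> x _; exact: (@continuous_enorm _ _ _ (fold_pos a b w) cfw x).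
move=> x; rewrite /= /fold_pos; case: ifP => _ h; first by left.
by right; exists (reflection a b x) => //; exact: reflectionK.
Qed.

(** A C^1 function that is even in the direction [a] across the hyperplane
    has a vanishing derivative in this direction on the hyperplane. *)
Lemma vm_derive_eq0 u w a b i x : a != 0 -> vanishing_minimizer u w ->
  P0_minimizer p G X (fold_pos a b u) -> dot a x = b ->
  'D_a (component i w) x = 0.
Proof.
move=> a0 uw mfu axb.
pose f := component i w; pose F := fold_pos a b f.
have [df Df] := Ck1_diff x (vm_C1 i uw).
have F1 : Ck 1 F.
  by have := vm_C1 i (vm_fold a0 uw mfu); rewrite component_fold_pos.
have [dF DF] := Ck1_diff x F1.
have Fsym (h : R) : F (h *: - a + x) = F (h *: a + x).
  rewrite -[RHS](fold_posK b f (h *: a + x) a0); congr (F _).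
  apply/rowP => j; rewrite /reflection dotDr dotZr axb !mxE.
  by field; exact/lt0r_neq0/dot_gt0.
have DF0 : 'D_a F x = 0.
  have : 'D_(- a) F x = 'D_a F x.
    rewrite /derive; have -> :
        (fun h : R => h^-1 *: ((F \o shift x) (h *: - a) - F x)) =
        (fun h : R => h^-1 *: ((F \o shift x) (h *: a) - F x)) => //.
    by apply/funext => h /=; rewrite Fsym.
  by rewrite !DF dotNl => /eqP; rewrite -subr_eq0 => /eqP h; lra.
have dfa : derivable f x a by exact: diff_derivable.
have dFa : derivable F x a by exact: diff_derivable.
rewrite -/f -DF0 /derive.
pose q (k : 'rV[R]_N -> R) (h : R) := h^-1 *: ((k \o shift x) (h *: a) - k x).
rewrite (@cvg_at_rightE _ _ (q f) 0 dfa) (@cvg_at_rightE _ _ (q F) 0 dFa).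
have qE : \forall h \near 0^'+, q f h = q F h.
  near=> h; have h0 : 0 < h by [].
  rewrite /q /F /fold_pos /= axb lexx dotDr dotZr axb lerDr.
  by rewrite mulr_ge0 ?(ltW h0)// dot_ge0.
have cqF : q F h @[h --> 0^'+] --> lim (q F h @[h --> 0^'+]).
  exact: cvgP (cvg_dnbhs_at_right dFa).
have qE' : {near 0^'+, q F =1 q f} by apply: filterS qE => h ->.
have cqf : q f h @[h --> 0^'+] --> lim (q F h @[h --> 0^'+]).
  exact: cvg_trans (near_eq_cvg qE') cqF.
exact: (cvg_lim (@norm_hausdorff _ _) cqf).
Unshelve. all: by end_near. Qed.

End vanishing_minimizers.

(** * Radial functions *)

Section radial.
Context {R : realType} {N m : nat}.
Implicit Types (w : 'rV[R]_N -> 'rV[R]_m) (a x y c : 'rV[R]_N).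

Definition radial_about w c :=
  forall x y, dot (x - c) (x - c) = dot (y - c) (y - c) -> w x = w y.

(** Rotating from [a] towards an orthogonal vector [b] of the same length
    moves along the level set of a function whose gradient is radial. *)
Lemma constant_on_rotation (f : 'rV[R]_N -> R) c a b (theta : R) : Ck 1 f ->
  (forall x v, dot v (x - c) = 0 -> 'D_v f x = 0) ->
  dot a a = dot b b -> dot a b = 0 ->
  f (c + (cos theta *: a + sin theta *: b)) = f (c + a).
Proof.
move=> f1 f0 ab ab0.
pose gam (t : R) : 'rV[R]_N := c + (cos t *: a + sin t *: b).
pose gam' (t : R) : 'rV[R]_N := - sin t *: a + cos t *: b.
have dgami (t : R) j : is_derive t (1 : R) (fun s : R => gam s ord0 j)
    (gam' t ord0 j).
  have -> : (fun s : R => gam s ord0 j) = (fun s : R => c ord0 j +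
      (a ord0 j * cos s + b ord0 j * sin s)).
    by apply/funext => s; rewrite !mxE ![_ * _ ord0 j]mulrC.
  apply: is_derive_eq.
  by rewrite !mxE /GRing.scale/=; ring.
have dgam (t : R) : is_derive t (1 : R) gam (gam' t).
  have dg : derivable gam t 1.
    by apply/derivable_mxP => i j; rewrite (ord1 i); have [] := dgami t j.
  apply: DeriveDef => //; rewrite derive_mx//; apply/rowP => j.
  by rewrite mxE; have [] := dgami t j.
have dfgam (t : R) : is_derive t (1 : R) (f \o gam) 0.
  have [df Df] := Ck1_diff (gam t) f1.
  have dg : differentiable gam t.
    by apply/derivable1_diffP; have [] := dgam t.
  apply: DeriveDef.
    by apply/derivable1_diffP; exact: differentiable_comp.
  rewrite deriveE; last exact: differentiable_comp.
  rewrite diff_comp//= -!deriveE//.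
  have [_ ->] := dgam t.
  apply: f0; rewrite /gam /gam' addrAC subrr add0r.
  rewrite !(dotDl, dotDr, dotZl, dotZr) (dotC b a) ab0 ab.
  by ring.
have := is_derive_0_is_cst theta 0 dfgam.
by rewrite /gam/= cos0 sin0 scale1r scale0r addr0.
Qed.

(** Two points [c + a] and [c + d] of a sphere are joined by the rotation in the
    plane spanned by [a] and [d]. No such plane is available if [d = - a], and
    this case is covered by the central symmetry. *)
Lemma radial_of_derivative w c : (forall i, Ck 1 (component i w)) ->
  (forall i x v, dot v (x - c) = 0 -> 'D_v (component i w) x = 0) ->
  (forall x, w (2 *: c - x) = w x) ->
  radial_about w c.
Proof.
move=> w1 w0 wsym.
suff core a d : dot a a = dot d d -> w (c + a) = w (c + d).
  by move=> x y /core; rewrite ![c + _]addrC !subrK.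
move=> ad; have [a0|a0] := eqVneq a 0.
  suff -> : d = 0 by rewrite a0.
  by apply/eqP; rewrite -dot_eq0 -ad dot_eq0 a0.
have aa := dot_gt0 a0.
pose k := dot a d / dot a a.
pose e := d - k *: a.
have ae : dot a e = 0.
  by rewrite /e dotDr dotNr dotZr /k mulfVK ?subrr// gt_eqF.
have ee : dot e e = dot a a * (1 - k ^+ 2).
  rewrite /e !(dotDl, dotDr, dotNl, dotNr, dotZl, dotZr) -ad (dotC d a).
  by rewrite /k; field; exact: lt0r_neq0.
have k1 : k ^+ 2 <= 1.
  by have := dot_ge0 e; rewrite ee pmulr_rge0// subr_ge0.
have kb : -1 <= k <= 1.
  rewrite -ler_norml -(ler_sqr _ _ ) ?nnegrE//.
  by rewrite ?real_normK// ?num_real// expr1n.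
have dE : d = k *: a + e by rewrite /e addrC subrK.
have [k2|k2] := eqVneq (k ^+ 2) 1.
  have e0 : e = 0 by apply/eqP; rewrite -dot_eq0 ee k2 subrr mulr0.
  rewrite dE e0 addr0; move/eqP: k2; rewrite sqrf_eq1 => /orP[] /eqP ->.
    by rewrite scale1r.
  rewrite -(wsym (c + a)); congr w; rewrite scaleN1r.
  by apply/rowP => i; rewrite !mxE; ring.
apply/rowP => i.
pose s := Num.sqrt (1 - k ^+ 2).
have s0 : 0 < s by rewrite sqrtr_gt0 subr_gt0 lt_neqAle k2.
have ss : s ^+ 2 = 1 - k ^+ 2 by rewrite sqr_sqrtr// subr_ge0.
(* Here [d = cos t *: a + sin t *: b], where [t = acos k] is the angle between
   [a] and [d] and [b = s^-1 *: e]. *)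
have := @constant_on_rotation (component i w) c a (s^-1 *: e) (acos k)
  (w1 i) (w0 i).
rewrite acosK// sin_acos// -/s scalerA mulfV ?lt0r_neq0// scale1r -dE.
move=> h; apply/esym/h; last by rewrite dotZr ae mulr0.
by rewrite dotZl dotZr ee -ss; field; exact: lt0r_neq0.
Qed.

End radial.

(** * Hyperplanes that split the constraint evenly *)

Section splitting.
Context {R : realType} {N m : nat}.
Local Notation leb := (lebesgue_rV R N).
Variables (p : R) (g : 'I_m -> 'rV[R]_m -> R) (G : 'rV[R]_m -> R).
Variable X : set ('rV[R]_N -> 'rV[R]_m).
Hypothesis admX : admissible p g G X.
Hypothesis minimizer_C1 : forall u, P0_minimizer p G X u -> C1_class u.
Implicit Types (u w : 'rV[R]_N -> 'rV[R]_m) (a x : 'rV[R]_N) (b : R).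

(** Dominated convergence: if [b'] tends to [b], the indicator functions of the
    half-spaces converge off the null hyperplane [dot a x = b]. *)
Lemma continuous_halfspace_integral a (h : 'rV[R]_N -> R) : a != 0 ->
  leb.-integrable setT (EFin \o h) ->
  continuous (fun b => \int[leb]_(x in [set x | b < dot a x]) h x).
Proof.
move=> a0 ih b; apply/(@cvg_nbhsP _ R^o) => bn bnb.
have mh : measurable_fun setT h.
  exact: (iffLR (measurable_EFinP _ _) (measurable_int leb ih)).
pose D b := [set x : 'rV[R]_N | b < dot a x].
have mD b' : measurable (D b') by exact: measurable_open_halfspace.
have mhD b' : measurable_fun setT (h \_ (D b')).
  exact: (iffLR (measurable_restrictT h (mD b')) (measurable_funTS mh)).
have := @dominated_convergence _ _ R leb setT measurableT
  (fun n x => ((h \_ (D (bn n))) x)%:E) (fun x => ((h \_ (D b)) x)%:E)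
  (fun x => `|(h x)%:E|%E).
case.
- by move=> n; exact/measurable_EFinP.
- exact/measurable_EFinP.
- apply: filterS (ae_off_hyperplane b a0) => x xb _.
  apply: cvg_near_cst.
  move: xb; rewrite neq_lt => /orP[xb|xb].
    have /cvgrPdist_lt/(_ (b - dot a x)) := bnb; rewrite subr_gt0 => /(_ xb).
    apply: filterS => n; rewrite ltr_norml => /andP[h1 h2].
    by rewrite !patchE !memNset//= /D/=; apply/negP; rewrite -leNgt; lra.
  have /cvgrPdist_lt/(_ (dot a x - b)) := bnb; rewrite subr_gt0 => /(_ xb).
  apply: filterS => n; rewrite ltr_norml => /andP[h1 h2].
  by rewrite !patchE !mem_set//= /D/=; lra.
- exact: integrable_abse.
- apply: aeW => x n _; rewrite lee_fin patchE; case: ifP => // _.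
  by rewrite normr0.
move=> ihD _ cv.
have fin b' : (\int[leb]_x ((h \_ (D b')) x)%:E)%E \is a fin_num.
  apply: integrable_fin_num => //.
  apply: le_integrable ih => //; first exact/measurable_EFinP.
  move=> x _; rewrite /= lee_fin patchE; case: ifP => // _.
  by rewrite normr0.
under eq_fun do rewrite Rintegral_mkcond.
rewrite Rintegral_mkcond.
move: cv; rewrite -[X in _ --> X](fineK (fin b)).
move/fine_cvg; exact.
Qed.

(** A nonnegative function with integral 0 vanishes a.e., which is impossible on
    a nonempty open set where it is positive. *)
Lemma Rintegral_gt0 (h : 'rV[R]_N -> R) (D U : set 'rV[R]_N) y :
  leb.-integrable setT (EFin \o h) -> measurable D ->
  {ae leb, forall x, D x -> 0 <= h x} ->
  open U -> U y -> {ae leb, forall x, U x -> D x /\ 0 < h x} ->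
  0 < \int[leb]_(x in D) h x.
Proof.
move=> ih mD hD oU Uy hU.
have mh : measurable_fun setT h.
  exact: (iffLR (measurable_EFinP _ _) (measurable_int leb ih)).
have ihD : leb.-integrable D (EFin \o h).
  by apply: integrableS ih => //; exact: subsetT.
have E : (\int[leb]_(x in D) (h x)%:E = \int[leb]_(x in D) `|(h x)%:E|)%E.
  apply: ae_eq_integral => //.
  - exact: measurable_int ihD.
  - by apply: measurableT_comp => //; exact: measurable_int ihD.
  - by apply: filterS hD => x hx Dx; rewrite gee0_abs// lee_fin hx.
rewrite lt_neqAle; apply/andP; split; last first.
  rewrite /Rintegral E; apply: fine_ge0; exact: integral_ge0.
apply/eqP => h0.
have : (\int[leb]_(x in D) `|(h x)%:E| = 0)%E.
  rewrite -E -[LHS]fineK; first by congr EFin; exact/esym.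
  exact: integrable_fin_num ihD.
move/(ae_eq_integral_abs leb mD (measurable_int leb ihD)) => hae.
have : {ae leb, forall x, (D x -> (h x)%:E = 0%E) /\ (U x -> D x /\ 0 < h x)}.
  by apply: filterS2 hae hU.
move=> /(ae_open_exists oU Uy)[z Uz [h1 h2]].
have [Dz hz] := h2 Uz.
by have [hz0] := h1 Dz; rewrite hz0 ltxx in hz.
Qed.

(* [s] is the sign of [G] near the origin, up to a positive factor. *)
Variables (eps s : R).
Hypothesis eps0 : 0 < eps.
Hypothesis s0 : s != 0.
Hypothesis sG : forall v : 'rV[R]_m, 0 < enorm v < eps -> 0 < s * G v.
Hypothesis sG0 : 0 <= s * G 0.

Lemma sG_ge0 (v : 'rV[R]_m) : enorm v < eps -> 0 <= s * G v.
Proof.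
move=> ve; have [->//|v0] := eqVneq v 0.
by apply/ltW/sG; rewrite ve andbT lt_def enorm_eq0 v0 enorm_ge0.
Qed.

Lemma Rintegral_sG_gt0 u w (D : set 'rV[R]_N) y :
  vanishing_minimizer p G X u w -> open D ->
  (forall x, D x -> enorm (w x) < eps) -> D y -> w y != 0 ->
  0 < \int[leb]_(x in D) (s * G (u x)).
Proof.
move=> uw oD De Dy wy.
have [[Xu _ _] _] := vm_minimizer uw.
have cw := vm_continuous uw.
have iG : leb.-integrable setT (EFin \o (fun x => s * G (u x))).
  exact: (integrableZl measurableT s (admissible_G admX Xu)).
apply: (@Rintegral_gt0 _ D ([set x | w x != 0] `&` D) y) => //.
- exact: measurable_rV_open.
- by apply: filterS (vm_ae uw) => x -> Dx; apply: sG_ge0; exact: De.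
- by apply: openI => //; exact: open_neq0.
- apply: filterS (vm_ae uw) => x -> [/= wx Dx]; split => //; apply: sG.
  by rewrite De// andbT lt_def enorm_eq0 wx enorm_ge0.
Qed.

Lemma open_halfspace a b : open [set x : 'rV[R]_N | b < dot a x].
Proof.
have /continuousP := @continuous_dot R N a.
by move=> /(_ [set t | b < t]); apply; exact: open_gt.
Qed.

(** The set where [w] is not small is compact. Beyond its two supporting
    hyperplanes orthogonal to [a], the integral of [G (u x)] has a sign, and
    these two signs give opposite signs to the integrals over the half-spaces
    on a given side. *)
Lemma splitting_hyperplane u w a : a != 0 -> vanishing_minimizer p G X u w ->
  exists b, vanishing_minimizer p G X (fold_pos a b u) (fold_pos a b w) /\
            vanishing_minimizer p G X (fold_neg a b u) (fold_neg a b w).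
Proof.
move=> a0 uw.
have [[Xu nu Vu] umin] := vm_minimizer uw.
have cw := vm_continuous uw.
have Na0 : - a != 0 by rewrite oppr_eq0.
have iG : leb.-integrable setT (EFin \o (fun x => s * G (u x))).
  exact: (integrableZl measurableT s (admissible_G admX Xu)).
have V0 : \int[leb]_x (s * G (u x)) = 0.
  rewrite RintegralZl//; last exact: (admissible_G admX).
  by rewrite [X in s * X]Vu mulr0.
pose K := [set x | eps <= enorm (w x)].
have cK : compact K by exact: (vm_compact uw).
have [y0 wy0] := vm_neq0 uw.
(* Otherwise [s * G (u x)] would be nonnegative with a positive integral. *)
have K0 : K !=set0.
  apply/set0P/negP => /eqP K0; have := ltxx (0 : R); rewrite -{2}V0.
  rewrite (@Rintegral_sG_gt0 u w setT y0)//; first exact: openT.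
  by move=> x _; rewrite ltNge; apply/negP => h; have : K x by []; rewrite K0.
have cd : {within K, continuous (dot a : 'rV[R]_N -> R)}.
  exact/continuous_subspaceT/continuous_dot.
have [xM /set_mem KM hM] := compact_EVT_max K0 cK cd.
have [xm /set_mem Km hm] := compact_EVT_min K0 cK cd.
have wK x : K x -> w x != 0.
  by move=> Kx; rewrite -enorm_eq0 gt_eqF// (lt_le_trans eps0).
pose Phi b := \int[leb]_(x in [set x | b < dot a x]) (s * G (u x)).
have Phi_pos : 0 < Phi (dot a xM).
  have [y wy ay] := neq0_beyond cw a0 (wK _ KM).
  apply: (@Rintegral_sG_gt0 u w _ y) => //; first exact: open_halfspace.
  move=> x /= xx; rewrite ltNge; apply/negP => h.
  by have := hM x (mem_set h); rewrite leNgt xx.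
have Phi_neg : Phi (dot a xm) < 0.
  have [y wy ay] := neq0_beyond cw Na0 (wK _ Km).
  have : 0 < \int[leb]_(x in [set x | - dot a xm < dot (- a) x]) (s * G (u x)).
    apply: (@Rintegral_sG_gt0 u w _ y) => //; first exact: open_halfspace.
      move=> x /=; rewrite dotNl ltrN2 => xx; rewrite ltNge; apply/negP => h.
      by have := hm x (mem_set h); rewrite leNgt xx.
    by rewrite /= -dotNl.
  have -> : [set x | - dot a xm < dot (- a) x] = [set x | dot a x < dot a xm].
    by apply/seteqP; split=> x /=; rewrite dotNl ltrN2.
  have := Rintegral_halfspaces (dot a xm) a0 iG; rewrite V0 -/(Phi _).
  by move=> /eqP; rewrite eq_sym addr_eq0 => /eqP ->; rewrite oppr_lt0.
have mM : dot a xm <= dot a xM by apply: hm; exact: mem_set.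
have cPhi : {within `[dot a xm, dot a xM], continuous Phi}.
  exact/continuous_subspaceT/continuous_halfspace_integral.
have [b] : exists2 b, b \in `[dot a xm, dot a xM] & Phi b = 0.
  apply: IVT => //.
  by rewrite ge_min le_max (ltW Phi_pos) (ltW Phi_neg) orbT.
rewrite in_itv/= => /andP[mb bM] Phib.
have VF : functionalV G (fold_pos a b u) = 0.
  rewrite (functionalV_fold admX b a0 Xu).
  have : s * \int[leb]_(x in [set x | b < dot a x]) G (u x) = 0.
    rewrite -Phib /Phi RintegralZl//; first exact: measurable_open_halfspace.
    apply: integrableS (admissible_G admX Xu) => //.
    exact: measurable_open_halfspace.
  by move=> /eqP; rewrite mulf_eq0 (negbTE s0)/= => /eqP ->; rewrite mulr0.
have n1 : nontrivial (fold_pos a b u).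
  have [y wy ay] := neq0_beyond cw a0 (wK _ KM).
  exact: (nontrivial_fold cw (vm_ae uw) wy (le_lt_trans bM ay)).
have n2 : nontrivial (fold_neg a b u).
  have [y wy ay] := neq0_beyond cw Na0 (wK _ Km).
  rewrite fold_negE; apply: (nontrivial_fold cw (vm_ae uw) wy).
  by apply: le_lt_trans ay; rewrite dotNl lerN2.
have [m1 m2] := fold_minimizer admX (vm_minimizer uw) a0 VF n1 n2.
exists b; split; first exact: vm_fold.
by move: m2; rewrite !fold_negE => m2; exact: vm_fold.
Qed.

End splitting.

(** * Symmetry of vanishing minimizers *)

Section symmetry.
Context {R : realType} {N m : nat}.
Local Notation leb := (lebesgue_rV R N).
Implicit Types (u w : 'rV[R]_N -> 'rV[R]_m) (a c x y : 'rV[R]_N) (b : R).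

(** A nonzero value would be repeated along an unbounded sequence in a compact
    superlevel set. *)
Lemma periodic_eq0 w (A : set 'rV[R]_N) t :
  (forall e : R, 0 < e -> compact [set x | e <= enorm (w x)]) ->
  t != 0 -> (forall x, A x -> A (x + t) /\ w (x + t) = w x) ->
  forall x, A x -> w x = 0.
Proof.
move=> cw t0 wt x Ax; apply/eqP/negPn/negP => wx.
have e0 : 0 < enorm (w x) by rewrite lt_def enorm_eq0 wx enorm_ge0.
have [M [Mr hM]] := compact_bounded (cw _ e0).
have wk k : A (x + k%:R *: t) /\ w (x + k%:R *: t) = w x.
  elim: k => [|k [Ak wk]]; first by rewrite scale0r addr0.
  by have [] := wt _ Ak; rewrite -natr1 scalerDl scale1r addrA wk.
have nt : 0 < `|t| by rewrite normr_gt0.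
pose k := (Num.truncn ((`|M| + 1 + `|x|) / `|t|)).+1.
have : `|x + k%:R *: t| <= `|M| + 1.
  apply: hM; first by rewrite ltr_pwDr// ler_norm.
  by rewrite /= (wk k).2.
rewrite leNgt => /negP; apply.
have kt : `|M| + 1 + `|x| < `|k%:R *: t|.
  rewrite normrZ ger0_norm// -ltr_pdivrMr//; exact: truncnS_gt.
have : `|k%:R *: t| <= `|x + k%:R *: t| + `|x|.
  by rewrite -{1}[k%:R *: t](addKr x) (le_trans (ler_normD _ _))// normrN addrC.
by move=> h; move: (lt_le_trans kt h); rewrite ltrD2r.
Qed.

Lemma reflection_through a c x :
  reflection a (dot a c) x = c + reflection a 0 (x - c).
Proof.
by apply/rowP => i; rewrite /reflection subr0 dotDr dotNr !mxE; ring.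
Qed.

Lemma dot_reflection2 a x : a != 0 ->
  dot (reflection a 0 x) (reflection a 0 x) = dot x x.
Proof.
by move=> a0; rewrite -!sqr_enorm enorm_reflection.
Qed.

(** Otherwise the function would be invariant under the composition of two
    reflections in distinct parallel hyperplanes, that is, under a
    translation. *)
Lemma radial_center_on_mirror w a b c :
  (forall e : R, 0 < e -> compact [set x | e <= enorm (w x)]) ->
  (exists x, w x != 0) -> a != 0 ->
  radial_about w c -> (forall x, w (reflection a b x) = w x) ->
  dot a c = b.
Proof.
move=> cw [x0 wx0] a0 wc ws; apply/eqP/negPn/negP => cb.
have aa := dot_gt0 a0.
have ws' x : w (reflection a (dot a c) x) = w x.
  by apply: wc; rewrite reflection_through addrAC subrr add0r dot_reflection2.
pose t := (2 * (b - dot a c) / dot a a) *: a.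
have t0 : t != 0.
  rewrite scaler_eq0 negb_or a0 andbT; apply: mulf_neq0; last first.
    by rewrite invr_neq0// lt0r_neq0.
  by apply: mulf_neq0 => //; rewrite subr_eq0 eq_sym.
move/eqP: wx0; apply; apply: (@periodic_eq0 w setT t) => // x _; split => //.
rewrite -[RHS]ws' -[RHS]ws; congr w; apply/rowP => i.
rewrite /reflection !(dotDr, dotNr, dotZr) !mxE.
by field; exact: lt0r_neq0.
Qed.

Definition flip (k : nat) c x : 'rV[R]_N :=
  \row_i if (i < k)%N then 2 * c ord0 i - x ord0 i else x ord0 i.

Lemma delta_neq0 (k : 'I_N) : (delta_mx ord0 k : 'rV[R]_N) != 0.
Proof.
by apply/eqP => /rowP/(_ k)/eqP; rewrite !mxE !eqxx oner_eq0.
Qed.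

Lemma dot_delta_delta (k l : 'I_N) :
  dot (delta_mx ord0 k) (delta_mx ord0 l : 'rV[R]_N) = (k == l)%:R.
Proof. by rewrite dot_delta mxE. Qed.

Lemma reflection_delta (k : 'I_N) b x :
  reflection (delta_mx ord0 k) b x =
  \row_i if i == k then 2 * b - x ord0 k else x ord0 i.
Proof.
apply/rowP => i; rewrite /reflection dot_delta_delta eqxx divr1 dot_delta !mxE.
rewrite eqxx/=; case: eqP => [->|_]; first by rewrite mulr1; ring.
by rewrite mulr0 subr0.
Qed.

Variables (p : R) (g : 'I_m -> 'rV[R]_m -> R) (G : 'rV[R]_m -> R).
Variable X : set ('rV[R]_N -> 'rV[R]_m).
Hypothesis admX : admissible p g G X.
Hypothesis minimizer_C1 : forall u, P0_minimizer p G X u -> C1_class u.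
Hypothesis N_gt1 : (1 < N)%N.

(** The two foldings of a centrally symmetric function along a hyperplane
    through the center are exchanged by the central symmetry, so they have the
    same [V]. *)
Lemma central_fold w a c x : a != 0 -> (forall x, w (2 *: c - x) = w x) ->
  fold_neg a (dot a c) w x = fold_pos a (dot a c) w (- x + 2 *: c).
Proof.
move=> a0 wc; rewrite /fold_neg /fold_pos dotDr dotNr dotZr.
have -> : (dot a c <= - dot a x + 2 * dot a c) = (dot a x <= dot a c).
  by apply/idP/idP; lra.
case: ifP => _; first by rewrite addrC wc.
rewrite -[LHS]wc; congr w; apply/rowP => i.
by rewrite /reflection dotDr dotNr dotZr !mxE; ring.
Qed.

(** All hyperplanes through the center of symmetry split the constraint
    evenly, so that all derivatives tangent to the spheres vanish. *)
Lemma radial_of_central_symmetry u w c :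
  vanishing_minimizer p G X u w ->
  (forall x, w (2 *: c - x) = w x) -> radial_about w c.
Proof.
move=> uw wc.
have [[Xu nu Vu] umin] := vm_minimizer uw.
apply: radial_of_derivative => //.
  by move=> i; exact: (vm_C1 minimizer_C1 i uw).
move=> i x a; have [->|a0] := eqVneq a 0; first by rewrite derive0.
rewrite dotDr dotNr => /eqP; rewrite subr_eq0 => /eqP ax.
apply: (vm_derive_eq0 minimizer_C1 i a0 uw _ ax).
have Xp := admissible_fold_pos admX (dot a c) Xu a0.
have Xn := admissible_fold_neg admX (dot a c) Xu a0.
have sT := point_reflection_scales (2 *: c).
have VV : functionalV G (fold_neg a (dot a c) u) =
    functionalV G (fold_pos a (dot a c) u).
  have := Rintegral_scaling ltr01 sT measurableT (measurable_G admX Xp).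
  rewrite preimage_setT mul1r => VT.
  transitivity (\int[leb]_x G (fold_pos a (dot a c) u (- x + 2 *: c)));
    last exact: VT.
  apply: ae_eq_Rintegral.
  - exact: (measurable_G admX Xn).
  - by apply: (measurableT_comp (measurable_G admX Xp)); case: sT.
  have fold_ae T v (f f' : 'rV[R]_N -> T) b : v != 0 ->
      {ae leb, forall x, f x = f' x} ->
      {ae leb, forall x, fold_pos v b f x = fold_pos v b f' x}.
    move=> v0 ff'.
    apply: filterS2 ff' (ae_scaling (reflection_scales b v0) ff').
    by move=> y h1 h2; rewrite /fold_pos h1 h2.
  have Na0 : - a != 0 by rewrite oppr_eq0.
  have := fold_ae _ _ _ _ (- dot a c) Na0 (vm_ae uw).
  rewrite -!fold_negE => h1.
  have h2 := ae_scaling sT (fold_ae _ _ _ _ (dot a c) a0 (vm_ae uw)).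
  by apply: filterS2 h1 h2 => y -> ->; rewrite central_fold.
have V0 : functionalV G (fold_pos a (dot a c) u) = 0.
  have := functionalV_folds admX (dot a c) a0 Xu; rewrite VV Vu mulr0; lra.
have cw := vm_continuous uw.
have [y wy] := vm_neq0 uw.
have Na0 : - a != 0 by rewrite oppr_eq0.
have far v : v != 0 -> exists2 z, w z != 0 & dot v c < dot v z.
  move=> v0; have [vy|vy] := ltP (dot v c) (dot v y); first by exists y.
  have wy' : w (2 *: c - y) != 0 by rewrite wc.
  have [z wz hz] := neq0_beyond cw v0 wy'; exists z => //.
  by apply: le_lt_trans hz; rewrite dotDr dotNr dotZr; lra.
have n1 : nontrivial (fold_pos a (dot a c) u).
  by have [z wz hz] := far a a0; exact: (nontrivial_fold cw (vm_ae uw) wz hz).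
have n2 : nontrivial (fold_neg a (dot a c) u).
  rewrite fold_negE -dotNl.
  have [z wz hz] := far (- a) Na0.
  exact: (nontrivial_fold cw (vm_ae uw) wz hz).
by have [] := fold_minimizer admX (vm_minimizer uw) a0 V0 n1 n2.
Qed.

Hypothesis split : forall u w a, a != 0 -> vanishing_minimizer p G X u w ->
  exists b, vanishing_minimizer p G X (fold_pos a b u) (fold_pos a b w) /\
            vanishing_minimizer p G X (fold_neg a b u) (fold_neg a b w).

(** On the mirror, [w] coincides with both foldings, so it is invariant under
    the symmetries about [c1] and [c2], whose composition is the translation by
    [2 *: (c1 - c2)]. If the centers were distinct, [w] would vanish on the
    mirror. In dimension at least 2 the mirror meets all the spheres about
    [c1], and the positive folding would vanish everywhere. So the centers
    coincide, and the values of [w] on both sides are determined by those on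
    the mirror. *)
Lemma radial_of_folds w (k : 'I_N) b c1 c2 :
  let e := delta_mx ord0 k in
  (forall d : R, 0 < d -> compact [set x | d <= enorm (w x)]) ->
  (exists x, fold_pos e b w x != 0) ->
  dot e c1 = b -> dot e c2 = b ->
  radial_about (fold_pos e b w) c1 -> radial_about (fold_neg e b w) c2 ->
  radial_about w c1.
Proof.
move=> e cw [x0 fx0] c1b c2b r1 r2.
have fp x : b <= dot e x -> fold_pos e b w x = w x by rewrite /fold_pos => ->.
have fn x : dot e x <= b -> fold_neg e b w x = w x by rewrite /fold_neg => ->.
have [l lk] : exists l : 'I_N, l != k.
  have N0 : (0 < N)%N by exact: ltnW.
  have [k0|k0] := eqVneq (k : nat) 0%N.
    by exists (Ordinal N_gt1); rewrite -val_eqE/= k0.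
  by exists (Ordinal N0); rewrite -val_eqE/= eq_sym.
have on_plane c x : dot e c = b -> exists2 z, dot e z = b &
    dot (z - c) (z - c) = dot (x - c) (x - c).
  move=> cb; exists (c + enorm (x - c) *: delta_mx ord0 l).
    by rewrite dotDr dotZr dot_delta_delta eq_sym (negbTE lk) mulr0 addr0.
  rewrite addrAC subrr add0r dotZl dotZr dot_delta_delta eqxx mulr1.
  by rewrite -expr2 sqr_enorm.
have c12 : c1 = c2.
  apply/eqP/negPn/negP => c12.
  have t0 : 2 *: (c1 - c2) != 0.
    by rewrite scaler_eq0 negb_or pnatr_eq0 subr_eq0.
  have w0 := @periodic_eq0 w [set x | dot e x = b] _ cw t0.
  move/eqP: fx0; apply.
  have [z zb zx] := on_plane c1 x0 c1b.
  rewrite -(r1 z x0 zx) fp ?zb// w0// => x /= xb; split.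
    by rewrite dotDr dotZr dotDr dotNr c1b c2b xb; ring.
  have wr c (f := fun y => 2 *: c - y) : dot e c = b ->
      forall y, dot e y = b -> dot e (f y) = b.
    by move=> cb y yb; rewrite /f dotDr dotNr dotZr cb yb; ring.
  have sym c y : dot (2 *: c - y - c) (2 *: c - y - c) = dot (y - c) (y - c).
    rewrite (_ : 2 *: c - y - c = - (y - c)) ?dotNl ?dotNr ?opprK//.
    by apply/rowP => i; rewrite !mxE; ring.
  have y2b := wr c2 c2b _ xb.
  have := r2 _ _ (sym c2 x); rewrite !fn ?y2b ?xb// => E2.
  have := r1 _ _ (sym c1 (2 *: c2 - x)).
  rewrite !fp ?wr// => E1.
  rewrite -E2 -E1; congr w.
  by apply/rowP => i; rewrite !mxE; ring.
subst c2.
have wz x z : dot e z = b -> dot (z - c1) (z - c1) = dot (x - c1) (x - c1) ->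
    w x = w z.
  move=> zb zx; have [xb|xb] := leP b (dot e x).
    by rewrite -(fp x xb) -(r1 _ _ zx) fp// zb.
  by rewrite -(fn x (ltW xb)) -(r2 _ _ zx) fn// zb.
move=> x y xy; have [z zb zx] := on_plane c1 x c1b.
by rewrite (wz x z)// (wz y z)// zx.
Qed.

(** Downward induction on the number [k] of coordinates in which the minimizer
    is known to be symmetric: it is folded in the direction [k], which makes it
    symmetric in one more coordinate. For [k = N] the symmetry is central. *)
Lemma radial_of_flip d k c u w : (k + d)%N = N ->
  vanishing_minimizer p G X u w -> (forall x, w (flip k c x) = w x) ->
  exists c', radial_about w c'.
Proof.
elim: d k c u w => [|d IHd] k c u w kd uw wf.
  exists c; apply: (radial_of_central_symmetry uw) => x.
  rewrite -[RHS]wf; congr w; apply/rowP => i.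
  by rewrite !mxE -[k]addn0 kd ltn_ord.
have kN : (k < N)%N by rewrite -kd addnS ltnS leq_addr.
pose k' := Ordinal kN; pose e : 'rV[R]_N := delta_mx ord0 k'.
have e0 : e != 0 by exact: delta_neq0.
have [b [up un]] := split e0 uw.
(* The foldings have the additional symmetry in the coordinate [k], about the
   value [b] that defines the mirror. *)
pose c1 : 'rV[R]_N := \row_i if i == k' then b else c ord0 i.
have flipS x : flip k.+1 c1 x = reflection e b (flip k c x).
  rewrite /e reflection_delta; apply/rowP => i; rewrite !mxE ltnS leq_eqVlt.
  rewrite -[(i : nat) == k]/(i == k'); case: eqP => [->|//]/=.
  by rewrite ltnn.
have ek x : dot e (flip k c x) = dot e x.
  by rewrite /e !dot_delta mxE ltnn.
have rf x : reflection e b (flip k c x) = flip k c (reflection e b x).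
  rewrite /e !reflection_delta; apply/rowP => i; rewrite !mxE ltnn.
  by case: eqP => [->|//]; rewrite ltnn.
have ff x : fold_pos e b w (flip k.+1 c1 x) = fold_pos e b w x.
  by rewrite flipS fold_posK// /fold_pos ek rf !wf.
have ffn x : fold_neg e b w (flip k.+1 c1 x) = fold_neg e b w x.
  have e0' : - e != 0 by rewrite oppr_eq0.
  rewrite fold_negE flipS -reflectionNN fold_posK//.
  by rewrite -fold_negE /fold_neg ek rf !wf.
have kd' : (k.+1 + d)%N = N by rewrite addSnnS.
have [cp rp] := IHd _ _ _ _ kd' up ff.
have [cn rn] := IHd _ _ _ _ kd' un ffn.
have cpb : dot e cp = b.
  apply: (radial_center_on_mirror (vm_compact up) (vm_neq0 up) e0 rp) => x.
  exact: fold_posK.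
have cnb : dot e cn = b.
  apply: (radial_center_on_mirror (vm_compact un) (vm_neq0 un) e0 rn) => x.
  by rewrite fold_negE -reflectionNN fold_posK// oppr_eq0.
exists cp; exact: (radial_of_folds (vm_compact uw) (vm_neq0 up) cpb cnb rp rn).
Qed.

Lemma vanishing_minimizer_radial u w : vanishing_minimizer p G X u w ->
  exists c, radial_about w c.
Proof.
move=> uw; apply: (@radial_of_flip N 0 0 u w) => // x; congr w.
by apply/rowP => i; rewrite mxE.
Qed.

End symmetry.

Section vanishing_functions.
Context {R : realType} {N m : nat}.
Local Notation leb := (lebesgue_rV R N).
Implicit Types (u w : 'rV[R]_N -> 'rV[R]_m).

(** An a.e. bound for [u] on an open set is a pointwise bound for [w]. *)
Lemma vanishing_compact u w : (forall i, continuous (component i w)) ->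
  {ae leb, forall x, u x = w x} -> vanishes_at_infinity u ->
  forall e : R, 0 < e -> compact [set x | e <= enorm (w x)].
Proof.
move=> cw uw u0 e e0; have e2 : 0 < e / 2 by rewrite divr_gt0.
have [r ur] := u0 _ e2.
have cn : continuous (enorm : 'rV[R]_N -> R).
  apply: (@continuous_enorm R N N id) => i; exact: coord_continuous.
have cwn := continuous_enorm cw.
have wr x : r < enorm x -> enorm (w x) <= e / 2.
  move=> rx; rewrite leNgt; apply/negP => wx.
  have oU : open ([set x | r < enorm x] `&` [set x | e / 2 < enorm (w x)]).
    apply: openI.
      by move/continuousP : cn => /(_ [set t | r < t]); apply; exact: open_gt.
    by move/continuousP : cwn => /(_ [set t | e / 2 < t]); apply; exact: open_gt.
  have := ae_open_exists oU (conj rx wx) (filterI uw ur).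
  by move=> [y [/= ry wy] [uy /(_ ry)]]; rewrite uy ltNge (ltW wy).
apply: bounded_closed_compact.
  exists r; split; first exact: num_real.
  move=> M rM x /= ex; rewrite (le_trans (norm_le_enorm x))// ltW//.
  apply: le_lt_trans rM; rewrite leNgt; apply/negP => /wr; lra.
apply: (preimage_closed (D := [set y | e <= y])); last exact: closed_ge.
by move=> x _; exact: cwn.
Qed.

Lemma radial_about_radially_symmetric u w c : (0 < N)%N ->
  {ae leb, forall x, u x = w x} -> radial_about w c -> radially_symmetric u.
Proof.
move=> N0 uw wc; pose e : 'rV[R]_N := delta_mx ord0 (Ordinal N0).
exists c, (fun r => w (c + r *: e)); apply: filterS uw => x ->.
apply: wc; rewrite addrAC subrr add0r dotZl dotZr dot_delta_delta eqxx mulr1.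
by rewrite -expr2 sqr_enorm.
Qed.

(** As [m > 0], the origin is a limit of points of the punctured ball. *)
Lemma continuous_sign_at0 (h : 'rV[R]_m -> R) (eps : R) : (0 < m)%N ->
  continuous h -> 0 < eps -> (forall v, 0 < enorm v < eps -> 0 < h v) ->
  0 <= h 0.
Proof.
move=> m0 ch eps0 hpos; rewrite leNgt; apply/negP => h0.
have oU : open (h @^-1` [set y | y < 0]).
  by move/continuousP : ch; apply; exact: open_lt.
have /nbhs_ballP[d /= d0 dU] : nbhs (0 : 'rV[R]_m) (h @^-1` [set y | y < 0]).
  by apply: open_nbhs_nbhs.
pose t := Num.min d eps / 2.
have me0 : 0 < Num.min d eps by rewrite lt_min d0.
have t0 : 0 < t by rewrite divr_gt0.
have td : t < d.
  rewrite ltr_pdivrMr// (@le_lt_trans _ _ d)// ?ge_min ?lexx//.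
  by rewrite ltr_pMr// ltr1n.
have te : t < eps.
  rewrite ltr_pdivrMr// (@le_lt_trans _ _ eps)// ?ge_min ?lexx ?orbT//.
  by rewrite ltr_pMr// ltr1n.
pose v : 'rV[R]_m := t *: delta_mx ord0 (Ordinal m0).
have vE : enorm v = t.
  rewrite /v enormZ ?ltW// /enorm dot_delta mxE !eqxx/= sqrtr1 mulr1//.
have : 0 < h v by apply: hpos; rewrite vE t0.
rewrite ltNge => /negP; apply; apply/ltW/dU; rewrite -ball_normE/= sub0r normrN.
by apply: (le_lt_trans (norm_le_enorm v)); rewrite vE.
Qed.

End vanishing_functions.

Lemma minimizer_radially_symmetric (R : realType) (N m : nat) (p : R)
    (g : 'I_m -> 'rV[R]_m -> R) (G : 'rV[R]_m -> R)
    (X : set ('rV[R]_N -> 'rV[R]_m)) (eps : R) u :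
  admissible p g G X -> (forall z, P0_minimizer p G X z -> C1_class z) ->
  (1 < N)%N -> (0 < m)%N -> continuous G -> 0 < eps ->
  (forall v : 'rV[R]_m, 0 < enorm v < eps -> G v < 0) \/
  (forall v : 'rV[R]_m, 0 < enorm v < eps -> 0 < G v) ->
  P0_minimizer p G X u -> vanishes_at_infinity u -> radially_symmetric u.
Proof.
move=> admX C1 N_gt1 m_gt0 cG eps0 Gsign umin u_vanish.
have [s s0 sG] : exists2 s : R, s != 0 &
    forall v : 'rV[R]_m, 0 < enorm v < eps -> 0 < s * G v.
  have [h|h] := Gsign.
    by exists (-1) => [|v /h]; rewrite ?oppr_eq0 ?oner_eq0// mulN1r oppr_gt0.
  by exists 1 => [|v /h]; rewrite ?oner_eq0// mul1r.
have sG0 : 0 <= s * G 0.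
  apply: (@continuous_sign_at0 _ _ (fun v => s * G v) eps) => //.
  by move=> v; exact: (cvgM (cvg_cst _) (cG v)).
have [w [w1 uw]] := C1 _ umin.
have cw i : continuous (component i w) by exact: Ck_continuous (w1 i).
have vm : vanishing_minimizer p G X u w.
  by split=> //; exact: (vanishing_compact cw uw u_vanish).
have split := splitting_hyperplane admX eps0 s0 sG sG0.
have [c wc] := vanishing_minimizer_radial admX C1 N_gt1 split vm.
exact: (radial_about_radially_symmetric (ltnW N_gt1) uw wc).
Qed.

(** * Least energy solutions *)

Lemma ereal_inf_attained (R : realType) (T : Type) (A : set T) (f : T -> R)
    x k :
  A x -> f x = k -> (forall y, A y -> k <= f y) ->
  ereal_inf [set (f y)%:E | y in A] = k%:E.
Proof.
move=> Ax fx kf; apply/eqP; rewrite eq_le; apply/andP; split.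
  by apply: ereal_inf_lbound; exists x => //; rewrite fx.
by apply: le_ereal_inf_tmp => _ [y Ay <-]; rewrite lee_fin; exact: kf.
Qed.

Theorem proposition4 (R : realType) (N m : nat) (p : R)
    (g : 'I_m -> 'rV[R]_m -> R) (G : 'rV[R]_m -> R)
    (X : set ('rV[R]_N -> 'rV[R]_m))
    (m_ge1 : (1 <= m)%N) (p_gt1 : 1 < p) (pN : p = N%:R)
    (gG : potential g G) (admX : admissible p g G X)
    (T0_gt0 : (0 < ereal_inf [set (functionalJ p u)%:E | u in P0_set G X])%E)
    (P0_min : exists u0, P0_minimizer p G X u0)
    (P0_min_EL : forall u, P0_minimizer p G X u ->
      C1_class u /\
      exists2 alpha : R, 0 < alpha &
        weak_solution p (fun i v => alpha * g i v) u)
    (pohozaev : forall (alpha : R) u, 0 < alpha -> X u ->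
      weak_solution p (fun i v => alpha * g i v) u -> functionalV G u = 0) :
  [/\ exists u, least_energy_solution p g G X u,
      forall u, least_energy_solution p g G X u -> P0_minimizer p G X u &
      (exists2 eps : R, 0 < eps &
        (forall v : 'rV[R]_m, 0 < enorm v < eps -> G v < 0) \/
        (forall v : 'rV[R]_m, 0 < enorm v < eps -> 0 < G v)) ->
      forall u, least_energy_solution p g G X u -> vanishes_at_infinity u ->
        radially_symmetric u].
Proof.
have [u0 u0min] := P0_min.
have [_ u0le] := u0min.
have [_ [alpha a0 u0sol]] := P0_min_EL _ u0min.
have [u1 [u1sol Vu1 Ju1]] :=
  dilated_minimizer_solution admX p_gt1 pN u0min a0 u0sol.
have V0 z : nontrivial_solutions p g X z -> functionalV G z = 0.
  move=> [Xz _ gz]; apply: (pohozaev 1 z ltr01 Xz).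
  have -> : (fun i v => 1 * g i v) = g.
    by apply/funext => i; apply/funext => v; rewrite mul1r.
  exact: gz.
have Smin z : nontrivial_solutions p g X z ->
    functionalJ p u0 <= functionalS p G z.
  move=> gz; have Vz := V0 z gz; rewrite /functionalS Vz subr0.
  have [Xz nz _] := gz; exact: (u0le z (And3 Xz nz Vz)).
have Su1 : functionalS p G u1 = functionalJ p u0.
  by rewrite /functionalS Vu1 subr0.
have infE : ereal_inf [set (functionalS p G v)%:E |
    v in nontrivial_solutions p g X] = (functionalJ p u0)%:E.
  exact: (ereal_inf_attained u1sol Su1 Smin).
have least_min u : least_energy_solution p g G X u -> P0_minimizer p G X u.
  move=> [gu]; rewrite infE => SuE; have Su := EFin_inj SuE.
  have Vu := V0 u gu.
  have [Xu nu _] := gu; split; first exact: (And3 Xu nu Vu).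
  move=> v Sv; apply: le_trans (u0le v Sv).
  by move: Su; rewrite /functionalS Vu subr0 => ->.
split; [|exact: least_min|].
  by exists u1; split; [exact: u1sol|rewrite infE Su1].
move=> [eps eps0 Gsign] u /least_min umin u_vanish.
apply: (minimizer_radially_symmetric admX _ _ m_ge1 _ eps0 Gsign umin u_vanish).
- by move=> z /P0_min_EL[].
- by rewrite -(ltr_nat R) -pN.
- exact: (potential_continuous gG).
Qed.
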